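(* Let $A=\bigoplus_{i=0}^{\ell}A_i$ be a finite dimensional graded Iwanaga-Gorenstein algebra. If the degree $0$ subalgebra $A_0$ is of finite global dimension, then the Grothendieck group $K_0(\underline{\mathrm{CM}}^{\mathbb Z}A)$ of the triangulated category $\underline{\mathrm{CM}}^{\mathbb Z}A$ is free, and its rank is bounded above by $\ell|A_0|$: \[ \operatorname{rank} K_0(\underline{\mathrm{CM}}^{\mathbb Z}A)\le \ell\,|A_0|, \] where $|A_0|$ denotes the number of non-isomorphic simple $A_0$-modules.
   Context: Algebras are over a field $\mathbf k$; modules are right modules unless stated otherwise. A graded algebra is $A=\bigoplus_{i\ge 0}A_i$ (here $A_i=0$ for $i>\ell$). A graded algebra is Iwanaga-Gorenstein (IG) if it is graded Noetherian on both sides and has finite graded self-injective dimension on both sides. For a graded IG algebra $A$, a graded $A$-module $M$ is (graded) Cohen-Macaulay (CM) if it is finitely generated and $\operatorname{Ext}^n_A(M,A)=0$ for all $n\ge 1$. $\mathrm{CM}^{\mathbb Z}A$ is the category of graded CM modules with degree-preserving homomorphisms; it is a Frobenius category whose projective-injective objects are the finitely generated graded projective modules, and $\underline{\mathrm{CM}}^{\mathbb Z}A$ is its stable category, which is triangulated. *)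

(* Defs.v *)
From HB Require Import structures.
From mathcomp Require Import all_boot all_algebra all_field.
From mathcomp Require Import boolp.
From mathcomp.multinomials Require Import freeg.

Set Implicit Arguments.
Unset Strict Implicit.
Unset Printing Implicit Defensive.

Import GRing.Theory Num.Theory.
Local Open Scope ring_scope.

(* The opposite algebra.  Left A-modules are right A^c-modules. *)
Section Opposite.
Variables (k : fieldType) (A : falgType k).

HB.instance Definition _ := Vector.copy A^c A.

Fact converse_scalerAl (a : k) (x y : A^c) :
  a *: (x * y) = (a *: x : A^c) * y.
Proof. exact: (scalerAr a (y : A) (x : A)). Qed.

Fact converse_scalerAr (a : k) (x y : A^c) :
  a *: (x * y) = x * (a *: y : A^c).
Proof. exact: (scalerAl a (y : A) (x : A)). Qed.

HB.instance Definition _ :=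
  GRing.Lmodule_isLalgebra.Build k A^c converse_scalerAl.
HB.instance Definition _ :=
  GRing.Lalgebra_isAlgebra.Build k A^c converse_scalerAr.
HB.instance Definition _ := Falgebra.on A^c.

End Opposite.

(* The algebras below are finite dimensional, so a module is finitely         *)
(* generated iff it is finite dimensional: rmodule B is the class of finitely *)
(* generated right B-modules, and projectivity and injectivity are tested in  *)
(* the category of finitely generated modules.  The structure carried by a    *)
(* vector space V is kept apart from V because K0 below needs the small type  *)
(* of structures on the spaces k^n.                                           *)
Section Modules.
Variables (k : fieldType) (B : falgType k).

Record rmod_on (V : vectType k) := RModOn {
  ract : V -> B -> V;
  ract_linearl : forall b, linear (ract^~ b);
  ract_linearr : forall m, linear (ract m);
  ract1 : forall m, ract m 1 = m;
  ractM : forall m a b, ract m (a * b) = ract (ract m a) b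
}.

Record rmodule := RModule {
  carrier :> vectType k;
  rmod_str :> rmod_on carrier
}.

Definition mod_hom (M N : rmodule) (f : 'Hom(M, N)) : Prop :=
  forall m b, f (ract M m b) = ract N (f m) b.

Definition mod_iso (M N : rmodule) : Prop :=
  exists f : 'Hom(M, N), [/\ mod_hom f, lker f = 0%VS & limg f = fullv].

Definition simple_mod (M : rmodule) : Prop :=
  (fullv : {vspace M}) <> 0%VS /\
  forall U : {vspace M}, (forall m b, m \in U -> ract M m b \in U) ->
    U = 0%VS \/ U = fullv.

(* |B| = r *)
Definition has_num_simples (r : nat) : Prop :=
  exists S : 'I_r -> rmodule,
    [/\ forall i, simple_mod (S i),
        forall i j, mod_iso (S i) (S j) -> i = j
      & forall M, simple_mod M -> exists i, mod_iso M (S i)].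

Definition projective_mod (P : rmodule) : Prop :=
  forall (M N : rmodule) (p : 'Hom(M, N)) (f : 'Hom(P, N)),
    mod_hom p -> limg p = fullv -> mod_hom f ->
    exists2 g : 'Hom(P, M), mod_hom g & (p \o g)%VF = f.

Definition proj_resolution (M : rmodule) (P : nat -> rmodule)
    (d : forall n, 'Hom(P n.+1, P n)) (e : 'Hom(P 0%N, M)) : Prop :=
  [/\ forall n, projective_mod (P n),
      (forall n, mod_hom (d n)) /\ mod_hom e,
      limg e = fullv,
      limg (d 0%N) = lker e
    & forall n, limg (d n.+1) = lker (d n)].

Definition finite_gldim : Prop :=
  exists D : nat, forall M : rmodule,
  exists (P : nat -> rmodule) (d : forall n, 'Hom(P n.+1, P n))
         (e : 'Hom(P 0%N, M)),
    proj_resolution d e /\ forall n, (D < n)%N -> (fullv : {vspace P n}) = 0%VS.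

(* Ext^(n+1)(M, N) = 0: in the complex Hom_B(P, N) every cocycle of degree    *)
(* n + 1 is a coboundary, P being any projective resolution of M.             *)
Definition ExtS_eq0 (n : nat) (M N : rmodule) : Prop :=
  forall (P : nat -> rmodule) (d : forall n, 'Hom(P n.+1, P n))
         (e : 'Hom(P 0%N, M)), proj_resolution d e ->
  forall f : 'Hom(P n.+1, N), mod_hom f -> (f \o d n.+1)%VF = 0 ->
    exists2 g : 'Hom(P n, N), mod_hom g & (g \o d n)%VF = f.

Definition regular_on : rmod_on B.
Proof.
apply: (@RModOn B *%R).
- by move=> b a x y; rewrite mulrDl scalerAl.
- by move=> m a x y; rewrite mulrDr scalerAr.
- exact: mulr1.
- exact: mulrA.
Defined.

Definition regular_mod : rmodule := RModule regular_on.

End Modules.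

Definition is_grading (k : fieldType) (V : vectType k)
    (U : int -> {vspace V}) : Prop :=
  exists s : seq int,
    [/\ uniq s, forall i, i \notin s -> U i = 0%VS,
        (\sum_(i <- s) U i)%VS = fullv & directv (\sum_(i <- s) U i)].

(* A = A_0 + ... + A_l, with A_i = 0 for i < 0 and for i > l *)
Record grading (k : fieldType) (A : falgType k) (l : nat) := Grading {
  homog :> int -> {vspace A};
  homog_out : forall i, (i < 0) || (l%:Z < i) -> homog i = 0%VS;
  homog_dec : is_grading homog;
  homog1 : 1 \in homog 0;
  homogM : forall i j, (homog i * homog j <= homog (i + j))%VS
}.

Section GradedAlgebra.
Variables (k : fieldType) (A : falgType k) (l : nat) (gr : grading A l).

Definition opposite_grading : grading A^c l.
Proof.
apply: (@Grading k A^c l (gr : int -> {vspace A})).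
- exact: (homog_out gr).
- exact: (homog_dec gr).
- exact: (homog1 gr).
move=> i j; apply/prodvP => a b ai bj.
rewrite addrC; apply: (subvP (homogM gr j i)).
exact: (@memv_mul k A _ _ (b : A) (a : A)).
Defined.

Fact degree0_is_aspace : is_aspace (gr 0).
Proof.
by rewrite /is_aspace has_algid1 ?homog1 //= -{3}[0]addr0 homogM.
Qed.

Definition degree0 : {aspace A} := ASpace degree0_is_aspace.

Record grmod_on (V : vectType k) := GrModOn {
  grmod_rmod :> rmod_on A V;
  gdeg : int -> {vspace V};
  gdeg_dec : is_grading gdeg;
  gdegM : forall i j m a,
    m \in gdeg i -> a \in gr j -> ract grmod_rmod m a \in gdeg (i + j)
}.

Record grmodule := GrModule {
  gcarrier : vectType k;
  grmod_str :> grmod_on gcarrier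
}.

Coercion grmodule_rmodule (M : grmodule) : rmodule A := RModule (grmod_str M).

Definition gr_hom (M N : grmodule) (f : 'Hom(M, N)) : Prop :=
  mod_hom f /\ forall i, (f @: gdeg M i <= gdeg N i)%VS.

Definition gr_projective (P : grmodule) : Prop :=
  forall (M N : grmodule) (p : 'Hom(M, N)) (f : 'Hom(P, N)),
    gr_hom p -> limg p = fullv -> gr_hom f ->
    exists2 g : 'Hom(P, M), gr_hom g & (p \o g)%VF = f.

Definition gr_injective (I : grmodule) : Prop :=
  forall (M N : grmodule) (u : 'Hom(M, N)) (f : 'Hom(M, I)),
    gr_hom u -> lker u = 0%VS -> gr_hom f ->
    exists2 g : 'Hom(N, I), gr_hom g & (g \o u)%VF = f.

Definition finite_gr_injdim (M : grmodule) : Prop :=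
  exists (D : nat) (I : nat -> grmodule) (d : forall n, 'Hom(I n, I n.+1))
         (e : 'Hom(M, I 0%N)),
    [/\ forall n, gr_injective (I n),
        (forall n, gr_hom (d n)) /\ gr_hom e,
        lker e = 0%VS /\ limg e = lker (d 0%N),
        forall n, limg (d n) = lker (d n.+1)
      & forall n, (D < n)%N -> (fullv : {vspace I n}) = 0%VS].

Definition gr_regular_on : grmod_on A.
Proof.
apply: (@GrModOn A (regular_on A) gr); first exact: (homog_dec gr).
by move=> i j m a mi aj; apply: (subvP (homogM gr i j)); apply: memv_mul.
Defined.

Definition gr_regular : grmodule := GrModule gr_regular_on.

Definition gr_right_ideal (I : {vspace A}) : Prop :=
  (I * fullv <= I)%VS /\ I = (\sum_(i < l.+1) (I :&: gr i%:Z))%VS.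

Definition gr_right_noetherian : Prop :=
  forall I : nat -> {vspace A},
    (forall n, gr_right_ideal (I n)) -> (forall n, (I n <= I n.+1)%VS) ->
    exists N, forall n, (N <= n)%N -> I n = I N.

End GradedAlgebra.

Definition iwanaga_gorenstein (k : fieldType) (A : falgType k) (l : nat)
    (gr : grading A l) : Prop :=
  [/\ gr_right_noetherian gr,
      gr_right_noetherian (opposite_grading gr),
      finite_gr_injdim (gr_regular gr)
    & finite_gr_injdim (gr_regular (opposite_grading gr))].

Section StableCategory.
Variables (k : fieldType) (A : falgType k) (l : nat) (gr : grading A l).

Record cm_on (V : vectType k) := CMOn {
  cm_grmod :> grmod_on gr V;
  cm_Ext : forall n, ExtS_eq0 n (RModule cm_grmod) (regular_mod A)
}.

Record cm_module := CMModule {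
  cm_carrier : vectType k;
  cm_str :> cm_on cm_carrier
}.

Coercion cm_grmodule (X : cm_module) : grmodule gr := GrModule (cm_str X).

Definition conflation (X Y Z : cm_module) (i : 'Hom(X, Y)) (p : 'Hom(Y, Z)) :=
  [/\ gr_hom i, gr_hom p, lker i = 0%VS, limg i = lker p & limg p = fullv].

(* equality of morphisms in the stable category *)
Definition stable_eq (X Y : cm_module) (f g : 'Hom(X, Y)) : Prop :=
  exists (P : cm_module) (a : 'Hom(X, P)) (b : 'Hom(P, Y)),
    [/\ gr_projective P, gr_hom a, gr_hom b & f - g = (b \o a)%VF].

Definition stable_isom (X Y : cm_module) (f : 'Hom(X, Y)) : Prop :=
  gr_hom f /\ exists g : 'Hom(Y, X),
    [/\ gr_hom g, stable_eq (g \o f)%VF \1%VF & stable_eq (f \o g)%VF \1%VF].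

(* A conflation X -> I -> S with I projective-injective exhibits S as the     *)
(* suspension of X.  No functorial choice is made: exact_triangle below is    *)
(* stated for an arbitrary suspension of the first vertex.                    *)
Record suspension (X : cm_module) := Suspension {
  susp_hull : cm_module;
  susp : cm_module;
  susp_in : 'Hom(X, susp_hull);
  susp_out : 'Hom(susp_hull, susp);
  susp_proj : gr_projective susp_hull;
  susp_conflation : conflation susp_in susp_out
}.

(* t represents the suspension of a in the stable category *)
Definition susp_hom (X X' : cm_module) (s : suspension X) (s' : suspension X')
    (a : 'Hom(X, X')) (t : 'Hom(susp s, susp s')) : Prop :=
  gr_hom t /\ exists h : 'Hom(susp_hull s, susp_hull s'),
    [/\ gr_hom h, (h \o susp_in s = susp_in s' \o a)%VF
      & (t \o susp_out s = susp_out s' \o h)%VF].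

Definition pushout (X Y I C : cm_module) (f : 'Hom(X, Y)) (i : 'Hom(X, I))
    (v : 'Hom(Y, C)) (j : 'Hom(I, C)) : Prop :=
  [/\ gr_hom v, gr_hom j, (v \o f = j \o i)%VF
    & forall (T : cm_module) (a : 'Hom(Y, T)) (b : 'Hom(I, T)),
        gr_hom a -> gr_hom b -> (a \o f = b \o i)%VF ->
        exists! c : 'Hom(C, T), [/\ gr_hom c, (c \o v = a)%VF & (c \o j = b)%VF]].

(* Happel's standard triangles X -> Y -> C -> SX: C is the pushout of f along *)
(* X -> I, and w is the morphism induced by 0 : Y -> S and I -> S.            *)
Definition standard_triangle (X Y C : cm_module) (s : suspension X)
    (f : 'Hom(X, Y)) (v : 'Hom(Y, C)) (w : 'Hom(C, susp s)) : Prop :=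
  [/\ gr_hom f, gr_hom w
    & exists j : 'Hom(susp_hull s, C),
        [/\ pushout f (susp_in s) v j, (w \o v = 0)%VF
          & (w \o j = susp_out s)%VF]].

Definition exact_triangle (X Y Z : cm_module) (s : suspension X)
    (u : 'Hom(X, Y)) (v : 'Hom(Y, Z)) (w : 'Hom(Z, susp s)) : Prop :=
  [/\ gr_hom u, gr_hom v, gr_hom w
    & exists (X' Y' Z' : cm_module) (s' : suspension X')
             (u' : 'Hom(X', Y')) (v' : 'Hom(Y', Z')) (w' : 'Hom(Z', susp s'))
             (a : 'Hom(X', X)) (b : 'Hom(Y', Y)) (c : 'Hom(Z', Z))
             (t : 'Hom(susp s', susp s)),
        [/\ standard_triangle u' v' w',
            [/\ stable_isom a, stable_isom b & stable_isom c],
            susp_hom a t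
          & [/\ stable_eq (u \o a)%VF (b \o u')%VF,
                stable_eq (v \o b)%VF (c \o v')%VF
              & stable_eq (w \o c)%VF (t \o w')%VF]]].

(* cm_module is too large (as a universe) to generate a zmodType, but every   *)
(* CM module is isomorphic to one with underlying vector space k^n.  These    *)
(* form a small type meeting every isomorphism class, and generate K0.        *)
Record cm_coord := CMCoord {
  coord_dim : nat;
  coord_str : cm_on 'rV[k]_coord_dim
}.

Coercion cm_of_coord (X : cm_coord) : cm_module := CMModule (coord_str X).

HB.instance Definition _ := gen_eqMixin cm_coord.
HB.instance Definition _ := gen_choiceMixin cm_coord.

Definition free_K0 : zmodType := {freeg cm_coord / int}.

Definition gen (X : cm_coord) : free_K0 := [freeg [:: (1, X)]].

Inductive K0_relator : free_K0 -> Prop :=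
| K0_isom (X Y : cm_coord) (f : 'Hom(X, Y)) : stable_isom f -> K0_relator (gen X - gen Y)
| K0_triangle (X Y Z : cm_coord) (s : suspension X) (u : 'Hom(X, Y)) (v : 'Hom(Y, Z))
    (w : 'Hom(Z, susp s)) :
    exact_triangle u v w -> K0_relator (gen X - gen Y + gen Z).

Definition K0_relations : {pred free_K0} := fun x =>
  `[< forall H : {pred free_K0}, zmod_closed H ->
        (forall y, K0_relator y -> y \in H) -> x \in H >].

Fact K0_relations_closed : zmod_closed K0_relations.
Proof.
split.
  by apply/asboolP => H cH _; case: cH.
move=> x y /asboolP xR /asboolP yR; apply/asboolP => H cH HR.
by case: (cH) => _; apply; [apply: xR | apply: yR].
Qed.

HB.instance Definition _ :=
  GRing.isZmodClosed.Build free_K0 K0_relations K0_relations_closed.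

Definition K0 : zmodType := ring_quotient.Quotient.quot K0_relations.

End StableCategory.

Definition is_basis (G : zmodType) (n : nat) (b : 'I_n -> G) : Prop :=
  forall x : G, exists! c : {ffun 'I_n -> int}, x = \sum_i b i *~ c i.

(* Main.v *)
(* Let S_j be the simple A_0-modules and let F be the free abelian group on    *)
(* the graded simple A-modules S_j(i), i an integer; every finitely generated  *)
(* graded module X has a class [X] in F.  Finite injective dimension of A      *)
(* makes the N-th syzygy of every graded module Cohen-Macaulay for N large, so *)
(* psi(X) = (-1)^N [Omega^N X] is an additive function on all graded modules   *)
(* with values in K_0; it kills every module of finite projective dimension    *)
(* and it restricts to the tautological class on Cohen-Macaulay modules.       *)
(* Hence psi induces a map from F onto K_0, and                                *)
(* K_0 embeds in F / C where C is spanned by the classes of the indecomposable *)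
(* projectives P_j(i).                                                         *)
(* The degree 0 part of [P_j] is the Cartan matrix of A_0, which is unimodular *)
(* as A_0 has finite global dimension.  Looking at lowest degrees, n D in C    *)
(* implies D in C, so K_0 is torsion free.  Modulo the relation psi(P_j(i)) =  *)
(* 0 the S_j(i) are combinations of the S_j'(i + 1), ..., S_j'(i + l).  The    *)
(* injectives I_j = D(A e_j) have finite projective dimension, because A has   *)
(* finite injective dimension as a left module, so psi(I_j(i)) = 0 expresses   *)
(* the S_j(i) through the S_j'(i - 1), ..., S_j'(i - l).  Therefore the        *)
(* l |A_0| classes of the S_j(i) with 0 <= i < l generate K_0.                 *)

Require Import Defs.
From mathcomp Require Import all_boot all_algebra all_field.
From HB Require Import structures.
From mathcomp Require Import all_order.
From mathcomp Require Import boolp.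
From mathcomp.multinomials Require Import freeg.
From mathcomp Require Import zify ring.

Set Implicit Arguments.
Unset Strict Implicit.
Unset Printing Implicit Defensive.

Import GRing.Theory Num.Theory Order.TTheory.
Local Open Scope ring_scope.

(** The class of a Cohen-Macaulay module is extended to all graded modules, where composition
    factors determine everything. Finite right injective dimension of [A] makes high syzygies
    Cohen-Macaulay ([CM_omega]), so the class in K_0, up to a sign, extends to a function [psi] that
    is additive on short exact sequences and kills projectives ([psi_exists]). This rests on two
    facts: a short exact sequence of Cohen-Macaulay modules gives an exact triangle
    ([triangle_exact]), and the class changes sign under syzygies ([cls_syz]).

    Conversely, composition multiplicities define [cl], with values in the free group [F] on the
    graded simples. An additive function carries the K_0 relations into any subgroup containing its
    values on projectives ([K0_lift_relations]), so [cl] descends to a map from K_0 to [F] modulo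
    the image of [cartan_map]. Since [psi] factors through [cl], this map is injective
    ([kpi_simple_lift], [simple_lift_cartan_map]).

    Torsion-freeness thus reduces to purity of the image of [cartan_map] ([cartan_map_pure]). That
    map is a convolution whose lowest coefficient is the Cartan matrix of A_0. Finite projective
    resolutions of the simple A_0-modules invert this matrix over the integers ([cartan0_unit]), and
    divisibility then propagates degree by degree.

    For the rank, [psi] vanishes on P_j(i), which lives in degrees i to i + l, and on I_j(i), which
    lives in degrees i - l to i and has finite projective dimension by duality with the left
    injective dimension ([pdim_coreg], [Ij_pdim]). Both relations have unimodular coefficients in
    degree i, so they carry every simple class into the window 0 <= i < l ([psi_simples_closed]).
    This leaves l * r generators, and a torsion-free group has a basis no larger than a finite
    generating family ([torsion_free_basis]). *)

Section MakeLinear.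
Variables (k : fieldType) (V W : vectType k).

Definition lfun_of (f : V -> W) (hf : linear f) : 'Hom(V, W) :=
  linfun (HB.pack_for {linear V -> W} f (GRing.isLinear.Build k V W _ f hf)).

Lemma lfun_ofE f hf : @lfun_of f hf =1 f.
Proof. by move=> x; rewrite /lfun_of lfunE. Qed.

End MakeLinear.

Lemma lker_eq0P (k : fieldType) (V W : vectType k) (f : 'Hom(V, W)) :
  lker f = 0%VS <-> injective f.
Proof. by split=> [/eqP/lker0P | /lker0P/eqP]. Qed.

Lemma limg_fullP (k : fieldType) (V W : vectType k) (f : 'Hom(V, W)) :
  limg f = fullv <-> forall y, exists x, f x = y.
Proof.
split=> [fE y | fS].
  have : y \in limg f by rewrite fE memvf.
  by case/memv_imgP => x _ ->; exists x.
by apply/vspaceP => y; rewrite memvf; case: (fS y) => x <-; rewrite memv_img ?memvf.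
Qed.

(** * Homological algebra of vector spaces with operators *)

(* Ungraded A-modules are spaces with operators indexed by A; graded A-modules *)
(* are spaces with operators indexed by A + int, an integer acting as the      *)
(* projection on the component of that degree.  In both cases all linear maps  *)
(* commuting with the operators are the homomorphisms, and the modules form a  *)
(* [variety] among the spaces with operators.                                  *)
Section OperatorModules.
Variables (k : fieldType) (O : Type).

Record omod := OMod { ocar :> vectType k; oact : O -> 'End(ocar) }.
Implicit Types L M N P Q K T : omod.

Definition ohom M N (f : 'Hom(M, N)) : Prop :=
  forall o m, f (oact M o m) = oact N o (f m).

Lemma ohom_id M : ohom (\1%VF : 'Hom(M, M)).
Proof. by move=> o m; rewrite !id_lfunE. Qed.

Lemma ohom_comp M N P (f : 'Hom(N, P)) (g : 'Hom(M, N)) :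
  ohom f -> ohom g -> ohom (f \o g)%VF.
Proof. by move=> hf hg o m; rewrite !comp_lfunE hg hf. Qed.

Lemma ohom0 M N : ohom (0 : 'Hom(M, N)).
Proof. by move=> o m; rewrite !zero_lfunE linear0. Qed.

Lemma ohomD M N (f g : 'Hom(M, N)) : ohom f -> ohom g -> ohom (f + g).
Proof. by move=> hf hg o m; rewrite !add_lfunE hf hg linearD. Qed.

Lemma ohomN M N (f : 'Hom(M, N)) : ohom f -> ohom (- f).
Proof. by move=> hf o m; rewrite !opp_lfunE hf linearN. Qed.

Lemma ohomB M N (f g : 'Hom(M, N)) : ohom f -> ohom g -> ohom (f - g).
Proof. by move=> hf hg; apply: ohomD => //; apply: ohomN. Qed.

Definition surj M N (f : 'Hom(M, N)) := forall y, exists x, f x = y.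

Definition odim M := dim (ocar M).

(** The lift is [f] followed by the linear pseudo-inverse of [i]; injectivity of [i] makes it
    commute with the operators. *)
Lemma factor_mono N M K (i : 'Hom(K, M)) (f : 'Hom(N, M)) :
  ohom i -> injective i -> ohom f -> (forall x, exists y, f x = i y) ->
  exists2 h : 'Hom(N, K), ohom h & forall x, i (h x) = f x.
Proof.
move=> hi ii hf fi.
have ih x : i ((i^-1 \o f)%VF x) = f x.
  rewrite comp_lfunE limg_lfunVK //; case: (fi x) => y ->.
  by rewrite memv_img ?memvf.
exists (i^-1 \o f)%VF => // o m; apply: ii.
by rewrite hi !ih hf.
Qed.

(** The pseudo-inverse of [p] is a linear section. Since [g] kills the kernel of [p], composing [g]
    with that section does not depend on it and commutes with the operators. *)
Lemma factor_epi M N T (p : 'Hom(M, N)) (g : 'Hom(M, T)) :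
  ohom p -> surj p -> ohom g -> (forall x, p x = 0 -> g x = 0) ->
  exists2 h : 'Hom(N, T), ohom h & forall x, h (p x) = g x.
Proof.
move=> hp ps hg pg.
have hpx x : (g \o p^-1)%VF (p x) = g x.
  rewrite comp_lfunE; apply/eqP; rewrite -subr_eq0 -linearB; apply/eqP/pg.
  by rewrite linearB /= limg_lfunVK ?memv_img ?memvf // subrr.
exists (g \o p^-1)%VF => // o m; case: (ps m) => x <-.
by rewrite -hp !hpx hg.
Qed.

Definition stable M (U : {vspace M}) :=
  forall o m, m \in U -> oact M o m \in U.

Lemma sub_exists M (U : {vspace M}) : stable U ->
  exists N (i : 'Hom(N, M)), [/\ ohom i, injective i
    & forall x, x \in U <-> exists y, x = i y].
Proof.
move=> sU.
pose v : 'Hom(subvs_of U, M) := linfun vsval.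
exists (OMod (fun o => (linfun (vsproj U) \o oact M o \o v)%VF)), v.
have vE x : v x = vsval x by rewrite lfunE.
split=> [o m | x y | x].
- rewrite /= !comp_lfunE /v !lfunE /= vsprojK //; exact/sU/subvsP.
- by rewrite !vE => /subvs_inj.
split=> [xU | [y ->]]; last by rewrite vE subvsP.
by exists (vsproj U x); rewrite vE vsprojK.
Qed.

(** The quotient is realised on a complement of [U], the image of [\1 - projv U]; the operators are
    carried over along a linear section. *)
Lemma quot_exists M (U : {vspace M}) : stable U ->
  exists N (p : 'Hom(M, N)), [/\ ohom p, surj p
    & forall x, p x = 0 <-> x \in U].
Proof.
move=> sU.
pose f : 'End(ocar M) := (\1 - projv U)%VF.
pose p : 'Hom(M, subvs_of (limg f)) := (linfun (vsproj (limg f)) \o f)%VF.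
have fU x : f x = 0 <-> x \in U.
  rewrite add_lfunE opp_lfunE id_lfunE; split=> [/eqP | xU]; last by rewrite projv_id ?subrr.
  by rewrite subr_eq0 => /eqP ->; apply: memv_proj.
have pU x : p x = 0 <-> x \in U.
  rewrite -fU comp_lfunE lfunE /=; split=> [/(congr1 vsval) | ->]; last exact: linear0.
  by rewrite vsprojK ?memv_img ?memvf.
have ps y : exists x, p x = y.
  case/memv_imgP: (subvsP y) => x _ yE; exists x.
  by rewrite comp_lfunE lfunE /= -yE vsvalK.
exists (OMod (fun o => (p \o oact M o \o p^-1)%VF)), p; split=> // o m.
have pst x : p x = 0 -> p (oact M o x) = 0 by move=> /pU xU; apply/pU/sU.
rewrite /= !(@comp_lfunE _ _ _ _ _ (p^-1)%VF) !(@comp_lfunE _ _ _ _ p).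
apply/eqP; rewrite -subr_eq0 -!linearB; apply/eqP/pst.
by rewrite linearB /= limg_lfunVK ?memv_img ?memvf ?subrr.
Qed.

Lemma stable_lker M N (f : 'Hom(M, N)) : ohom f -> stable (lker f).
Proof. by move=> hf o m; rewrite !memv_ker hf => /eqP ->; rewrite linear0. Qed.

Lemma stable_limg M N (f : 'Hom(M, N)) : ohom f -> stable (limg f).
Proof.
by move=> hf o m /memv_imgP[x _ ->]; rewrite -hf memv_img ?memvf.
Qed.

Record ses M' M M'' (i : 'Hom(M', M)) (p : 'Hom(M, M'')) : Prop := Ses {
  ses_hi : ohom i;
  ses_hp : ohom p;
  ses_inj : injective i;
  ses_surj : surj p;
  ses_pi : forall x, p (i x) = 0;
  ses_ex : forall y, p y = 0 -> exists x, y = i x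
}.

Lemma ses_inj0 M' M M'' (i : 'Hom(M', M)) (p : 'Hom(M, M'')) x :
  ses i p -> i x = 0 -> x = 0.
Proof. by move=> s ix; apply: (ses_inj s); rewrite ix linear0. Qed.

Lemma ker_exists M N (p : 'Hom(M, N)) : ohom p -> surj p ->
  exists K (i : 'Hom(K, M)), ses i p.
Proof.
move=> hp ps; case: (sub_exists (stable_lker hp)) => K [i [hi ii iE]].
exists K, i; split=> // [x | y py].
  by apply/eqP; rewrite -memv_ker; apply/iE; exists x.
by apply/iE; rewrite memv_ker py.
Qed.

Lemma coker_exists M N (i : 'Hom(M, N)) : ohom i -> injective i ->
  exists (C : omod) (p : 'Hom(N, C)), ses i p.
Proof.
move=> hi ii; case: (quot_exists (stable_limg hi)) => C [p [hp ps pE]].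
exists C, p; split=> // [x | y /pE /memv_imgP[x _ ->]]; last by exists x.
by apply/pE; rewrite memv_img ?memvf.
Qed.

Lemma img_exists M N (f : 'Hom(M, N)) : ohom f ->
  exists (I : omod) (p : 'Hom(M, I)) (i : 'Hom(I, N)),
    [/\ ohom p, surj p, ohom i, injective i & forall x, i (p x) = f x].
Proof.
move=> hf; case: (sub_exists (stable_limg hf)) => I [i [hi ii iE]].
have [|p hp ip] := factor_mono hi ii hf.
  by move=> x; apply/iE; rewrite memv_img ?memvf.
exists I, p, i; split=> // y.
have /iE/memv_imgP[x _ yx] : exists z, i y = i z by exists y.
by exists x; apply: ii; rewrite ip.
Qed.

Lemma odim_inj M N (f : 'Hom(M, N)) : injective f -> (odim M <= odim N)%N.
Proof.
move/lker0P/eqP => f0; rewrite /odim -!dimvf.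
have <- : \dim (limg f) = \dim {:M} by apply: limg_dim_eq; rewrite f0 capv0.
exact/dimvS/subvf.
Qed.

Lemma ses_dim M' M M'' (i : 'Hom(M', M)) (p : 'Hom(M, M'')) :
  ses i p -> odim M = (odim M' + odim M'')%N.
Proof.
move=> s; rewrite /odim -!dimvf -(limg_ker_dim p) capfv.
have -> : limg p = fullv by apply/limg_fullP/ses_surj/s.
have -> : lker p = limg i.
  apply/vspaceP => y; rewrite memv_ker; apply/eqP/memv_imgP => [py | [x _ ->]].
    by case: (ses_ex s py) => x ->; exists x => //; rewrite memvf.
  exact: (ses_pi s).
congr (_ + _)%N; apply: limg_dim_eq.
by have /lker0P/eqP -> := ses_inj s; rewrite capv0.
Qed.

Lemma odim0 M : odim M = 0%N -> forall x : M, x = 0.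
Proof.
move=> d0 x; apply/eqP; rewrite -memv0.
suff <- : (fullv : {vspace M}) = 0%VS by apply: memvf.
by apply/eqP; rewrite -dimv_eq0 dimvf; apply/eqP.
Qed.

Definition ozero : omod := OMod (fun o : O => (0 : 'End('rV[k]_0))).

Lemma ozero_eq0 (x : ozero) : x = 0.
Proof. exact: thinmx0. Qed.

Section Sum.
Variables M N : omod.

Fact osum_act_linear o : linear
  (fun x : (M * N)%type => (oact M o x.1, oact N o x.2)).
Proof. by move=> a x y /=; rewrite !linearP. Qed.

Definition osum := @OMod (M * N)%type (fun o => lfun_of (osum_act_linear o)).

Fact inl_linear : linear (fun x : M => (x, 0 : N) : (M * N)%type).
Proof. by move=> a x y; apply: injective_projections; rewrite //= scaler0 addr0. Qed.
Fact inr_linear : linear (fun x : N => (0 : M, x) : (M * N)%type).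
Proof. by move=> a x y; apply: injective_projections; rewrite //= scaler0 addr0. Qed.
Fact fst_lin : linear (fun x : (M * N)%type => x.1).
Proof. by []. Qed.
Fact snd_lin : linear (fun x : (M * N)%type => x.2).
Proof. by []. Qed.

Definition oinl : 'Hom(M, osum) := lfun_of inl_linear.
Definition oinr : 'Hom(N, osum) := lfun_of inr_linear.
Definition ofst : 'Hom(osum, M) := lfun_of fst_lin.
Definition osnd : 'Hom(osum, N) := lfun_of snd_lin.

Lemma oinlE x : oinl x = (x, 0). Proof. exact: lfun_ofE. Qed.
Lemma oinrE x : oinr x = (0, x). Proof. exact: lfun_ofE. Qed.
Lemma ofstE x : ofst x = x.1. Proof. exact: lfun_ofE. Qed.
Lemma osndE x : osnd x = x.2. Proof. exact: lfun_ofE. Qed.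
Lemma osum_actE o x : oact osum o x = (oact M o x.1, oact N o x.2).
Proof. exact: lfun_ofE. Qed.

Lemma oinl_hom : ohom oinl.
Proof. by move=> o m; rewrite !oinlE osum_actE linear0. Qed.
Lemma oinr_hom : ohom oinr.
Proof. by move=> o m; rewrite !oinrE osum_actE linear0. Qed.
Lemma ofst_hom : ohom ofst.
Proof. by move=> o m; rewrite !ofstE osum_actE. Qed.
Lemma osnd_hom : ohom osnd.
Proof. by move=> o m; rewrite !osndE osum_actE. Qed.

Definition ocopair T (f : 'Hom(M, T)) (g : 'Hom(N, T)) : 'Hom(osum, T) :=
  (f \o ofst)%VF + (g \o osnd)%VF.
Definition opair T (f : 'Hom(T, M)) (g : 'Hom(T, N)) : 'Hom(T, osum) :=
  (oinl \o f)%VF + (oinr \o g)%VF.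

Lemma ocopairE T f g x : @ocopair T f g x = f x.1 + g x.2.
Proof. by rewrite add_lfunE !comp_lfunE ofstE osndE. Qed.
Lemma opairE T f g x : @opair T f g x = (f x, g x).
Proof.
rewrite add_lfunE !comp_lfunE oinlE oinrE.
by apply: injective_projections; rewrite /= ?addr0 ?add0r.
Qed.
Lemma ocopair_hom T (f : 'Hom(M, T)) (g : 'Hom(N, T)) :
  ohom f -> ohom g -> ohom (ocopair f g).
Proof.
move=> hf hg; apply: ohomD; apply: ohom_comp => //.
- exact: ofst_hom.
- exact: osnd_hom.
Qed.
Lemma opair_hom T (f : 'Hom(T, M)) (g : 'Hom(T, N)) :
  ohom f -> ohom g -> ohom (opair f g).
Proof.
move=> hf hg; apply: ohomD; apply: ohom_comp => //.
- exact: oinl_hom.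
- exact: oinr_hom.
Qed.

Lemma osum_ses : ses oinl osnd.
Proof.
split.
- exact: oinl_hom.
- exact: osnd_hom.
- by move=> x y; rewrite !oinlE => -[].
- by move=> y; exists (0, y); rewrite osndE.
- by move=> x; rewrite osndE oinlE.
by case=> a b; rewrite osndE /= => ->; exists a; rewrite oinlE.
Qed.

End Sum.

Definition retract M L := exists (i : 'Hom(M, L)) (p : 'Hom(L, M)),
  [/\ ohom i, ohom p & forall x, p (i x) = x].

Definition oiso M N := exists2 f : 'Hom(M, N), ohom f & injective f /\ surj f.

Lemma oiso_inv M N (f : 'Hom(M, N)) : ohom f -> injective f -> surj f ->
  exists g : 'Hom(N, M), [/\ ohom g, forall x, g (f x) = x & forall y, f (g y) = y].
Proof.
move=> hf fi fs; have [|g hg fg] := factor_mono hf fi (@ohom_id N).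
  by move=> x; case: (fs x) => y <-; exists y; rewrite id_lfunE.
have {}fg x : f (g x) = x by rewrite fg id_lfunE.
by exists g; split=> // x; apply: fi; rewrite fg.
Qed.

Lemma oiso_sym M N : oiso M N -> oiso N M.
Proof.
case=> f hf [fi fs]; case: (oiso_inv hf fi fs) => g [hg gf fg].
exists g => //; split; first exact: can_inj fg.
by move=> y; exists (f y).
Qed.

Lemma oiso_trans L M N : oiso L M -> oiso M N -> oiso L N.
Proof.
case=> f hf [fi fs] [g hg [gi gs]]; exists (g \o f)%VF; first exact: ohom_comp.
split=> [x y | z]; first by rewrite !comp_lfunE => /gi/fi.
by case: (gs z) => y <-; case: (fs y) => x <-; exists x; rewrite comp_lfunE.
Qed.

Lemma oiso_refl M : oiso M M.
Proof.
exists \1%VF; first exact: ohom_id.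
by split=> [x y | y]; [rewrite !id_lfunE | exists y; rewrite id_lfunE].
Qed.

Lemma oiso_retract M N : oiso M N -> retract M N.
Proof.
case=> f hf [fi fs]; case: (oiso_inv hf fi fs) => g [hg gf _].
by exists f, g.
Qed.

End OperatorModules.

(** * Projectives, short exact sequences and syzygies in a variety *)

Section Variety.
Variables (k : fieldType) (O : Type).
Notation omod := (omod k O).
Implicit Types L M N P Q K T G S : omod.

(** These closure properties are what the homological algebra asks of a class of modules. They hold
    for ungraded modules ([modV]) and graded ones ([grV]), which are thus treated together. *)
Record variety (V : omod -> Prop) : Prop := Variety {
  var_sub : forall M N (f : 'Hom(N, M)), ohom f -> injective f -> V M -> V N;
  var_quot : forall M N (f : 'Hom(M, N)), ohom f -> surj f -> V M -> V N;
  var_sum : forall M N, V M -> V N -> V (osum M N);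
  var_zero : V (ozero k O)
}.

Variables (V : omod -> Prop) (vV : variety V).

Definition oproj P := V P /\ forall M N (p : 'Hom(M, N)) (f : 'Hom(P, N)),
  V M -> ohom p -> surj p -> ohom f ->
  exists2 g : 'Hom(P, M), ohom g & forall x, p (g x) = f x.

Lemma ses_varl M' M M'' (i : 'Hom(M', M)) (p : 'Hom(M, M'')) :
  ses i p -> V M -> V M'.
Proof. by case=> hi _ ii _ _ _; apply: (var_sub vV) ii. Qed.

Lemma ses_varr M' M M'' (i : 'Hom(M', M)) (p : 'Hom(M, M'')) :
  ses i p -> V M -> V M''.
Proof. by case=> _ hp _ ps _ _; apply: (var_quot vV) ps. Qed.

Lemma oproj_retract M L : retract M L -> oproj L -> oproj M.
Proof.
case=> i [p [hi hp pi]] [VL Lp]; split.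
  by apply: (var_sub vV hi) => // x y ixy; rewrite -(pi x) ixy pi.
move=> X Y q f VX hq qs hf.
have [g hg qg] := Lp X Y q (f \o p)%VF VX hq qs (ohom_comp hf hp).
exists (g \o i)%VF; first exact: ohom_comp.
by move=> x; rewrite comp_lfunE qg comp_lfunE pi.
Qed.

Lemma oproj_sum P Q : oproj P -> oproj Q -> oproj (osum P Q).
Proof.
move=> [VP Pp] [VQ Qp]; split; first exact: (var_sum vV).
move=> X Y q f VX hq qs hf.
have [g hg qg] := Pp _ _ q (f \o oinl P Q)%VF VX hq qs (ohom_comp hf (@oinl_hom _ _ _ _)).
have [h hh qh] := Qp _ _ q (f \o oinr P Q)%VF VX hq qs (ohom_comp hf (@oinr_hom _ _ _ _)).
exists (ocopair g h); first exact: ocopair_hom.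
case=> a b; rewrite ocopairE linearD /= qg qh !comp_lfunE -linearD oinlE oinrE.
by congr (f _); apply: injective_projections; rewrite /= ?addr0 ?add0r.
Qed.

Lemma oproj_eq0 P : odim P = 0%N -> oproj P.
Proof.
move=> P0; split.
  apply: (var_sub vV (@ohom0 _ _ P (ozero k O))); last exact: (var_zero vV).
  by move=> x y _; rewrite (odim0 P0 x) (odim0 P0 y).
move=> X Y q f _ _ _ _; exists 0; first exact: ohom0.
by move=> x; rewrite (odim0 P0 x) !linear0.
Qed.

Lemma oproj_zero : oproj (ozero k O).
Proof. by apply: oproj_eq0; rewrite /odim dim_matrix. Qed.

Lemma oproj_lift_ker P M N K (p : 'Hom(M, N)) (i : 'Hom(K, M)) (f : 'Hom(P, M)) :
  ses i p -> ohom f -> (forall x, p (f x) = 0) ->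
  exists2 g : 'Hom(P, K), ohom g & forall x, i (g x) = f x.
Proof.
move=> s hf pf; apply: (factor_mono (ses_hi s) (ses_inj s) hf) => x.
exact: (ses_ex s (pf x)).
Qed.

Lemma ses_retract M' M M'' (i : 'Hom(M', M)) (p : 'Hom(M, M''))
    (s : 'Hom(M'', M)) : ses i p -> ohom s -> (forall x, p (s x) = x) ->
  retract M' M.
Proof.
move=> e hs ps; have hf : ohom (\1%VF - (s \o p)%VF).
  by apply: ohomB; [exact: ohom_id | apply: ohom_comp => //; exact: ses_hp e].
have [|g hg ig] := oproj_lift_ker e hf.
  by move=> x; rewrite add_lfunE opp_lfunE id_lfunE comp_lfunE linearB /= ps subrr.
exists i, g; split=> //; first exact: ses_hi e.
move=> x; apply: (ses_inj e); rewrite ig add_lfunE opp_lfunE id_lfunE comp_lfunE.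
by rewrite (ses_pi e) linear0 subr0.
Qed.

Lemma ses_split M' M P (i : 'Hom(M', M)) (p : 'Hom(M, P)) :
  ses i p -> V M -> oproj P ->
  exists2 s : 'Hom(P, M), ohom s & forall x, p (s x) = x.
Proof.
move=> e VM [_ Pp].
have [g hg pg] := Pp _ _ p \1%VF VM (ses_hp e) (ses_surj e) (@ohom_id _ _ P).
by exists g => // x; rewrite pg id_lfunE.
Qed.

Lemma ses_retract_proj M' M P (i : 'Hom(M', M)) (p : 'Hom(M, P)) :
  ses i p -> V M -> oproj P -> retract M' M.
Proof. by move=> e VM pP; have [s hs ps] := ses_split e VM pP; exact: (ses_retract e hs ps). Qed.

Definition syz K P M (i : 'Hom(K, P)) (p : 'Hom(P, M)) := oproj P /\ ses i p.

(** The horseshoe lemma. Lifting [p''] through [p] to [t], the maps [i \o p'] and [t] together cover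
    [M] by the sum of the two projectives, and the kernel of this cover is an extension of [K''] by
    [K']. *)
Lemma horseshoe M' M M'' K' P' K'' P'' (i : 'Hom(M', M)) (p : 'Hom(M, M''))
    (i' : 'Hom(K', P')) (p' : 'Hom(P', M'))
    (i'' : 'Hom(K'', P'')) (p'' : 'Hom(P'', M'')) :
  V M -> ses i p -> syz i' p' -> syz i'' p'' ->
  exists K (j : 'Hom(K, osum P' P'')) (q : 'Hom(osum P' P'', M))
         (a : 'Hom(K', K)) (b : 'Hom(K, K'')), syz j q /\ ses a b.
Proof.
move=> VM e [P'p e'] [P''p e''].
have [_ lift''] := P''p.
have [t ht pt] := lift'' _ _ p p'' VM (ses_hp e) (ses_surj e) (ses_hp e'').
have hq : ohom (ocopair (i \o p')%VF t).
  by apply: ocopair_hom => //; apply: ohom_comp; [exact: ses_hi e | exact: ses_hp e'].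
have qE x : ocopair (i \o p')%VF t x = i (p' x.1) + t x.2.
  by rewrite ocopairE comp_lfunE.
have qs : surj (ocopair (i \o p')%VF t).
  move=> m; case: (ses_surj e'' (p m)) => y py.
  have : p (m - t y) = 0 by rewrite linearB /= pt py subrr.
  case/(ses_ex e) => x mE; case: (ses_surj e' x) => z zE.
  by exists (z, y); rewrite qE /= zE -mE subrK.
case: (ker_exists hq qs) => K [j ej].
have qj x : ocopair (i \o p')%VF t (j x) = 0 by apply: ses_pi ej x.
have [|a ha ja] := factor_mono (ses_hi ej) (ses_inj ej)
    (ohom_comp (@oinl_hom _ _ P' P'') (ses_hi e')).
  move=> x; have [|y yE] := ses_ex ej (y := oinl P' P'' (i' x)).
    by rewrite qE oinlE /= (ses_pi e') !linear0 addr0.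
  by exists y; rewrite comp_lfunE.
have [|b hb jb] := factor_mono (ses_hi e'') (ses_inj e'')
    (ohom_comp (@osnd_hom _ _ P' P'') (ses_hi ej)).
  move=> x; have [|y yE] := ses_ex e'' (y := osnd P' P'' (j x)).
    rewrite osndE -pt; move: (qj x); rewrite qE => /(congr1 p).
    by rewrite linearD /= (ses_pi e) add0r linear0.
  by exists y; rewrite comp_lfunE.
exists K, j, (ocopair (i \o p')%VF t), a, b; split.
  by split=> //; apply: oproj_sum.
split=> //.
- move=> x y /(congr1 j); rewrite !ja !comp_lfunE !oinlE => -[].
  exact: (ses_inj e').
- move=> y; have : p (t (i'' y)) = 0 by rewrite pt (ses_pi e'').
  case/(ses_ex e) => x xE; case: (ses_surj e' x) => z zE.
  have [|w wE] := ses_ex ej (y := (- z, i'' y)).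
    by rewrite qE /= linearN /= zE linearN /= xE addNr.
  by exists w; apply: (ses_inj e''); rewrite jb comp_lfunE osndE -wE.
- move=> x; apply: (ses_inj e''); rewrite jb comp_lfunE ja comp_lfunE.
  by rewrite osndE oinlE linear0.
- move=> y by0; have j2 : (j y).2 = 0.
    by rewrite -osndE -comp_lfunE -jb by0 linear0.
  have : p' (j y).1 = 0.
    apply: (ses_inj e); rewrite linear0; move: (qj y).
    by rewrite qE j2 linear0 addr0.
  case/(ses_ex e') => x xE; exists x; apply: (ses_inj ej).
  by rewrite ja comp_lfunE oinlE -xE -j2; case: (j y).
Qed.

(** The comparison theorem in one step: [u] and [v] lift to the covers and restrict to [a] and [b]
    on the kernels. As [v] splits [u], the composite of the two lifts minus the identity lands in
    [K]; it is the homotopy [h]. *)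
Lemma syz_retract M L K P K' P' (u : 'Hom(M, L)) (v : 'Hom(L, M))
    (i : 'Hom(K, P)) (p : 'Hom(P, M)) (i' : 'Hom(K', P')) (p' : 'Hom(P', L)) :
  ohom u -> ohom v -> (forall x, v (u x) = x) -> syz i p -> syz i' p' ->
  exists (t : 'Hom(P, P')) (a : 'Hom(K, K')) (b : 'Hom(K', K)) (h : 'Hom(P, K)),
    [/\ ohom t /\ ohom a, ohom b, ohom h, forall x, i' (a x) = t (i x)
      & forall x, b (a x) = x + h (i x)].
Proof.
move=> hu hv vu [[VP Pp] e] [[VP' P'p] e'].
have [t ht pt] := Pp _ _ p' (u \o p)%VF VP' (ses_hp e') (ses_surj e')
  (ohom_comp hu (ses_hp e)).
have [t' ht' pt'] := P'p _ _ p (v \o p')%VF VP (ses_hp e) (ses_surj e)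
  (ohom_comp hv (ses_hp e')).
have [|a ha ia] := oproj_lift_ker e' (ohom_comp ht (ses_hi e)).
  by move=> x; rewrite comp_lfunE pt comp_lfunE (ses_pi e) linear0.
have [|b hb ib] := oproj_lift_ker e (ohom_comp ht' (ses_hi e')).
  by move=> x; rewrite comp_lfunE pt' comp_lfunE (ses_pi e') linear0.
have [|h hh ih] := oproj_lift_ker e (ohomB (ohom_comp ht' ht) (@ohom_id _ _ P)).
  move=> x; rewrite add_lfunE opp_lfunE id_lfunE comp_lfunE linearB /= pt'.
  by rewrite comp_lfunE pt comp_lfunE vu subrr.
exists t, a, b, h; split=> // x; first by rewrite ia comp_lfunE.
apply: (ses_inj e); rewrite ib comp_lfunE ia comp_lfunE linearD /= ih.
by rewrite add_lfunE opp_lfunE id_lfunE comp_lfunE addrC subrK.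
Qed.

(** The map (a, i) is split by (b, -h). Taking [M = L], this also compares two syzygies of one
    module. *)
Lemma syz_retract_sum M L K P K' P' (i : 'Hom(K, P)) (p : 'Hom(P, M))
    (i' : 'Hom(K', P')) (p' : 'Hom(P', L)) :
  retract M L -> syz i p -> syz i' p' -> retract K (osum K' P).
Proof.
case=> u [v [hu hv vu]] s s'.
have [t [a [b [h [[ht ha] hb hh ia ba]]]]] := syz_retract hu hv vu s s'.
exists (opair a i), (ocopair b (- h)); split.
- by apply: opair_hom => //; case: s => _ /ses_hi.
- by apply: ocopair_hom => //; apply: ohomN.
by move=> x; rewrite ocopairE opairE /= ba opp_lfunE addrK.
Qed.

(** Schanuel's lemma: [W] is the pullback of the two covers over [M], and its two projections have
    kernels [K] and [K']. *)
Lemma syz_pullback M K P K' P' (i : 'Hom(K, P)) (p : 'Hom(P, M))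
    (i' : 'Hom(K', P')) (p' : 'Hom(P', M)) : syz i p -> syz i' p' ->
  exists (W : omod) (a : 'Hom(K, W)) (b : 'Hom(W, P')) (a' : 'Hom(K', W)) (b' : 'Hom(W, P)),
    [/\ V W, ses a b & ses a' b'].
Proof.
move=> [[VP Pp] e] [[VP' P'p] e'].
pose q := ocopair p (- p').
have hq : ohom q.
  by apply: ocopair_hom; [exact: ses_hp e | apply: ohomN; exact: ses_hp e'].
have qE x : q x = p x.1 - p' x.2 by rewrite ocopairE opp_lfunE.
have qs : surj q.
  move=> m; case: (ses_surj e m) => x xE; exists (x, 0).
  by rewrite qE /= linear0 subr0.
case: (ker_exists hq qs) => W [j ej].
have qj x : p (j x).1 = p' (j x).2.
  by apply/eqP; rewrite -subr_eq0 -qE (ses_pi ej).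
have [|a ha ja] := oproj_lift_ker ej (ohom_comp (@oinl_hom _ _ P P') (ses_hi e)).
  by move=> x; rewrite qE comp_lfunE oinlE /= linear0 (ses_pi e) subr0.
have [|a' ha' ja'] := oproj_lift_ker ej (ohom_comp (@oinr_hom _ _ P P') (ses_hi e')).
  by move=> x; rewrite qE comp_lfunE oinrE /= linear0 (ses_pi e') subr0.
exists W, a, (osnd P P' \o j)%VF, a', (ofst P P' \o j)%VF.
split; first by apply: (ses_varl ej); apply: (var_sum vV).
- split=> //.
  + by apply: ohom_comp; [exact: osnd_hom | exact: ses_hi ej].
  + move=> x y /(congr1 j); rewrite !ja !comp_lfunE !oinlE => -[].
    exact: (ses_inj e).
  + move=> y; case: (ses_surj e (p' y)) => x xE.
    have [|w wE] := ses_ex ej (y := (x, y)); first by rewrite qE /= xE subrr.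
    by exists w; rewrite comp_lfunE -wE osndE.
  + by move=> x; rewrite comp_lfunE ja comp_lfunE osndE oinlE.
  move=> w; rewrite comp_lfunE osndE => j2.
  have : p (j w).1 = 0 by rewrite qj j2 linear0.
  case/(ses_ex e) => x xE; exists x; apply: (ses_inj ej).
  by rewrite ja comp_lfunE oinlE -xE -j2; case: (j w).
split=> //.
+ by apply: ohom_comp; [exact: ofst_hom | exact: ses_hi ej].
+ move=> x y /(congr1 j); rewrite !ja' !comp_lfunE !oinrE => -[].
  exact: (ses_inj e').
+ move=> y; case: (ses_surj e' (p y)) => x xE.
  have [|w wE] := ses_ex ej (y := (y, x)); first by rewrite qE /= xE subrr.
  by exists w; rewrite comp_lfunE -wE ofstE.
+ by move=> x; rewrite comp_lfunE ja' comp_lfunE ofstE oinrE.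
move=> w; rewrite comp_lfunE ofstE => j1.
have : p' (j w).2 = 0 by rewrite -qj j1 linear0.
case/(ses_ex e') => x xE; exists x; apply: (ses_inj ej).
by rewrite ja' comp_lfunE oinrE -xE -j1; case: (j w).
Qed.

(** A generating family of projectives, phrased so that the image of a partial cover can always be
    enlarged. *)
Definition covering (gen : omod -> Prop) :=
  (forall G, gen G -> oproj G) /\
  forall M (U : {vspace M}), V M -> U <> fullv ->
    exists2 G, gen G & exists2 f : 'Hom(G, M), ohom f & ~ (limg f <= U)%VS.

Section Cover.
Variables (gen : omod -> Prop) (genC : covering gen).

Lemma cover_class (X : omod -> Prop) : X (ozero k O) -> (forall G, gen G -> X G) ->
  (forall M N, X M -> X N -> X (osum M N)) ->
  forall M, V M -> exists P (p : 'Hom(P, M)), [/\ X P, oproj P, ohom p & surj p].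
Proof.
move=> X0 Xg XS M VM.
(* Induction on the codimension of the image of the partial cover [p]; each new generator decreases
   it. *)
have step n (P : omod) (p : 'Hom(P, M)) : (dim M - \dim (limg p) < n)%N ->
    X P -> oproj P -> ohom p ->
    exists Q (q : 'Hom(Q, M)), [/\ X Q, oproj Q, ohom q & surj q].
  elim: n P p => // n IH P p dn XP pP hp.
  have [pf | /eqP pn] := eqVneq (limg p) fullv.
    by exists P, p; split=> //; apply/limg_fullP.
  have [G gG [f hf fU]] := genC.2 M (limg p) VM pn.
  apply: (IH (osum P G) (ocopair p f)).
  - have sub : (limg p <= limg (ocopair p f))%VS.
      apply/subvP => _ /memv_imgP[x _ ->].
      have -> : p x = ocopair p f (x, 0) by rewrite ocopairE /= linear0 addr0.
      by rewrite memv_img ?memvf.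
    have lt : (\dim (limg p) < \dim (limg (ocopair p f)))%N.
      rewrite ltn_neqAle (dimv_leqif_eq sub).1 andbT (dimv_leqif_eq sub).2.
      apply/negP => /eqP E; apply: fU; rewrite E.
      apply/subvP => _ /memv_imgP[x _ ->].
      have -> : f x = ocopair p f (0, x) by rewrite ocopairE /= linear0 add0r.
      by rewrite memv_img ?memvf.
    have := dimvS (subvf (limg (ocopair p f))); rewrite dimvf; lia.
  - exact: XS (Xg _ gG).
  - by apply: oproj_sum => //; apply: genC.1.
  - exact: ocopair_hom.
apply: (step _ (ozero k O) 0 (ltnSn _)) => //; first exact: oproj_zero.
exact: ohom0.
Qed.

Lemma enough_proj M : V M -> exists K P (i : 'Hom(K, P)) (p : 'Hom(P, M)), syz i p.
Proof.
move=> VM; have [||P [p [_ pP hp ps]]] := @cover_class (fun=> True) I _ _ M VM => //.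
by case: (ker_exists hp ps) => K [i e]; exists K, P, i, p.
Qed.

(** A projective splits off any of its covers, hence is a retract of a finite sum of generators. *)
Lemma oproj_ind (X : omod -> Prop) : X (ozero k O) -> (forall G, gen G -> X G) ->
  (forall M N, X M -> X N -> X (osum M N)) ->
  (forall M N, retract M N -> X N -> X M) -> forall P, oproj P -> X P.
Proof.
move=> X0 Xg XS XR P [VP Pp].
have [Q [q [XQ [VQ _] hq qs]]] := cover_class X0 Xg XS VP.
apply: XR XQ; have [g hg qg] := Pp _ _ q \1%VF VQ hq qs (@ohom_id _ _ P).
by exists g, q; split=> // x; rewrite qg id_lfunE.
Qed.

End Cover.

End Variety.

(** * Vanishing of Ext, stably additive functions, projective dimension *)

Section Homological.
Variables (k : fieldType) (O : Type).
Notation omod := (omod k O).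
Implicit Types L M N P Q K T G S Y I : omod.
Variables (V : omod -> Prop) (vV : variety V).
Variables (gen : omod -> Prop) (genC : covering V gen).

Definition extends N K Y (i : 'Hom(K, Y)) := forall f : 'Hom(K, N), ohom f ->
  exists2 g : 'Hom(Y, N), ohom g & forall x, g (i x) = f x.

(** Vanishing of Ext^1(M, N) as an extension property over all short exact sequences ending in [M];
    no resolution is involved. *)
Definition ext1_eq0 N M := forall K Y (i : 'Hom(K, Y)) (p : 'Hom(Y, M)),
  V Y -> ses i p -> extends N i.

(* Ext^(n+1)(M, N) = 0, computed by dimension shifting. *)
Fixpoint ext_eq0 N (n : nat) M : Prop :=
  if n is n'.+1 then
    forall K P (i : 'Hom(K, P)) (p : 'Hom(P, M)), syz V i p -> ext_eq0 N n' K
  else ext1_eq0 N M.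

Lemma syz_var K P M (i : 'Hom(K, P)) (p : 'Hom(P, M)) : syz V i p -> V K /\ V M.
Proof. by case=> -[VP _] e; split; [apply: (ses_varl vV e) | apply: (ses_varr vV e)]. Qed.

(** One projective cover decides, because [Y] is the pushout of [P] and [K1] along [K]: a map on
    [K1] extends to [Y] once its restriction to [K] extends to [P]. *)
Lemma ext1_syz N M K P (i : 'Hom(K, P)) (p : 'Hom(P, M)) :
  syz V i p -> extends N i -> ext1_eq0 N M.
Proof.
move=> [[VP Pp] e] ext K1 Y j q VY e1 f hf.
have [a ha qa] := Pp _ _ q p VY (ses_hp e1) (ses_surj e1) (ses_hp e).
have [|b hb jb] := oproj_lift_ker e1 (ohom_comp ha (ses_hi e)).
  by move=> x; rewrite comp_lfunE qa (ses_pi e).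
have [g hg gi] := ext _ (ohom_comp hf hb).
have hc : ohom (ocopair a j) by apply: ocopair_hom => //; apply: ses_hi e1.
have sc : surj (ocopair a j).
  move=> y; case: (ses_surj e (q y)) => x xE.
  have : q (y - a x) = 0 by rewrite linearB /= qa xE subrr.
  case/(ses_ex e1) => z zE; exists (x, z).
  by rewrite ocopairE /= -zE addrC subrK.
(* The kernel of [ocopair a j] consists of the pairs (i w, - b w), on which [g] and [f] cancel. *)
have [|h hh hE] := factor_epi hc sc (ocopair_hom hg hf).
  case=> x z; rewrite !ocopairE /= => xz.
  have : p x = 0.
    by move/(congr1 q): xz; rewrite linearD /= qa (ses_pi e1) addr0 linear0.
  case/(ses_ex e) => w wE; have zE : z = - b w.
    apply: (ses_inj e1); apply/eqP; rewrite linearN /= -addr_eq0 jb comp_lfunE -wE.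
    by rewrite addrC xz.
  by rewrite wE gi comp_lfunE zE linearN subrr.
exists h => // x; have := hE (0, x).
by rewrite !ocopairE /= !linear0 !add0r.
Qed.

Lemma ext1_retract N M L : V L -> retract M L -> ext1_eq0 N L -> ext1_eq0 N M.
Proof.
move=> VL [u [v [hu hv vu]]] eL.
have VM : V M by apply: (var_sub vV hu) VL => x y xy; rewrite -(vu x) xy vu.
have [K [P [i [p s]]]] := enough_proj vV genC VM.
have [K' [P' [i' [p' s']]]] := enough_proj vV genC VL.
have [t [a [b [h [[ht ha] hb hh ia ba]]]]] := syz_retract hu hv vu s s'.
apply: (ext1_syz s) => f hf.
have [g hg gi] := eL _ _ _ _ (s'.1.1) s'.2 _ (ohom_comp hf hb).
exists ((g \o t)%VF - (f \o h)%VF); first by apply: ohomB; apply: ohom_comp.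
move=> x; rewrite add_lfunE opp_lfunE !comp_lfunE -ia gi comp_lfunE ba.
by rewrite linearD /= addrK.
Qed.

(** The map is extended in two stages: to the kernel of Y -> M'', which is an extension of [M'] by
    [K], and from there to [Y]. *)
Lemma ext1_ses N M' M M'' (i : 'Hom(M', M)) (p : 'Hom(M, M'')) :
  ses i p -> ext1_eq0 N M' -> ext1_eq0 N M'' -> ext1_eq0 N M.
Proof.
move=> e e' e'' K Y j q VY eY f hf.
have [||Y' [u eu]] := @ker_exists _ _ Y M'' (p \o q)%VF.
- by apply: ohom_comp; [apply: ses_hp e | apply: ses_hp eY].
- move=> z; case: (ses_surj e z) => m mE; case: (ses_surj eY m) => y yE.
  by exists y; rewrite comp_lfunE yE.
have [|r hr ir] := oproj_lift_ker e (ohom_comp (ses_hp eY) (ses_hi eu)).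
  by move=> x; rewrite comp_lfunE -comp_lfunE (ses_pi eu).
have [|w hw uw] := oproj_lift_ker eu (ses_hi eY).
  by move=> x; rewrite comp_lfunE (ses_pi eY) linear0.
have ew : ses w r.
  split=> //.
  - by move=> x y /(congr1 u); rewrite !uw => /(ses_inj eY).
  - move=> m; case: (ses_surj eY (i m)) => y yE.
    have [|z zE] := ses_ex eu (y := y); first by rewrite comp_lfunE yE (ses_pi e).
    by exists z; apply: (ses_inj e); rewrite ir comp_lfunE -zE.
  - by move=> x; apply: (ses_inj e); rewrite ir comp_lfunE uw (ses_pi eY) linear0.
  move=> y ry; have : q (u y) = 0 by rewrite -comp_lfunE -ir ry linear0.
  case/(ses_ex eY) => x xE; exists x; apply: (ses_inj eu).
  by rewrite uw.
have [g hg gw] := e' _ _ _ _ (ses_varl vV eu VY) ew f hf.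
have [h hh hu] := e'' _ _ _ _ VY eu g hg.
by exists h => // x; rewrite -uw hu gw.
Qed.

(** The three closure properties are proved together: a syzygy of a retract is a retract of a syzygy
    only after adding a projective, so each inductive step uses the others. *)
Lemma ext_closed N n :
  (forall M L, V L -> retract M L -> ext_eq0 N n L -> ext_eq0 N n M) /\
  (forall M' M M'' (i : 'Hom(M', M)) (p : 'Hom(M, M'')), V M -> ses i p ->
    ext_eq0 N n M' -> ext_eq0 N n M'' -> ext_eq0 N n M) /\
  (forall P, oproj V P -> ext_eq0 N n P).
Proof.
elim: n => [|n [IHr [IHs IHp]]] /=.
  split; first exact: ext1_retract.
  split=> [M' M M'' i p _ | P pP]; first exact: ext1_ses.
  move=> K Y i p VY e f hf.
  have [u [v [hu hv vu]]] := ses_retract_proj e VY pP.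
  have [s hs ps] := ses_split e VY pP.
  have [|w hw iw] := oproj_lift_ker e
      (ohomB (@ohom_id _ _ Y) (ohom_comp hs (ses_hp e))).
    by move=> x; rewrite add_lfunE opp_lfunE id_lfunE comp_lfunE linearB /= ps subrr.
  exists (f \o w)%VF; first exact: ohom_comp.
  move=> x; rewrite comp_lfunE; congr (f _); apply: (ses_inj e).
  by rewrite iw add_lfunE opp_lfunE id_lfunE comp_lfunE (ses_pi e) linear0 subr0.
have R M L : V L -> retract M L -> ext_eq0 N n.+1 L -> ext_eq0 N n.+1 M.
  move=> VL r eL K P i p s.
  have [K' [P' [i' [p' s']]]] := enough_proj vV genC VL.
  apply: (IHr _ (osum K' P)); last 1 first.
  - apply: (IHs _ _ _ _ _ _ (osum_ses K' P)).
    + by apply: (var_sum vV); [case: (syz_var s') | case: s => -[]].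
    + exact: eL s'.
    + by apply: IHp; case: s.
  - by apply: (var_sum vV); [case: (syz_var s') | case: s => -[]].
  exact: syz_retract_sum r s s'.
split=> //; split.
  move=> M' M M'' i p VM e e' e'' K P j q s.
  have [K' [P' [i' [p' s']]]] := enough_proj vV genC (ses_varl vV e VM).
  have [K'' [P'' [i'' [p'' s'']]]] := enough_proj vV genC (ses_varr vV e VM).
  have [L [u [v [a [b [su eab]]]]]] := horseshoe vV VM e s' s''.
  have VL : V L by case: (syz_var su).
  apply: (IHr _ (osum L P)); last 1 first.
  - apply: (IHs _ _ _ _ _ _ (osum_ses L P)).
    + by apply: (var_sum vV); [| case: s => -[]].
    + by apply: (IHs _ _ _ _ _ VL eab); [apply: e' s' | apply: e'' s''].
    + by apply: IHp; case: s.
  - by apply: (var_sum vV); [| case: s => -[]].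
  exact: (syz_retract_sum (oiso_retract (oiso_refl M)) s su).
move=> P pP K Q i p [[VQ Qp] e]; apply: IHp.
apply: (oproj_retract vV (ses_retract_proj e VQ pP)).
by split.
Qed.

Lemma ext_retract N n M L : V L -> retract M L -> ext_eq0 N n L -> ext_eq0 N n M.
Proof. exact: (ext_closed N n).1. Qed.

Lemma ext_ses N n M' M M'' (i : 'Hom(M', M)) (p : 'Hom(M, M'')) :
  V M -> ses i p -> ext_eq0 N n M' -> ext_eq0 N n M'' -> ext_eq0 N n M.
Proof. exact: (ext_closed N n).2.1. Qed.

Lemma ext_proj N n P : oproj V P -> ext_eq0 N n P.
Proof. exact: (ext_closed N n).2.2. Qed.

(** The definition of [ext_eq0] quantifies over all syzygies; a single one suffices, since any two
    agree up to projective summands and retracts. *)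
Lemma ext_succ N n M K P (i : 'Hom(K, P)) (p : 'Hom(P, M)) :
  syz V i p -> ext_eq0 N n K -> ext_eq0 N n.+1 M.
Proof.
move=> s eK K' P' i' p' s'.
have VKP : V (osum K P') by apply: (var_sum vV); [case: (syz_var s) | case: s' => -[]].
apply: (@ext_retract _ _ _ (osum K P')) => //.
  exact: (syz_retract_sum (oiso_retract (oiso_refl M)) s' s).
by apply: (ext_ses VKP (osum_ses K P')) => //; apply: ext_proj; case: s'.
Qed.

Definition oinj I := forall K Y (i : 'Hom(K, Y)),
  V Y -> ohom i -> injective i -> extends I i.

Lemma ext_inj I n M : V M -> oinj I -> ext_eq0 I n M.
Proof.
move=> VM iI; elim: n M VM => [|n IH] M VM.
  by move=> K Y i p VY e; apply: iI VY (ses_hi e) (ses_inj e).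
by move=> K P i p s; apply: IH; case: (syz_var s).
Qed.

(** Dimension shifting in the second variable, along an embedding of [N] into an injective. *)
Lemma ext_shift N I N' (u : 'Hom(N, I)) (v : 'Hom(I, N')) n M :
  V I -> oinj I -> ses u v -> ext_eq0 N' n M -> ext_eq0 N n.+1 M.
Proof.
move=> VI iI e; elim: n M => [|n IH] M eN' K P i p s; last first.
  exact/IH/(eN' _ _ _ _ s).
move=> K2 Y j q VY eY f hf.
have [g hg gj] := iI _ _ j VY (ses_hi eY) (ses_inj eY) _ (ohom_comp (ses_hi e) hf).
have [|h hh hq] := factor_epi (ses_hp eY) (ses_surj eY) (ohom_comp (ses_hp e) hg).
  move=> x /(ses_ex eY)[y ->]; rewrite comp_lfunE gj comp_lfunE.
  exact: ses_pi e _.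
have [w hw wi] := eN' _ _ _ _ s.1.1 s.2 _ hh.
have [t ht vt] := s.1.2 _ _ v w VI (ses_hp e) (ses_surj e) hw.
(* The map [g] into [I] is corrected by a map pulled back from [P], so that it dies in [N'] and
   hence lands in [N]. *)
have [|z hz uz] := oproj_lift_ker e
  (ohomB hg (ohom_comp ht (ohom_comp (ses_hi s.2) (ses_hp eY)))).
  move=> y; rewrite add_lfunE opp_lfunE !comp_lfunE linearB /= vt wi hq.
  by rewrite comp_lfunE subrr.
exists z => // x; apply: (ses_inj e).
rewrite uz add_lfunE opp_lfunE !comp_lfunE gj comp_lfunE (ses_pi eY).
by rewrite !linear0 addr0.
Qed.

(** Induction on the length of the injective resolution, replacing [N] by the cokernel of its
    embedding into the first term. *)
Lemma ext_injdim (R : nat -> omod) (d : forall n, 'Hom(R n, R n.+1)) N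
    (e : 'Hom(N, R 0%N)) D :
  (forall n, V (R n) /\ oinj (R n)) -> (forall n, ohom (d n)) -> ohom e ->
  injective e -> (forall x, d 0%N x = 0 <-> exists y, x = e y) ->
  (forall n x, d n.+1 x = 0 <-> exists y, x = d n y) ->
  (forall n, (D <= n)%N -> forall x : R n, x = 0) ->
  forall n M, V M -> (D <= n)%N -> ext_eq0 N n M.
Proof.
elim: D R d N e => [|D IH] R d N e VR hd he ie e0 dd R0 n M VM Dn.
  have N0 : odim N = 0%N.
    apply/eqP; rewrite -leqn0; apply: leq_trans (odim_inj ie) _.
    rewrite /odim -dimvf leqn0 dimv_eq0 -subv0.
    by apply/subvP => x _; have -> : x = 0 by [apply: R0]; exact: mem0v.
  apply: ext_inj => // K Y i _ _ _ f _; exists 0; first exact: ohom0.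
  by move=> x; rewrite (odim0 N0 (f x)) zero_lfunE.
have [C [p ep]] := coker_exists he ie.
case: n Dn => // n Dn; apply: (ext_shift (VR 0%N).1 (VR 0%N).2 ep).
have [|e' he' e'p] := factor_epi (ses_hp ep) (ses_surj ep) (hd 0%N).
  by move=> x /(ses_ex ep) ex; apply/e0.
apply: (IH (fun n => R n.+1) (fun n => d n.+1) C e') => //.
- move=> x y /eqP; rewrite -subr_eq0 -linearB => /eqP exy.
  apply/eqP; rewrite -subr_eq0; apply/eqP; move: exy.
  case: (ses_surj ep (x - y)) => z <-; rewrite /= e'p => /e0[w ->].
  exact: ses_pi ep _.
- move=> x; split=> [/dd[y ->] | [c ->]]; first by exists (p y); rewrite e'p.
  by case: (ses_surj ep c) => y <-; rewrite e'p; apply/dd; exists y.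
by move=> m Dm; apply: R0.
Qed.

(* If (X, f) is stably additive then so are the modules whose syzygies are in  *)
(* X with - f o Omega, which is how a function on Cohen-Macaulay modules is    *)
(* extended to all modules.                                                    *)
Record stably_additive (G : zmodType) (X : omod -> Prop) (f : omod -> G) : Prop :=
  StablyAdditive {
    sa_proj : forall P, oproj V P -> X P /\ f P = 0;
    sa_ext : forall M' M M'' (i : 'Hom(M', M)) (p : 'Hom(M, M'')),
      V M -> ses i p -> X M' -> X M'' -> X M /\ f M = f M' + f M'';
    sa_ker : forall M' M P (i : 'Hom(M', M)) (p : 'Hom(M, P)),
      V M -> ses i p -> oproj V P -> X M -> X M'
  }.

(** In the pullback of the two covers, [f W] equals both [f K] and [f K'], since [f] kills
    projectives. So [f] of a syzygy does not depend on the syzygy chosen. *)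
Lemma stably_additive_syz (G : zmodType) X (f : omod -> G) M K P K' P'
    (i : 'Hom(K, P)) (p : 'Hom(P, M)) (i' : 'Hom(K', P')) (p' : 'Hom(P', M)) :
  stably_additive X f -> syz V i p -> syz V i' p' -> X K -> X K' /\ f K' = f K.
Proof.
move=> sf s s' XK.
have [W [a [b [a' [b' [VW e e']]]]]] := syz_pullback vV s s'.
have [XP fP] := sa_proj sf s.1; have [XP' fP'] := sa_proj sf s'.1.
have [XW fW] := sa_ext sf VW e XK XP'.
have XK' := sa_ker sf VW e' s.1 XW; split=> //.
have [_] := sa_ext sf VW e' XK' XP.
by rewrite fW fP fP' !addr0.
Qed.

Lemma syz_functor_exists : exists Om : omod -> omod, forall M, V M ->
  exists P (i : 'Hom(Om M, P)) (p : 'Hom(P, M)), syz V i p.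
Proof.
suff /choice[Om OmP] : forall M, exists K, V M ->
    exists P (i : 'Hom(K, P)) (p : 'Hom(P, M)), syz V i p by exists Om.
move=> M.
have [VM | nVM] := EM (V M); last by exists M.
by have [K [P [i [p s]]]] := enough_proj vV genC VM; exists K => _; exists P, i, p.
Qed.

Variable Om : omod -> omod.
Hypothesis OmP : forall M, V M ->
  exists P (i : 'Hom(Om M, P)) (p : 'Hom(P, M)), syz V i p.

(** [Om] is a mere choice of syzygies, not a functor. The horseshoe lemma provides an exact sequence
    of some syzygies, and [stably_additive_syz] replaces the middle one by the chosen one. *)
Lemma stably_additive_step (G : zmodType) X (f : omod -> G) :
  stably_additive X f -> stably_additive (X \o Om) (fun M => - f (Om M)).
Proof.
move=> sf.
have projOm P : oproj V P -> oproj V (Om P).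
  move=> pP; have [Q [i [p [pQ e]]]] := OmP pP.1.
  exact: oproj_retract (ses_retract_proj e pQ.1 pP) pQ.
split=> /=.
- by move=> P /projOm pP; case: (sa_proj sf pP) => ? ->; rewrite oppr0.
- move=> M' M M'' i p VM e X' X''.
  have [P' [i' [p' s']]] := OmP (ses_varl vV e VM).
  have [P'' [i'' [p'' s'']]] := OmP (ses_varr vV e VM).
  have [P [j [q s]]] := OmP VM.
  have [K [u [v [a [b [su eab]]]]]] := horseshoe vV VM e s' s''.
  have [XK fK] := sa_ext sf (syz_var su).1 eab X' X''.
  have [XM fM] := stably_additive_syz sf su s XK.
  by rewrite fM fK opprD.
move=> M' M P i p VM e pP XM.
have [P' [i' [p' s']]] := OmP (ses_varl vV e VM).
have [P'' [i'' [p'' s'']]] := OmP pP.1.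
have [Q [j [q s]]] := OmP VM.
have [K [u [v [a [b [su eab]]]]]] := horseshoe vV VM e s' s''.
have [XK _] := stably_additive_syz sf s su XM.
have t := (sa_ker sf (syz_var su).1 eab (projOm _ pP) XK).
exact: t.
Qed.

Lemma stably_additive_iter (G : zmodType) X (f : omod -> G) n :
  stably_additive X f ->
  stably_additive (fun M => X (iter n Om M)) (fun M => (f (iter n Om M)) *~ (-1) ^+ n).
Proof.
elim: n X f => [|n IH] X f sf.
  by rewrite (_ : (fun M => _) = f) //; apply/funext => M; rewrite expr0 mulr1z.
have := stably_additive_step (IH _ _ sf); congr stably_additive; apply/funext => M /=.
  by rewrite -iterSr.
by rewrite -iterSr exprS mulN1r mulrNz.
Qed.

Fixpoint pdim_le n M : Prop :=
  if n is n'.+1 then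
    exists K P (i : 'Hom(K, P)) (p : 'Hom(P, M)), syz V i p /\ pdim_le n' K
  else oproj V M.

Lemma pdim_le_sum n M P : pdim_le n M -> oproj V P -> pdim_le n (osum M P).
Proof.
case: n => [|n] /=; first exact: oproj_sum.
case=> K [Q [i [p [[pQ e] dK]]]] pP.
exists K, (osum Q P), (opair i 0), (opair (p \o ofst Q P)%VF (osnd Q P)).
split=> //; split; first exact: oproj_sum.
split.
- by apply: opair_hom; [exact: ses_hi e | exact: ohom0].
- apply: opair_hom; last exact: osnd_hom.
  by apply: ohom_comp; [exact: ses_hp e | exact: ofst_hom].
- by move=> x y; rewrite !opairE => -[/(ses_inj e)].
- case=> m x; case: (ses_surj e m) => q qE; exists (q, x).
  by rewrite opairE comp_lfunE ofstE osndE /= qE.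
- move=> x; rewrite !opairE comp_lfunE ofstE osndE /= (ses_pi e) zero_lfunE.
  by [].
case=> q x; rewrite !opairE comp_lfunE ofstE osndE /= => -[/(ses_ex e)[y ->] ->].
by exists y; rewrite opairE zero_lfunE.
Qed.

Lemma pdim_le_retract n M L : V L -> retract M L -> pdim_le n L -> pdim_le n M.
Proof.
elim: n M L => [|n IH] M L VL r /=; first exact: oproj_retract.
case=> K' [P' [i' [p' [s' dK']]]].
have VM : V M.
  by case: r => u [v [hu _ vu]]; apply: (var_sub vV hu) VL => x y xy; rewrite -(vu x) xy vu.
have [K [P [i [p s]]]] := enough_proj vV genC VM.
exists K, P, i, p; split=> //; apply: (IH _ (osum K' P)).
- by apply: (var_sum vV); [case: (syz_var s') | case: s => -[]].
- exact: syz_retract_sum r s s'.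
by apply: pdim_le_sum => //; case: s.
Qed.

(** Along a finite projective resolution the value changes sign at each syzygy and ends at a
    projective. *)
Lemma pdim_additive_eq0 (G : zmodType) (f : omod -> G) n M :
  stably_additive (fun=> True) f -> V M -> pdim_le n M -> f M = 0.
Proof.
move=> sf; elim: n M => [|n IH] M VM /=; first by case/(sa_proj sf).
case=> K [P [i [p [s dK]]]].
have [_] := sa_ext sf s.1.1 s.2 I I.
by rewrite (sa_proj sf s.1).2 (IH _ (syz_var s).1) // add0r.
Qed.

End Homological.

(** * Modules and graded modules *)

Section GradingProjections.
Variables (k : fieldType) (V : vectType k).

Lemma directv_seqP (s : seq int) (U : int -> {vspace V}) : uniq s ->
  directv (\sum_(i <- s) U i) <->
  forall u : int -> V, (forall i, i \in s -> u i \in U i) ->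
    \sum_(i <- s) u i = 0 -> forall i, i \in s -> u i = 0.
Proof.
move=> us.
have -> : directv (\sum_(i <- s) U i) = directv (\sum_(i < size s) U s`_i).
  rewrite /directv_def /=; congr (\dim _ == _).
    by rewrite (big_nth 0) big_mkord.
  by rewrite (big_nth 0) big_mkord.
have memP i : i \in s -> exists2 j : 'I_(size s), s`_j = i & true.
  move=> si; have lt : (index i s < size s)%N by rewrite index_mem.
  by exists (Ordinal lt) => //=; rewrite nth_index.
split=> [/directv_sum_independent D u uU u0 i /memP[j <- _] | D].
  apply: (D (fun j => u s`_j)) => // [l _|]; first exact/uU/mem_nth.
  by rewrite -[RHS]u0 (big_nth 0) big_mkord.
apply/directv_sum_independent => u uU u0 i _.
pose w (x : int) := if insub (index x s) is Some j then u j else 0.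
have wE (j : 'I_(size s)) : w s`_j = u j.
  by rewrite /w index_uniq // insubT //= => lt; congr u; apply: val_inj.
rewrite -wE; apply: D (mem_nth _ (ltn_ord i)).
  by move=> x /memP[j <- _]; rewrite wE uU.
by rewrite -[RHS]u0 (big_nth 0) big_mkord; apply: eq_bigr => j _; rewrite wE.
Qed.

(** Turns a grading into a family of projectors; as operators, these make graded maps plain
    homomorphisms of operator modules. *)
Lemma grading_proj (U : int -> {vspace V}) : is_grading U ->
  exists pr : int -> 'End(V),
  [/\ exists2 s, uniq s & forall m, \sum_(i <- s) pr i m = m,
      forall i j m, m \in U j -> pr i m = if i == j then m else 0
    & forall i m, pr i m \in U i].
Proof.
case=> s [us Us Uf /(directv_seqP _ us) dU].
pose pr i := sumv_pi_for (erefl (\sum_(i <- s) U i)%VS) i.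
have prU i m : pr i m \in U i by apply: memv_sum_pi.
have prS m : \sum_(i <- s) pr i m = m.
  by apply: sumv_pi_uniq_sum; rewrite ?filter_predT // Uf memvf.
exists pr; split=> // [|i j m mU]; first by exists s.
have [si | /Us Ui] := boolP (i \in s); last first.
  have := prU i m; rewrite Ui memv0 => /eqP ->; case: eqP => // E.
  by move: mU; rewrite -E Ui memv0 => /eqP ->.
apply/eqP; rewrite -subr_eq0; apply/eqP.
apply: (dU (fun i => pr i m - if i == j then m else 0)) => // [l _|].
  by apply: memvB => //; case: eqP => [->|_]; rewrite ?mem0v.
rewrite sumrB prS; have [sj | /Us Uj] := boolP (j \in s); last first.
  move: mU; rewrite Uj memv0 => /eqP ->.
  by rewrite big1 ?subrr // => l _; rewrite if_same.
rewrite (bigD1_seq j) //= eqxx big1 ?addr0 ?subrr // => l /negPf ->.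
by [].
Qed.

Lemma proj_grading (pr : int -> 'End(V)) (s : seq int) : uniq s ->
  (forall m, \sum_(i <- s) pr i m = m) ->
  (forall i j m, pr i (pr j m) = if i == j then pr j m else 0) ->
  is_grading (fun i => limg (pr i)).
Proof.
move=> us prS prO.
have out i m : i \notin s -> pr i m = 0.
  move=> si; rewrite -[m]prS linear_sum big_seq big1 // => j sj /=.
  by rewrite prO; case: eqP => // E; rewrite -E (negPf si) in sj.
exists s; split=> //.
- move=> i si; apply/eqP; rewrite -subv0; apply/subvP => _ /memv_imgP[m _ ->].
  by rewrite out ?mem0v.
- apply/vspaceP => m; rewrite memvf -[m]prS.
  rewrite big_seq; apply: rpred_sum => i si.
  apply: (subvP (_ : (limg (pr i) <= _)%VS)); last by rewrite memv_img ?memvf.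
  by rewrite (bigD1_seq i) //= addvSl.
apply/directv_seqP => // u uU u0 i si.
have uE j : j \in s -> pr j (u j) = u j.
  by move=> /uU/memv_imgP[x _ ->]; rewrite prO eqxx.
have := congr1 (pr i) u0; rewrite linear0 linear_sum big_seq => <-.
rewrite -big_seq (bigD1_seq i) //= uE // big_seq_cond big1 ?addr0 // => j /andP[sj ji].
by rewrite -uE // prO eq_sym (negPf ji).
Qed.

End GradingProjections.

Section Modules.
Variables (k : fieldType) (B : falgType k).

Definition modV (X : omod k B) : Prop :=
  [/\ forall m, oact X 1 m = m,
      forall a b m, oact X (a * b) m = oact X b (oact X a m)
    & forall c a b m, oact X (c *: a + b) m = c *: oact X a m + oact X b m].

Lemma modV_variety : variety modV.
Proof.
split.
- move=> M N f hf fi [M1 MM ML]; split.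
  + by move=> m; apply: fi; rewrite hf M1.
  + by move=> a b m; apply: fi; rewrite !hf MM.
  + by move=> c a b m; apply: fi; rewrite linearP /= !hf ML.
- move=> M N f hf fs [M1 MM ML]; split.
  + by move=> m; case: (fs m) => x <-; rewrite -hf M1.
  + by move=> a b m; case: (fs m) => x <-; rewrite -!hf MM.
  + by move=> c a b m; case: (fs m) => x <-; rewrite -!hf ML linearP.
- move=> M N [M1 MM ML] [N1 NM NL]; split.
  + by case=> x y; rewrite osum_actE M1 N1.
  + by move=> a b [x y]; rewrite !osum_actE MM NM.
  + by move=> c a b [x y]; rewrite !osum_actE ML NL.
by split=> *; rewrite [LHS]ozero_eq0 [RHS]ozero_eq0.
Qed.

Lemma modV0 X : modV X -> forall m, oact X 0 m = 0.
Proof.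
by case=> _ _ XL m; have := XL (-1) 0 0 m; rewrite scaleN1r addNr scaleN1r addNr.
Qed.

Lemma modVD X (a b : B) m : modV X -> oact X (a + b) m = oact X a m + oact X b m.
Proof. by case=> _ _ XL; rewrite -{1}(scale1r a) XL scale1r. Qed.

Lemma modV_sum (I : Type) (s : seq I) (F : I -> B) X m : modV X ->
  oact X (\sum_(i <- s) F i) m = \sum_(i <- s) oact X (F i) m.
Proof.
move=> vX; elim: s => [|i s IH]; first by rewrite !big_nil (modV0 vX).
by rewrite !big_cons modVD // IH.
Qed.

Lemma ract_linear (M : rmodule B) b : linear (fun m : M => ract M m b).
Proof. exact: ract_linearl. Qed.

Definition om (M : rmodule B) : omod k B :=
  @OMod k B M (fun b => lfun_of (@ract_linear M b)).

Lemma omE M b m : oact (om M) b m = ract M m b.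
Proof. exact: lfun_ofE. Qed.

Lemma om_modV M : modV (om M).
Proof.
split=> [m | a b m | c a b m]; rewrite !omE; first exact: ract1.
  exact: ractM.
exact: ract_linearr.
Qed.

Definition rmod_of (X : omod k B) (vX : modV X) : rmodule B.
Proof.
apply: (@RModule k B X (@RModOn k B X (fun m b => oact X b m) _ _ _ _)).
- by move=> b c x y; rewrite linearP.
- by case: vX => _ _ XL m c a b; rewrite XL.
- by case: vX.
- by case: vX.
Defined.

Lemma mod_hom_ohom (M N : rmodule B) (f : 'Hom(M, N)) :
  mod_hom f <-> ohom (f : 'Hom(om M, om N)).
Proof. by split=> hf b m; [rewrite !omE hf | have := hf m b; rewrite !omE]. Qed.

Lemma rmod_of_hom (X Y : omod k B) vX vY (f : 'Hom(X, Y)) :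
  mod_hom (f : 'Hom(@rmod_of X vX, @rmod_of Y vY)) <-> ohom f.
Proof. by split=> hf a b; apply: hf. Qed.

Lemma om_rmod_of_act (X : omod k B) vX b m : oact (om (@rmod_of X vX)) b m = oact X b m.
Proof. by rewrite omE. Qed.

Lemma projective_oproj (P : rmodule B) : projective_mod P <-> oproj modV (om P).
Proof.
split=> [Pp | [_ Pp] M N p f hp pf hf].
  split=> [|M N p f vM hp ps hf]; first exact: om_modV.
  have vN := var_quot modV_variety hp ps vM.
  have [|||g hg pg] := Pp (rmod_of vM) (rmod_of vN) p f.
  - exact/rmod_of_hom.
  - exact/limg_fullP.
  - by move=> m b; have := hf b m; rewrite omE.
  exists g; first by move=> b m; rewrite omE hg.
  by move=> x; rewrite -pg comp_lfunE.
have [|||g hg pg] := Pp (om M) (om N) p f (om_modV M).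
- exact/mod_hom_ohom.
- exact/limg_fullP.
- exact/mod_hom_ohom.
exists g; first exact/mod_hom_ohom.
by apply/lfunP => x; rewrite comp_lfunE pg.
Qed.

Definition oreg : omod k B := om (regular_mod B).

Lemma oregE b m : oact oreg b m = m * b.
Proof. exact: omE. Qed.

Fact orbit_linear (X : omod k B) (vX : modV X) (m : X) : linear (fun a => oact X a m).
Proof. by case: vX => _ _ XL c a b; rewrite XL. Qed.

Definition orbit_map (X : omod k B) (vX : modV X) (m : X) : 'Hom(oreg, X) :=
  lfun_of (orbit_linear vX m).

Lemma orbit_mapE X vX m a : @orbit_map X vX m a = oact X a m.
Proof. exact: lfun_ofE. Qed.

Lemma orbit_map_hom X vX m : ohom (@orbit_map X vX m).
Proof. by move=> b a; rewrite !orbit_mapE oregE; case: vX => _ ->. Qed.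

Lemma oreg_proj : oproj modV oreg.
Proof.
split=> [|M N p f vM hp ps hf]; first exact: om_modV.
case: (ps (f 1)) => m mE; exists (orbit_map vM m); first exact: orbit_map_hom.
by move=> a; rewrite orbit_mapE hp mE -hf oregE mul1r.
Qed.

Lemma modV_covering : covering modV (fun G => G = oreg).
Proof.
split=> [G -> | M U vM Uf]; first exact: oreg_proj.
have [m mU] : exists m, m \notin U.
  apply: contrapT => /forallNP nU; apply: Uf; apply/vspaceP => m.
  by rewrite memvf; apply/negbNE/negP/nU.
exists oreg => //; exists (orbit_map vM m); first exact: orbit_map_hom.
move/subvP/(_ m) => sub; case/negP: mU; apply: sub.
have E : orbit_map vM m 1 = m by rewrite orbit_mapE; case: vM.
by rewrite -[X in X \in _]E memv_img ?memvf.
Qed.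

End Modules.

(** * Projective resolutions and dimension shifting *)

Section Resolutions.
Variables (k : fieldType) (O : Type).
Notation omod := (omod k O).
Variables (V : omod -> Prop) (vV : variety V).
Variables (gen : omod -> Prop) (genC : covering V gen).
Implicit Types X K Q : omod.

Record oresolution (X : omod) (P : nat -> omod) (d : forall n, 'Hom(P n.+1, P n))
    (e : 'Hom(P 0%N, X)) : Prop := OResolution {
  ores_proj : forall n, oproj V (P n);
  ores_hd : forall n, ohom (d n);
  ores_he : ohom e;
  ores_surj : surj e;
  ores_e : forall x, e x = 0 <-> exists y, x = d 0%N y;
  ores_d : forall n x, d n x = 0 <-> exists y, x = d n.+1 y
}.

Lemma resolution_exists X : V X -> exists P d e, @oresolution X P d e.
Proof.
move=> VX; have [Om OmP] := syz_functor_exists vV genC.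
pose K n := iter n Om X.
have VK n : V (K n).
  by elim: n => //= n /OmP[P [i [p s]]]; case: (syz_var vV s).
pose PP n := cid (OmP _ (VK n)); pose P n := projT1 (PP n).
pose II n := cid (projT2 (PP n)); pose i n : 'Hom(K n.+1, P n) := projT1 (II n).
pose QQ n := cid (projT2 (II n)); pose p n : 'Hom(P n, K n) := projT1 (QQ n).
have s n : syz V (i n) (p n) := projT2 (QQ n).
exists P, (fun n => (i n \o p n.+1)%VF), (p 0%N).
have ker n x : p n x = 0 <-> exists y, x = (i n \o p n.+1)%VF y.
  split=> [/(ses_ex (s n).2)[z ->] | [y ->]].
    by case: (ses_surj (s n.+1).2 z) => y <-; exists y; rewrite comp_lfunE.
  by rewrite comp_lfunE (ses_pi (s n).2).
split=> [n | n | | | x | n x].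
- exact: (s n).1.
- by apply: ohom_comp; [exact: ses_hi (s n).2 | exact: ses_hp (s n.+1).2].
- exact: ses_hp (s 0%N).2.
- exact: ses_surj (s 0%N).2.
- exact: (ker 0%N x).
rewrite -ker comp_lfunE; split=> [ip | ->]; last exact: linear0.
exact: ses_inj0 (s n).2 ip.
Qed.

Definition extS_eq0 (N : omod) n (X : omod) := forall P d e, @oresolution X P d e ->
  forall f : 'Hom(P n.+1, N), ohom f -> (forall x, f (d n.+1 x) = 0) ->
  exists2 g : 'Hom(P n, N), ohom g & forall x, g (d n x) = f x.

Definition splice_obj (Q : omod) (P : nat -> omod) n := if n is n'.+1 then P n' else Q.

Definition splice_map (Q : omod) (P : nat -> omod) (d0 : 'Hom(P 0%N, Q))
    (d : forall n, 'Hom(P n.+1, P n)) n :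
    'Hom(splice_obj Q P n.+1, splice_obj Q P n) :=
  if n is n'.+1 then d n' else d0.

(** A resolution of the syzygy is prolonged by the cover, which lowers the Ext degree by one in
    [extS_ext]. *)
Lemma splice_resolution X K Q (i : 'Hom(K, Q)) (p : 'Hom(Q, X))
    (P : nat -> omod) (d : forall n, 'Hom(P n.+1, P n)) (e : 'Hom(P 0%N, K)) :
  syz V i p -> @oresolution K P d e ->
  oresolution (splice_map (i \o e)%VF d) (p : 'Hom(splice_obj Q P 0, X)).
Proof.
case=> pQ s [Pp hd he es ee ed]; split.
- by case.
- by case=> [|n] //=; apply: ohom_comp => //; exact: ses_hi s.
- exact: ses_hp s.
- exact: ses_surj s.
- move=> x; split=> [/(ses_ex s)[z ->] | [y ->]] /=.
    by case: (es z) => y <-; exists y; rewrite comp_lfunE.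
  by rewrite comp_lfunE (ses_pi s).
case=> [|n] x; last exact: ed.
apply: (iff_trans _ (ee x)); rewrite /= comp_lfunE.
by split=> [/(ses_inj0 s) | ->]; rewrite ?linear0.
Qed.

Lemma extS_ext N n X : V X -> extS_eq0 N n X -> ext_eq0 V N n X.
Proof.
elim: n X => [|n IH] X VX eX.
  have [K [Q [i [p s]]]] := enough_proj vV genC VX.
  apply: (ext1_syz s) => f hf.
  have [P [d [e r]]] := resolution_exists (syz_var vV s).1.
  have [||g hg gE] := eX _ _ _ (splice_resolution s r) (f \o e)%VF.
  - by apply: ohom_comp => //; apply: ores_he r.
  - by move=> x; rewrite comp_lfunE /= (_ : e _ = 0) ?linear0 //; apply/(ores_e r); exists x.
  exists g => // x; case: (ores_surj r x) => y <-.
  by have := gE y; rewrite /= !comp_lfunE.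
move=> K Q i p s; apply: IH; first by case: (syz_var vV s).
move=> P d e r f hf fd.
exact: (eX _ _ _ (splice_resolution s r)).
Qed.

Lemma resolution_tail X P d e : @oresolution X P d e ->
  exists K (i : 'Hom(K, P 0%N)) (e0 : 'Hom(P 1%N, K)),
    [/\ ses i e, @oresolution K (fun n => P n.+1) (fun n => d n.+1) e0
      & forall x, i (e0 x) = d 0%N x].
Proof.
move=> r; have [K [i s]] := ker_exists (ores_he r) (ores_surj r).
have [|e0 he0 ie0] := oproj_lift_ker s (@ores_hd _ _ _ _ r 0%N).
  by move=> x; apply/(ores_e r); exists x.
exists K, i, e0; split=> //; split=> //.
- by move=> m; apply: (ores_proj r).
- by move=> m; apply: (ores_hd r).
- move=> z; have /(ores_e r)[y yE] := ses_pi s z; exists y.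
  by apply: (ses_inj s); rewrite ie0 yE.
- by move=> x; rewrite -(ores_d r) -ie0; split=> [->|/(ses_inj0 s) //]; rewrite linear0.
by move=> m x; apply: (ores_d r).
Qed.

Lemma ext_extS N n X : ext_eq0 V N n X -> extS_eq0 N n X.
Proof.
elim: n X => [|n IH] X eX P d e r f hf fd;
  have [K [i [e0 [s r0 ie0]]]] := resolution_tail r.
  have [|h hh hE] := factor_epi (ores_he r0) (ores_surj r0) hf.
    by move=> x /(ores_e r0)[y ->].
  have [g hg gE] := eX _ _ _ _ (ores_proj r 0).1 s _ hh.
  by exists g => // x; rewrite -ie0 gE hE.
have eK : ext_eq0 V N n K by apply: (eX _ _ i e); split=> //; apply: (ores_proj r).
exact: IH eK _ _ _ r0 f hf fd.
Qed.

End Resolutions.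

Lemma proj_resolution_ores (k : fieldType) (B : falgType k) (M : rmodule B) P d e :
  @proj_resolution k B M P d e ->
  @oresolution _ _ (@modV k B) (om M) (fun n => om (P n)) d e.
Proof.
case=> Pp [hd he] ef e0 ed; split=> [a | a | | | x | a x].
- exact/projective_oproj.
- exact/mod_hom_ohom.
- exact/mod_hom_ohom.
- exact/limg_fullP.
- have := memv_ker e x; rewrite -e0 => E0; split=> [ex | [y xE]].
    have /memv_imgP[y _ ->] : x \in limg (d 0%N) by rewrite E0 ex.
    by exists y.
  by apply/eqP; rewrite -E0 xE memv_img ?memvf.
have := memv_ker (d a) x; rewrite -ed => E0; split=> [ex | [y xE]].
  have /memv_imgP[y _ ->] : x \in limg (d a.+1) by rewrite E0 ex.
  by exists y.
by apply/eqP; rewrite -E0 xE memv_img ?memvf.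
Qed.

(** The bridge between Ext vanishing tested on all projective resolutions, as in the definition of
    Cohen-Macaulay modules, and the recursive form by dimension shifting. *)
Lemma ExtS_ext_eq0 (k : fieldType) (B : falgType k) n (M N : rmodule B) :
  ExtS_eq0 n M N <-> ext_eq0 (@modV k B) (om N) n (om M).
Proof.
split=> [E | E P d e r f hf fd].
  apply: (extS_ext (@modV_variety _ _) (@modV_covering _ _) (om_modV M)).
  move=> P d e r f hf fd.
  pose P' n := rmod_of (ores_proj r n).1.
  have [|||g hg gd] := E P' d e _ f.
  - split.
    + move=> a; apply/projective_oproj; split=> [|X Y p h vX hp ps hh].
        exact: om_modV.
      have [|g hg pg] := (ores_proj r a).2 X Y p h vX hp ps.
        by move=> b x; rewrite -hh omE.
      by exists g => // b x; rewrite omE -hg.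
    + split=> [a | ].
        by apply/rmod_of_hom; exact: (@ores_hd _ _ _ _ _ _ _ r a).
      by move=> m b; rewrite -[RHS]omE; apply: (ores_he r).
    + by apply/limg_fullP; exact: (ores_surj r).
    + apply/vspaceP => x; rewrite memv_ker; apply/memv_imgP/eqP => [[y _ ->]|].
        by apply/(ores_e r); exists y.
      by case/(ores_e r) => y ->; exists y; rewrite ?memvf.
    move=> a; apply/vspaceP => x; rewrite memv_ker; apply/memv_imgP/eqP => [[y _ ->]|].
      by apply/(ores_d r); exists y.
    by case/(ores_d r) => y ->; exists y; rewrite ?memvf.
  - by move=> m b; rewrite -[RHS]omE; apply: hf.
  - by apply/lfunP => x; rewrite comp_lfunE fd zero_lfunE.
  exists g; first by move=> b m; rewrite omE; apply: hg.
  by move=> x; rewrite -gd comp_lfunE.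
have [||g hg gd] := @ext_extS _ _ _ _ _ _ E (fun n => om (P n)) d e
    (proj_resolution_ores r) f.
- exact/mod_hom_ohom.
- by move=> x; rewrite -comp_lfunE fd zero_lfunE.
exists g; first exact/mod_hom_ohom.
by apply/lfunP => x; rewrite comp_lfunE gd.
Qed.

(** * Graded modules, their shifts and graded projectives *)

Section Graded.
Variables (k : fieldType) (A : falgType k) (l : nat) (gr : grading A l).
Notation gomod := (omod k (A + int)%type).
Implicit Types X Y Z K M N P : gomod.

Definition act X (a : A) : 'End(ocar X) := oact X (inl a).
Definition pj X (i : int) : 'End(ocar X) := oact X (inr i).
Definition fgt X : omod k A := OMod (act X).

(** The second clause says that only finitely many degrees occur; the last one expresses that
    degrees add under the action, in terms of projectors. *)
Definition grV X : Prop :=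
  [/\ modV (fgt X),
      exists2 s, uniq s & forall m, \sum_(i <- s) pj X i m = m,
      forall i j m, pj X i (pj X j m) = if i == j then pj X j m else 0
    & forall i j a m, a \in gr j -> pj X (i + j) (act X a m) = act X a (pj X i m)].

Lemma ohomE X Y (f : 'Hom(X, Y)) : ohom f <->
  (forall a m, f (act X a m) = act Y a (f m)) /\
  (forall i m, f (pj X i m) = pj Y i (f m)).
Proof. by split=> [hf | [ha hp] [a|i] m]; [split=> *; apply: hf | apply: ha | apply: hp]. Qed.

Lemma grV_out X s : grV X -> uniq s -> (forall m, \sum_(i <- s) pj X i m = m) ->
  forall i m, i \notin s -> pj X i m = 0.
Proof.
case=> _ _ prO _ us prS i m si; rewrite -[m]prS linear_sum big_seq big1 // => j sj /=.
by rewrite prO; case: eqP => // E; rewrite -E (negPf si) in sj.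
Qed.

Lemma grV_sum X s s' : grV X -> uniq s -> (forall m, \sum_(i <- s) pj X i m = m) ->
  uniq s' -> {subset s <= s'} -> forall m, \sum_(i <- s') pj X i m = m.
Proof.
move=> vX us sE us' ss m; have out := grV_out vX us sE.
rewrite (bigID (mem s)) /= [X in _ + X]big1 ?addr0; last by move=> i /out.
rewrite -[RHS]sE -big_filter; apply: perm_big.
apply: uniq_perm; rewrite ?filter_uniq // => i.
by rewrite mem_filter /=; case si: (i \in s) => //=; rewrite ss.
Qed.

Lemma grV_variety : variety grV.
Proof.
split.
- move=> M N f /ohomE[ha hp] fi [vM [s us sE] prO prM]; split.
  + by apply: (@var_sub _ _ _ (@modV_variety _ A) (fgt M) (fgt N) f) => // a m; apply: ha.
  + exists s => // m; apply: fi; rewrite linear_sum -[RHS]sE.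
    by apply: eq_bigr => i _; apply: hp.
  + by move=> i j m; apply: fi; rewrite !hp prO; case: ifP; rewrite ?linear0.
  + by move=> i j a m aj; apply: fi; rewrite !(hp, ha) prM.
- move=> M N f /ohomE[ha hp] fs [vM [s us sE] prO prM]; split.
  + by apply: (@var_quot _ _ _ (@modV_variety _ A) (fgt M) (fgt N) f) => // a m; apply: ha.
  + exists s => // y; case: (fs y) => m <-.
    by rewrite -[in RHS](sE m) linear_sum; apply: eq_bigr => i _; rewrite -hp.
  + by move=> i j y; case: (fs y) => m <-; rewrite -!hp prO; case: ifP; rewrite ?linear0.
  + by move=> i j a y aj; case: (fs y) => m <-; rewrite -!(hp, ha) prM.
- move=> M N vM' vN'; have [vM [s us sE] prO prM] := vM'.
  have [vN [t ut tE] qrO qrM] := vN'.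
  split.
  + have aE (a : A) (x : osum M N) :
        act (osum M N) a x = (act M a x.1, act N a x.2) by apply: osum_actE.
    case: vM vN => [M1 MM ML] [N1 NM NL].
    split=> [[x y] | a b [x y] | c a b [x y]]; rewrite /= !aE;
      apply: injective_projections.
    * exact: M1.
    * exact: N1.
    * exact: MM.
    * exact: NM.
    * exact: ML.
    exact: NL.
  + have sub1 : {subset s <= undup (s ++ t)}.
      by move=> i si; rewrite mem_undup mem_cat si.
    have sub2 : {subset t <= undup (s ++ t)}.
      by move=> i si; rewrite mem_undup mem_cat si orbT.
    exists (undup (s ++ t)); first exact: undup_uniq.
    have u := undup_uniq (s ++ t).
    case=> x y; rewrite -[in RHS](grV_sum vM' us sE u sub1 x).
    rewrite -[in RHS](grV_sum vN' ut tE u sub2 y).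
    elim/big_ind3 : _ => // [_ a b _ c d -> -> // | i _].
    by rewrite /pj osum_actE.
  + move=> i j [x y]; rewrite /pj !osum_actE /= -/(pj _ _) -/(pj _ _).
    by move: (prO i j x) (qrO i j y) => /= -> ->; case: ifP.
  move=> i j a [x y] aj; rewrite /pj /act !osum_actE /=.
  by congr pair; [apply: prM | apply: qrM].
split.
- by split=> *; rewrite [LHS]ozero_eq0 [RHS]ozero_eq0.
- by exists [::] => // m; rewrite big_nil [RHS]ozero_eq0.
- by move=> *; rewrite [LHS]ozero_eq0 [RHS]ozero_eq0.
by move=> *; rewrite [LHS]ozero_eq0 [RHS]ozero_eq0.
Qed.

(** With this sign convention the unit of [gshift greg n] sits in degree [n], so maps out of it pick
    out elements of degree [n]. *)
Definition gshift X (n : int) : gomod :=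
  @OMod k (A + int)%type X (fun o => match o with inl a => act X a | inr i => pj X (i - n) end).

Lemma act_shift X n a m : act (gshift X n) a m = act X a m. Proof. by []. Qed.
Lemma pj_shift X n i m : pj (gshift X n) i m = pj X (i - n) m. Proof. by []. Qed.

Lemma grV_shift X n : grV X -> grV (gshift X n).
Proof.
case=> vX [s us sE] prO prM; split=> //.
- exists [seq i + n | i <- s]; first by rewrite map_inj_uniq // => x y /addIr.
  by move=> m; rewrite big_map -[RHS]sE; apply: eq_bigr => i _; rewrite pj_shift addrK.
- by move=> i j m; rewrite !pj_shift prO (inj_eq (addIr _)).
by move=> i j a m aj; rewrite !pj_shift !act_shift addrAC prM.
Qed.

Lemma ohom_shift X Y n (f : 'Hom(X, Y)) :
  ohom f -> ohom (f : 'Hom(gshift X n, gshift Y n)).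
Proof.
by move=> /ohomE[ha hp]; apply/ohomE; split=> [a|i] m; [rewrite !act_shift | rewrite !pj_shift].
Qed.

Lemma gshiftK X n : oiso (gshift (gshift X n) (- n)) X.
Proof.
exists \1%VF.
  apply/ohomE; split=> [a|i] m; rewrite !id_lfunE // !pj_shift.
  by rewrite opprK addrK.
by split=> [x y | y]; [rewrite !id_lfunE | exists y; rewrite id_lfunE].
Qed.

Lemma ses_shift X Y Z n (i : 'Hom(X, Y)) (p : 'Hom(Y, Z)) :
  ses i p -> @ses _ _ (gshift X n) (gshift Y n) (gshift Z n) i p.
Proof. by case=> hi hp ii ps pi ex; split=> //; apply: ohom_shift. Qed.

Lemma grV_unshift X n : grV (gshift X n) -> grV X.
Proof.
move/(grV_shift (- n)) => vX; case: (oiso_sym (gshiftK X n)) => f hf [fi _].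
exact: (var_sub grV_variety hf fi vX).
Qed.

Lemma oproj_shift P n : oproj grV P -> oproj grV (gshift P n).
Proof.
case=> vP Pp; split=> [|M N p f vM hp ps hf]; first exact: grV_shift.
have [||||g hg pg] := Pp (gshift M (- n)) (gshift N (- n)) p f.
- exact: grV_shift.
- exact: ohom_shift.
- by [].
- have := @ohom_shift _ _ (- n) _ hf => /ohomE[ha hb]; apply/ohomE; split=> // i m.
  by rewrite -hb !pj_shift opprK addrK.
exists g => //; case/ohomE: hg => ha hb; apply/ohomE; split=> [a | i] m.
  exact: ha.
by rewrite pj_shift hb pj_shift opprK subrK.
Qed.

Definition gproj_fun (M : grmodule gr) : int -> 'End(gcarrier M) :=
  projT1 (cid (grading_proj (gdeg_dec M))).

Lemma gproj_funP (M : grmodule gr) (pr := gproj_fun M) :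
  [/\ exists2 s, uniq s & forall m, \sum_(i <- s) pr i m = m,
      forall i j m, m \in gdeg M j -> pr i m = if i == j then m else 0
    & forall i m, pr i m \in gdeg M i].
Proof. exact: (projT2 (cid (grading_proj (gdeg_dec M)))). Qed.

Definition gom (M : grmodule gr) : gomod :=
  @OMod k (A + int)%type (gcarrier M)
    (fun o => match o with inl a => oact (om M) a | inr i => gproj_fun M i end).

Lemma gom_actE (M : grmodule gr) a m : act (gom M) a m = ract M m a.
Proof. exact: lfun_ofE. Qed.

Lemma fgt_gom (M : grmodule gr) : fgt (gom M) = om M.
Proof. by []. Qed.

Lemma gom_degP (M : grmodule gr) i m : m \in gdeg M i <-> pj (gom M) i m = m.
Proof.
have [_ prU prM] := gproj_funP M; split=> [/prU -> | <-]; first by rewrite eqxx.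
exact: prM.
Qed.

Lemma gom_grV (M : grmodule gr) : grV (gom M).
Proof.
have [[s us sE] prU prM] := gproj_funP M.
have sumE m : \sum_(i <- s) pj (gom M) i m = m by apply: sE.
split.
- by rewrite fgt_gom; apply: om_modV.
- by exists s.
- by move=> i j m; apply: prU; apply: prM.
move=> i j a m aj; rewrite -[in LHS](sumE m) -[in RHS](sumE m) !linear_sum.
apply: eq_bigr => t _ /=; rewrite gom_actE gom_actE.
have mt : pj (gom M) t m \in gdeg M t by apply: prM.
have := @gdegM _ _ _ _ _ M _ _ _ _ mt aj => /(prU (i + j)) E.
rewrite [LHS]E (inj_eq (addIr _)) [pj (gom M) i _](prU i t _ mt).
by case: eqP => // _; rewrite -gom_actE linear0.
Qed.

Lemma grV_modV X : grV X -> modV (fgt X). Proof. by case. Qed.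

Lemma grV_grading X : grV X -> is_grading (fun i => limg (pj X i)).
Proof. by case=> _ [s us sE] prO _; apply: proj_grading us sE prO. Qed.

Lemma grV_degM X i j m a : grV X -> m \in limg (pj X i) -> a \in gr j ->
  act X a m \in limg (pj X (i + j)).
Proof.
case=> _ _ prO prM /memv_imgP[x _ ->] aj.
by rewrite -(prM _ _ _ _ aj) memv_img ?memvf.
Qed.

Definition gmod_on (X : gomod) (vX : grV X) : grmod_on gr X.
Proof.
apply: (@GrModOn k A l gr X (rmod_str (rmod_of (grV_modV vX))) (fun i => limg (pj X i))).
- exact: grV_grading vX.
- by move=> i j m a; apply: grV_degM vX.
Defined.

Definition gmod_of (X : gomod) (vX : grV X) : grmodule gr := GrModule (gmod_on vX).

Lemma gmod_of_deg X vX i m : m \in gdeg (@gmod_of X vX) i <-> pj X i m = m.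
Proof.
split=> [/memv_imgP[x _ ->] | <-]; last by rewrite memv_img ?memvf.
by have [_ _ -> _] := vX; rewrite eqxx.
Qed.

Lemma gom_gmod_act X vX a m : act (gom (@gmod_of X vX)) a m = act X a m.
Proof. exact: gom_actE. Qed.

Lemma gom_gmod_pj X vX i m : pj (gom (@gmod_of X vX)) i m = pj X i m.
Proof.
have [_ [s us sE] prO _] := vX.
rewrite -[in LHS](sE m) linear_sum -[in RHS](sE m) linear_sum; apply: eq_bigr => j _ /=.
have [_ prU _] := gproj_funP (gmod_of vX).
by rewrite prO; apply: prU; apply/gmod_of_deg; rewrite prO eqxx.
Qed.

Lemma gmod_ofK X vX : oiso (gom (@gmod_of X vX)) X.
Proof.
exists (\1%VF : 'Hom(gom (gmod_of vX), X)).
  apply/ohomE; split=> [a | i] m; rewrite !id_lfunE; first exact: gom_gmod_act.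
  exact: gom_gmod_pj.
by split=> [x y | y]; [rewrite !id_lfunE | exists y; rewrite id_lfunE].
Qed.

Lemma ohom_gmodl X vX Y (f : 'Hom(X, Y)) :
  ohom (f : 'Hom(gom (@gmod_of X vX), Y)) <-> ohom f.
Proof.
split=> /ohomE[ha hp]; apply/ohomE; split=> ? m.
- by rewrite -ha gom_gmod_act.
- by rewrite -hp gom_gmod_pj.
- by rewrite -ha gom_gmod_act.
by rewrite -hp gom_gmod_pj.
Qed.

Lemma ohom_gmodr X vX Y (f : 'Hom(Y, X)) :
  ohom (f : 'Hom(Y, gom (@gmod_of X vX))) <-> ohom f.
Proof.
split=> /ohomE[ha hp]; apply/ohomE; split=> ? m.
- by rewrite ha gom_gmod_act.
- by rewrite hp gom_gmod_pj.
- by rewrite ha gom_gmod_act.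
by rewrite hp gom_gmod_pj.
Qed.

Lemma gr_hom_ohom (M N : grmodule gr) (f : 'Hom(M, N)) :
  gr_hom f <-> ohom (f : 'Hom(gom M, gom N)).
Proof.
split=> [[ha hp] | /ohomE[ha hp]].
  apply/ohomE; split=> [a m | i m]; first by rewrite !gom_actE ha.
  have [[s us sE] prU prM] := gproj_funP M.
  have [_ qrU _] := gproj_funP N.
  rewrite -(sE m) !linear_sum; apply: eq_bigr => j _ /=.
  have mj : f (gproj_fun M j m) \in gdeg N j.
    by apply: (subvP (hp j)); rewrite memv_img.
  by rewrite [RHS](qrU i j _ mj) (prU i j _ (prM j m)); case: eqP => // _; rewrite linear0.
split=> [m a | i]; first by have := ha a m; rewrite !gom_actE.
apply/subvP => _ /memv_imgP[m /gom_degP mi ->].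
by apply/gom_degP; rewrite -hp mi.
Qed.

Lemma gr_projective_oproj (P : grmodule gr) : gr_projective P <-> oproj grV (gom P).
Proof.
split=> [Pp | [_ Pp] M N p f hp pf hf].
  split=> [|M N p f vM hp ps hf]; first exact: gom_grV.
  have vN := var_quot grV_variety hp ps vM.
  have [|||g hg pg] := Pp (gmod_of vM) (gmod_of vN) p f.
  - exact/gr_hom_ohom/ohom_gmodl/ohom_gmodr.
  - exact/limg_fullP.
  - exact/gr_hom_ohom/ohom_gmodr.
  exists g; first exact/(ohom_gmodr vM)/gr_hom_ohom.
  by move=> x; rewrite -pg comp_lfunE.
have [|||g hg pg] := Pp (gom M) (gom N) p f (gom_grV M).
- exact/gr_hom_ohom.
- exact/limg_fullP.
- exact/gr_hom_ohom.
exists g; first exact/gr_hom_ohom.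
by apply/lfunP => x; rewrite comp_lfunE pg.
Qed.

Lemma gr_injective_oinj (I : grmodule gr) : gr_injective I <-> oinj grV (gom I).
Proof.
split=> [Ii K Y i vY hi ii f hf | Ii M N u f hu u0 hf].
  have vK := var_sub grV_variety hi ii vY.
  have [|||g hg ig] := Ii (gmod_of vK) (gmod_of vY) i f.
  - exact/gr_hom_ohom/ohom_gmodl/ohom_gmodr.
  - exact/lker_eq0P.
  - exact/gr_hom_ohom/ohom_gmodl.
  exists g; first exact/(ohom_gmodl vY)/gr_hom_ohom.
  by move=> x; rewrite -ig comp_lfunE.
have [|||g hg ig] := Ii (gom M) (gom N) u (gom_grV N) _ _ f.
- exact/gr_hom_ohom.
- exact/lker_eq0P.
- exact/gr_hom_ohom.
exists g; first exact/gr_hom_ohom.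
by apply/lfunP => x; rewrite comp_lfunE ig.
Qed.

Definition greg : gomod := gom (gr_regular gr).

Lemma greg_act a m : act greg a m = m * a.
Proof. exact: gom_actE. Qed.

Lemma greg_grV : grV greg. Proof. exact: gom_grV. Qed.

Lemma greg_degP i (a : A) : a \in gr i <-> pj greg i a = a.
Proof. by have H := @gom_degP (gr_regular gr) i a; exact: H. Qed.

Lemma greg_pj_deg i (a : A) : pj greg i a \in gr i.
Proof. by have [_ _] := gproj_funP (gr_regular gr); apply. Qed.

Lemma act_pj X i t m a : grV X -> pj X i m = m ->
  pj X t (act X a m) = act X (pj greg (t - i) a) m.
Proof.
move=> vX mi; have [vV _ prO prM] := vX.
have [_ [s us sE] qrO _] := greg_grV.
have sumE (n : X) (b : int -> A) :
    act X (\sum_(j <- s) b j) n = \sum_(j <- s) act X (b j) n.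
  exact: (@modV_sum _ _ _ _ _ (fgt X) n vV).
rewrite -[in LHS](sE a) sumE linear_sum -[in RHS](sE a) linear_sum sumE.
apply: eq_bigr => j _ /=.
have -> : pj X t (act X (pj greg j a) m) = act X (pj greg j a) (pj X (t - j) m).
  by rewrite -(prM _ j) ?greg_pj_deg // subrK.
rewrite -[in LHS]mi prO qrO (_ : (t - i == j) = (t - j == i)).
  by case: eqP => _; rewrite ?linear0 ?mi //; have := modV0 vV m => /= ->.
by apply/eqP/eqP => <-; rewrite opprB addrC subrK.
Qed.

Lemma greg1 i : pj greg i (1 : A) = if i == 0 then 1 else 0.
Proof.
by have [_ prU _] := gproj_funP (gr_regular gr); apply: (prU i 0); exact: homog1.
Qed.

Definition gorbit_map X (vX : grV X) (m : X) : 'Hom(greg, X) :=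
  @orbit_map _ _ (fgt X) (grV_modV vX) m.

Lemma gorbit_mapE X vX m a : @gorbit_map X vX m a = act X a m.
Proof. exact: lfun_ofE. Qed.

Lemma gorbit_map_hom X vX i m : pj X i m = m ->
  ohom (@gorbit_map X vX m : 'Hom(gshift greg i, X)).
Proof.
move=> mi; apply/ohomE; split=> [a b | t b]; rewrite !gorbit_mapE.
  by rewrite act_shift greg_act; case: (vX) => -[_ vM _] _ _ _; apply: vM.
by rewrite pj_shift (act_pj _ _ vX mi).
Qed.

Lemma greg_oproj i : oproj grV (gshift greg i).
Proof.
split=> [|M N p f vM hp ps hf]; first exact/grV_shift/greg_grV.
(* The unit has degree [i] in the shift, so the degree [i] part of any preimage of [f 1] is again a
   preimage. *)
case: (ps (f 1)) => m0 m0E; pose m := pj M i m0.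
have mi : pj M i m = m by rewrite /m; case: (vM) => _ _ -> _; rewrite eqxx.
have [fa fp] := (ohomE _).1 hf; have [pa pp] := (ohomE _).1 hp.
have mE : p m = f 1.
  by rewrite /m pp m0E -fp pj_shift subrr greg1 eqxx.
exists (gorbit_map vM m); first exact: gorbit_map_hom.
by move=> a; rewrite gorbit_mapE pa mE -fa act_shift greg_act mul1r.
Qed.

Lemma grV_covering : covering grV (fun G => exists i, G = gshift greg i).
Proof.
split=> [_ [i ->] | M U vM Uf]; first exact: greg_oproj.
have [_ [s us sE] prO _] := vM.
have [[i m]] : exists im : int * M, pj M im.1 im.2 \notin U.
  apply: contrapT => /forallNP nU; apply: Uf; apply/vspaceP => m.
  rewrite memvf -(sE m); apply: rpred_sum => i _.
  exact/negbNE/negP/(nU (i, m)).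
move=> /= mU; exists (gshift greg i); first by exists i.
have mi : pj M i (pj M i m) = pj M i m by rewrite prO eqxx.
exists (gorbit_map vM (pj M i m)); first exact: gorbit_map_hom.
move/subvP/(_ (pj M i m)) => sub; case/negP: mU; apply: sub.
have E : gorbit_map vM (pj M i m) 1 = pj M i m.
  by rewrite gorbit_mapE; case: (vM) => -[v1 _ _] _ _ _; apply: v1.
by rewrite -[X in X \in _]E memv_img ?memvf.
Qed.

Lemma ohom_fgt X Y (f : 'Hom(X, Y)) : ohom f -> ohom (f : 'Hom(fgt X, fgt Y)).
Proof. by case/ohomE. Qed.

Lemma ses_fgt X Y Z (i : 'Hom(X, Y)) (p : 'Hom(Y, Z)) :
  ses i p -> @ses _ _ (fgt X) (fgt Y) (fgt Z) i p.
Proof. by case=> hi hp ii ps pi ex; split=> //; apply: ohom_fgt. Qed.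

(** A graded projective is a retract of a sum of shifts of [A], and these become free once the
    grading is forgotten. *)
Lemma oproj_fgt P : oproj grV P -> oproj (@modV k A) (fgt P).
Proof.
apply: (oproj_ind grV_variety grV_covering (X := fun P => oproj (@modV k A) (fgt P))).
- by apply: (oproj_eq0 (@modV_variety k A)); rewrite /odim dim_matrix.
- by move=> _ [i ->]; apply: oreg_proj.
- move=> M N pM pN; apply: (oproj_retract (@modV_variety k A) _
    (oproj_sum (@modV_variety k A) pM pN)).
  exists (\1%VF : 'Hom(fgt (osum M N), osum (fgt M) (fgt N))).
  exists (\1%VF : 'Hom(osum (fgt M) (fgt N), fgt (osum M N))).
  have aE (a : A) (x : osum M N) :
      oact (osum (fgt M) (fgt N)) a x = act (osum M N) a x.
    transitivity ((act M a x.1, act N a x.2) : osum M N); first exact: osum_actE.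
    by symmetry; apply: osum_actE.
  by split=> [a x | a x | x]; rewrite !id_lfunE.
move=> M N [i [p [hi hp pi]]]; apply: (oproj_retract (@modV_variety k A)).
by exists i, p; split=> //; apply: ohom_fgt.
Qed.

End Graded.

(** * Cohen-Macaulay modules and their Grothendieck group *)

Section CohenMacaulay.
Variables (k : fieldType) (A : falgType k) (l : nat) (gr : grading A l).
Notation gomod := (omod k (A + int)%type).
Notation grV := (grV gr).
Notation greg := (greg gr).
Implicit Types X Y Z K M N P I : gomod.

Lemma oinj_shift I n : oinj grV I -> oinj grV (gshift I n).
Proof.
move=> Ii K Y i vY hi ii f hf.
have fS : ohom (f : 'Hom(gshift K (- n), I)).
  have := @ohom_shift _ _ _ _ (- n) _ hf => /ohomE[ha hb].
  apply/ohomE; split=> [|j m]; first exact: ha.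
  by rewrite hb !pj_shift opprK addrK.
have [g hg gE] := Ii (gshift K (- n)) (gshift Y (- n)) i (grV_shift (- n) vY)
  (@ohom_shift _ _ _ _ (- n) _ hi) ii f fS.
exists g => //; case/ohomE: hg => ha hb; apply/ohomE; split=> [|j m]; first exact: ha.
by rewrite pj_shift -hb pj_shift opprK subrK.
Qed.

(** Ext is the ungraded one, as in [cm_on]; the index [n] stands for Ext^(n+1). *)
Definition gCM X := forall n, ext_eq0 (@modV k A) (oreg A) n (fgt X).

Lemma syz_fgt K P X (i : 'Hom(K, P)) (p : 'Hom(P, X)) :
  syz grV i p -> @syz _ _ (@modV k A) (fgt K) (fgt P) (fgt X) i p.
Proof. by case=> pP e; split; [apply: oproj_fgt pP | apply: ses_fgt e]. Qed.

Let mV := @modV_variety k A.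
Let mC := @modV_covering k A.
Let gV := grV_variety gr.
Let gC := grV_covering gr.

Lemma CM_proj P : oproj grV P -> gCM P.
Proof. by move=> pP n; apply: (ext_proj mV mC) (oproj_fgt pP). Qed.

Lemma CM_ses X Y Z (i : 'Hom(X, Y)) (p : 'Hom(Y, Z)) :
  grV Y -> ses i p -> gCM X -> gCM Z -> gCM Y.
Proof.
move=> vY e cX cZ n.
exact: (ext_ses mV mC (grV_modV vY) (ses_fgt e)).
Qed.

Lemma CM_syz K P X (i : 'Hom(K, P)) (p : 'Hom(P, X)) : syz grV i p -> gCM X -> gCM K.
Proof. by move=> s cX n; apply: (cX n.+1) (syz_fgt s). Qed.

Lemma CM_retract X Y : grV Y -> retract X Y -> gCM Y -> gCM X.
Proof.
move=> vY [i [p [hi hp pi]]] cY n.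
apply: (ext_retract mV mC (grV_modV vY) _ (cY n)).
by exists i, p; split=> //; apply: ohom_fgt.
Qed.

(** The degree-preserving component of an ungraded homomorphism, which turns ungraded extensions of
    graded maps into graded ones. *)
Lemma hom_component X Y (f : 'Hom(fgt X, fgt Y)) : grV X -> grV Y -> ohom f ->
  exists2 g : 'Hom(X, Y), ohom g & forall i m, pj X i m = m -> g m = pj Y i (f m).
Proof.
move=> vX vY hf; have [_ [s us sE] prO prM] := vX.
have [_ _ qrO qrM] := vY.
pose g : 'Hom(X, Y) := \sum_(i <- s) (pj Y i \o (f : 'Hom(X, Y)) \o pj X i)%VF.
have gE i m : pj X i m = m -> g m = pj Y i (f m).
  move=> mi; rewrite sum_lfunE; have [si | si] := boolP (i \in s).
    rewrite (bigD1_seq i) //= big1 ?addr0 => [|j ji].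
      by rewrite !comp_lfunE mi.
    by rewrite !comp_lfunE -mi prO (negPf ji) !linear0.
  have m0 : m = 0 by rewrite -mi (grV_out vX us sE).
  by rewrite m0 !linear0 big1 // => j _; rewrite linear0.
exists g => //; apply/ohomE; split=> [a m | i m]; last first.
  rewrite -(sE m) !linear_sum; apply: eq_bigr => j _ /=.
  rewrite (gE j (pj X j m)) ?prO ?eqxx // qrO.
  by case: eqP => _; rewrite ?linear0 // (gE j) // prO eqxx.
rewrite -(sE m) !linear_sum; apply: eq_bigr => i _ /=.
move: (pj X i m) (prO i i m) => {}m; rewrite eqxx => mi.
have [_ [t ut tE] _ _] := greg_grV gr.
have sumE (W : gomod) (n : W) (b : int -> A) : grV W ->
    act W (\sum_(j <- t) b j) n = \sum_(j <- t) act W (b j) n.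
  by move=> vW; apply: (@modV_sum _ _ _ _ _ (fgt W) n (grV_modV vW)).
rewrite -(tE a) !sumE // linear_sum; apply: eq_bigr => j _ /=.
have aj := greg_pj_deg gr j a.
have E : pj X (i + j) (act X (pj greg j a) m) = act X (pj greg j a) m.
  by rewrite (prM _ _ _ _ aj) mi.
rewrite (gE _ _ E) (gE _ _ mi) -(qrM _ _ _ _ aj).
by congr (pj Y _ _); apply: hf.
Qed.

(** Projectives are relatively injective for sequences ending in a Cohen-Macaulay module, the
    Frobenius property. For a shift of [A] an ungraded extension exists, and its degree-preserving
    component still extends [f]; sums and retracts follow. *)
Lemma CM_extends K Y X (i : 'Hom(K, Y)) (p : 'Hom(Y, X)) I :
  grV Y -> ses i p -> gCM X -> oproj grV I -> extends I i.
Proof.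
move=> vY e cX; apply: (oproj_ind gV gC (X := fun I => extends I i)).
- move=> f _; exists 0; first exact: ohom0.
  by move=> x; rewrite [LHS]ozero_eq0 [RHS]ozero_eq0.
- move=> _ [n ->] f hf.
  have vR := grV_shift n (greg_grV gr).
  have [g hg gE] := cX 0%N _ _ _ _ (grV_modV vY) (ses_fgt e) _ (ohom_fgt hf).
  have [h hh hE] := hom_component vY vR hg.
  exists h => // x.
  have [_ [s us sE] prO _] := ses_varl gV e vY.
  rewrite -(sE x) !linear_sum; apply: eq_bigr => t _ /=.
  have /ohomE[_ hi] := ses_hi e; have /ohomE[_ hp] := hf.
  rewrite (hE t); last by rewrite -hi prO eqxx.
  by rewrite [g _]gE -hp prO eqxx.
- move=> M N eM eN f hf.
  have [g hg gE] := eM _ (ohom_comp (@ofst_hom _ _ M N) hf).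
  have [h hh hE] := eN _ (ohom_comp (@osnd_hom _ _ M N) hf).
  exists (opair g h); first exact: opair_hom.
  by move=> x; rewrite opairE gE hE !comp_lfunE ofstE osndE; case: (f x).
move=> M N [u [v [hu hv vu]]] eN f hf.
have [g hg gE] := eN _ (ohom_comp hu hf).
exists (v \o g)%VF; first exact: ohom_comp.
by move=> x; rewrite comp_lfunE gE comp_lfunE vu.
Qed.

(** Ungraded Ext into [A] is the sum of the graded Ext groups into its shifts: an ungraded map is
    the sum of its homogeneous components, and each of them extends. *)
Lemma graded_ext_CM X : grV X ->
  (forall n t, ext_eq0 grV (gshift greg t) n X) -> gCM X.
Proof.
move=> vX eX n; move: {eX}(eX n); elim: n X vX => [|n IH] X vX eX.
  have [K [P [i [p s]]]] := enough_proj gV gC vX.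
  apply: (ext1_syz (syz_fgt s)) => f hf.
  have [vK _] := syz_var gV s.
  have vR := greg_grV gr.
  have compE t : exists g : 'Hom(P, greg), ohom (g : 'Hom(fgt P, oreg A)) /\
      forall j m, pj K j m = m -> g (i m) = pj greg (j - t) (f m).
    have [g hg gE] := @hom_component K (gshift greg t) f vK (grV_shift t vR) hf.
    have [h hh hE] := eX t _ _ _ _ s.1.1 s.2 _ hg.
    exists h; split=> [|j m mj]; first exact: (ohom_fgt hh).
    by rewrite hE (gE j).
  have [g gP] := choice compE.
  have [_ [sK uK KE] prO _] := vK; have [_ [sA uA AE] _ _] := vR.
  (* The finitely many degree differences between a component of [K] and one of [A]: outside them
     the components of [f] vanish. *)
  pose S := undup [seq j - u | j <- sK, u <- sA].
  exists (\sum_(t <- S) g t).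
    apply: (big_ind (fun h : 'Hom(fgt P, oreg A) => ohom h)).
    - exact: ohom0.
    - by move=> a b ha hb; apply: (ohomD ha hb).
    by move=> t _; case: (gP t).
  move=> x; rewrite -(KE x) !linear_sum big_seq [RHS]big_seq; apply: eq_bigr => j sj /=.
  have mj : pj K j (pj K j x) = pj K j x by rewrite prO eqxx.
  rewrite sum_lfunE (eq_bigr (fun t => pj greg (j - t) (f (pj K j x)))); last first.
    by move=> t _; case: (gP t) => _; apply.
  rewrite -(big_map (fun t => j - t) predT (fun u => pj greg u (f (pj K j x)))).
  apply: (grV_sum vR uA AE).
    by rewrite map_inj_uniq ?undup_uniq // => a b /addrI/oppr_inj.
  move=> u su; apply/mapP; exists (j - u); last by rewrite opprB addrC subrK.
  by rewrite mem_undup; apply: allpairs_f.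
have [K [P [i [p s]]]] := enough_proj gV gC vX.
apply: (ext_succ mV mC (syz_fgt s)); apply: IH; first by case: (syz_var gV s).
by move=> t; apply: eX s.
Qed.

(** Ext^(m+1) of the n-th syzygy is Ext^(m+n+1) of [M], which vanishes once [n] exceeds the length
    of an injective resolution of [A]. That length does not depend on [M], and shifting the
    resolution treats all shifts of [A]. *)
Lemma CM_omega : finite_gr_injdim (gr_regular gr) ->
  exists D, forall (Om : gomod -> gomod), (forall M, grV M ->
      exists P (i : 'Hom(Om M, P)) (p : 'Hom(P, M)), syz grV i p) ->
    forall n M, (D <= n)%N -> grV M -> gCM (iter n Om M).
Proof.
case=> D [R [d [e [Ri [hd he] [e0 ed] dd R0]]]].
exists D.+1 => Om OmP n M Dn vM.
have vO m N : grV N -> grV (iter m Om N).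
  by move=> vN; elim: m => //= m /OmP[P [i [p s]]]; case: (syz_var gV s).
apply: graded_ext_CM => [|m t]; first exact: vO.
have eE j N : grV N -> (D < j)%N -> ext_eq0 grV (gshift greg t) j N.
  move=> vN Dj; apply: (@ext_injdim _ _ _ gV (fun n => gshift (gom (R n)) t)
    d (gshift greg t) e D.+1) => // {j N vN Dj}.
  - move=> a; split; first exact/grV_shift/gom_grV.
    exact/oinj_shift/gr_injective_oinj.
  - by move=> a; apply: ohom_shift; apply/gr_hom_ohom.
  - by apply: ohom_shift; apply/gr_hom_ohom.
  - exact/lker_eq0P.
  - move=> x; have := memv_ker (d 0%N) x; rewrite -ed => E; split=> [ex | [y xE]].
      have /memv_imgP[y _ ->] : x \in limg e by rewrite E ex.
      by exists y.
    by apply/eqP; rewrite -E xE memv_img ?memvf.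
  - move=> a x; have := memv_ker (d a.+1) x; rewrite -dd => E; split=> [ex | [y xE]].
      have /memv_imgP[y _ ->] : x \in limg (d a) by rewrite E ex.
      by exists y.
    by apply/eqP; rewrite -E xE memv_img ?memvf.
  by move=> a /R0 Ra x; apply/eqP; rewrite -memv0 -Ra memvf.
have {}Dn : (D < m + n)%N by rewrite (leq_trans Dn) ?leq_addl.
elim: n m M vM Dn => [|n IH] m M vM Dn.
  by apply: eE; rewrite // -(addn0 m).
have [P [i [p s]]] := OmP _ (vO n _ vM).
rewrite /=; apply: (IH m.+1 M vM _) s.
by rewrite addSnnS.
Qed.

End CohenMacaulay.

(** * Classes of Cohen-Macaulay modules in K_0 *)

Section K0Classes.
Variables (k : fieldType) (A : falgType k) (l : nat) (gr : grading A l).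
Notation gomod := (omod k (A + int)%type).
Notation grV := (grV gr).
Notation gCM := (@gCM k A).
Implicit Types X Y Z K M N P I S : gomod.

Let mV := @modV_variety k A.
Let mC := @modV_covering k A.
Let gV := grV_variety gr.
Let gC := grV_covering gr.

Definition kpi (x : free_K0 gr) : K0 gr :=
  \pi_(ring_quotient.Quotient.quot (@K0_relations k A l gr))%qT x.

Lemma kpi_surj y : exists x, kpi x = y.
Proof. by exists (repr y); rewrite /kpi reprK. Qed.

Lemma kpiD : {morph kpi : x y / x + y}.
Proof. exact: ring_quotient.Quotient.pi_add. Qed.

Lemma kpiN : {morph kpi : x / - x}.
Proof. exact: ring_quotient.Quotient.pi_opp. Qed.

Lemma kpi0 : kpi 0 = 0.
Proof. by apply: (addrI (kpi 0)); rewrite -kpiD !addr0. Qed.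

Lemma kpi_eq0 x : kpi x = 0 <-> x \in @K0_relations k A l gr.
Proof.
rewrite -[in X in _ <-> X](subr0 x) ring_quotient.Quotient.idealrBE.
by rewrite -kpi0; split=> [E | /eqP]; [apply/eqP | ].
Qed.

Lemma kpi_relator x : K0_relator x -> kpi x = 0.
Proof. by move=> Rx; apply/kpi_eq0/asboolP => H _; apply. Qed.

Lemma fgt_iso_ext (X Y : omod k A) n : modV X -> oiso X Y ->
  ext_eq0 (@modV k A) (oreg A) n X -> ext_eq0 (@modV k A) (oreg A) n Y.
Proof.
by move=> vX /oiso_sym/oiso_retract r; apply: (ext_retract mV mC vX r).
Qed.

Fact cm_of_proof X (vX : grV X) : gCM X ->
  forall n, ExtS_eq0 n (RModule (gmod_on vX)) (regular_mod A).
Proof.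
move=> cX n; apply/ExtS_ext_eq0; apply: fgt_iso_ext (grV_modV vX) _ (cX n).
exists (\1%VF : 'Hom(fgt X, om (RModule (gmod_on vX)))).
  by move=> a m; rewrite !id_lfunE omE.
by split=> [x y | y]; [rewrite !id_lfunE | exists y; rewrite id_lfunE].
Qed.

Definition cm_of X (vX : grV X) (cX : gCM X) : cm_module gr :=
  CMModule (CMOn (@cm_of_proof X vX cX)).

Lemma gom_CM (X : cm_module gr) : gCM (gom X).
Proof.
move=> n; exact: (proj1 (ExtS_ext_eq0 n (RModule (cm_grmod (cm_str X))) (regular_mod A))
  (@cm_Ext _ _ _ _ _ (cm_str X) n)).
Qed.

Lemma CM_iso X Y : grV X -> oiso X Y -> gCM X -> gCM Y.
Proof. by move=> vX /oiso_sym/oiso_retract r; apply: CM_retract vX r. Qed.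

Lemma transport_exists (X : gomod) (W : vectType k) (f : 'Hom(X, W)) :
  injective f -> (forall y, exists x, f x = y) ->
  exists2 ops : A + int -> 'End(W), True & oiso X (OMod ops).
Proof.
move=> fi fs; exists (fun o => (f \o oact X o \o f^-1)%VF) => //.
exists (f : 'Hom(X, OMod (fun o => (f \o oact X o \o f^-1)%VF))) => //.
move=> o m; rewrite /= !comp_lfunE lker0_lfunK //; exact/lker0P.
Qed.

Lemma cm_coord_exists X : grV X -> gCM X -> exists c : cm_coord gr, oiso (gom c) X.
Proof.
move=> vX cX; have bX := vbasisP (fullv : {vspace X}).
pose f : 'Hom(X, 'rV[k]_(\dim (fullv : {vspace X}))) := lfun_of (passmx.rVof_linear (vbasis fullv)).
have fE x : f x = passmx.rVof (vbasis fullv) x by apply: lfun_ofE.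
have fi : injective f by move=> x y; rewrite !fE => /(can_inj (passmx.rVofK bX)).
have fs y : exists x, f x = y.
  by exists (passmx.vecof (vbasis fullv) y); rewrite fE passmx.vecofK.
have [ops _ iso] := transport_exists fi fs.
have vY : grV (OMod ops).
  by case: (oiso_sym iso) => g hg [gi _]; apply: (var_sub gV hg gi vX).
have cY := CM_iso vX iso cX.
exists (CMCoord (CMOn (@cm_of_proof _ vY cY))).
apply: oiso_trans (oiso_sym iso).
exact: gmod_ofK vY.
Qed.

(** The value is 0 when [X] has no Cohen-Macaulay model on some k^n. Otherwise the model chosen is
    irrelevant by [cls_coord], isomorphisms being relators. *)
Definition cls X : K0 gr :=
  if pselect (exists c : cm_coord gr, oiso (gom c) X) is left h
  then kpi (gen (projT1 (cid h))) else 0.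

Lemma stable_eq_refl (X Y : cm_module gr) (f g : 'Hom(X, Y)) : f = g -> stable_eq f g.
Proof.
move=> ->; have v0 := var_zero gV.
have p0 : oproj grV (ozero k (A + int)) by apply: oproj_zero gV.
exists (cm_of v0 (CM_proj p0)), 0, 0; split.
- by apply/gr_projective_oproj; apply: (oproj_retract gV _ p0); apply/oiso_retract/gmod_ofK.
- by apply/gr_hom_ohom; apply: ohom0.
- by apply/gr_hom_ohom; apply: ohom0.
by rewrite subrr comp_lfun0l.
Qed.

Lemma iso_stable (X Y : cm_module gr) (f : 'Hom(X, Y)) :
  ohom (f : 'Hom(gom X, gom Y)) -> injective f -> (forall y, exists x, f x = y) ->
  stable_isom f.
Proof.
move=> hf fi fs; have [g [hg gf fg]] := oiso_inv hf fi fs.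
split; first exact/gr_hom_ohom.
exists g; split; first exact/gr_hom_ohom.
  by apply: stable_eq_refl; apply/lfunP => x; rewrite comp_lfunE id_lfunE gf.
by apply: stable_eq_refl; apply/lfunP => x; rewrite comp_lfunE id_lfunE fg.
Qed.

Lemma cls_coord (c : cm_coord gr) X : oiso (gom c) X -> cls X = kpi (gen c).
Proof.
move=> iso; rewrite /cls; case: pselect => [h | []]; last by exists c.
case: (cid h) => c' iso' /=.
have [f hf [fi fs]] := oiso_trans iso' (oiso_sym iso).
have := kpi_relator (K0_isom (iso_stable hf fi fs)).
by rewrite kpiD kpiN => /eqP; rewrite subr_eq0 => /eqP.
Qed.


(* A short exact sequence X -> Y -> Z of Cohen-Macaulay modules with X -> I a  *)
(* suspension is a standard triangle up to isomorphism: X -> I extends to Y,   *)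
(* so the pushout of Y and I over X is the direct sum of Z and I.              *)
Section Triangle.
Variables (X Y Z I S : cm_module gr).
Variables (i : 'Hom(gom X, gom Y)) (p : 'Hom(gom Y, gom Z)).
Variables (u : 'Hom(gom X, gom I)) (q : 'Hom(gom I, gom S)).
Hypotheses (e : ses i p) (e' : ses u q) (pI : gr_projective I).

Fact triangle_conflation : conflation (u : 'Hom(X, I)) (q : 'Hom(I, S)).
Proof.
split.
- exact/gr_hom_ohom/(ses_hi e').
- exact/gr_hom_ohom/(ses_hp e').
- exact/lker_eq0P/(ses_inj e').
- apply/vspaceP => y; rewrite memv_ker; apply/memv_imgP/eqP => [[x _ ->] | ].
    exact: (ses_pi e').
  by case/(ses_ex e') => x ->; exists x; rewrite ?memvf.
exact/limg_fullP/(ses_surj e').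
Qed.

Definition triangle_susp : suspension X := Suspension pI triangle_conflation.

Let vC : grV (osum (gom I) (gom Z)).
Proof. by apply: (var_sum gV); apply: gom_grV. Qed.

Let cC : gCM (osum (gom I) (gom Z)).
Proof. exact: CM_ses vC (osum_ses _ _) (gom_CM I) (gom_CM Z). Qed.

Let C := cm_of vC cC.

Lemma triangle_exact : exists w : 'Hom(Z, susp triangle_susp),
  exact_triangle (i : 'Hom(X, Y)) (p : 'Hom(Y, Z)) w.
Proof.
have pI' : oproj grV (gom I) by apply/gr_projective_oproj.
have [h hh hi] := CM_extends (gom_grV Y) e (gom_CM Z) pI' (ses_hi e').
have [|g hg gp] := factor_epi (ses_hp e) (ses_surj e) (ohom_comp (ses_hp e') hh).
  by move=> x /(ses_ex e)[y ->]; rewrite comp_lfunE hi (ses_pi e').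
have hng : ohom (- g) by apply: ohomN.
pose v : 'Hom(Y, C) := opair h p.
(* The sign makes [w \o v] vanish, because [q \o h = g \o p]. *)
pose w : 'Hom(C, S) := ocopair q (- g).
pose j : 'Hom(I, C) := oinl (gom I) (gom Z).
pose c : 'Hom(C, Z) := osnd (gom I) (gom Z).
pose r : 'Hom(Z, C) := oinr (gom I) (gom Z).
have grv : gr_hom v.
  by apply/gr_hom_ohom/ohom_gmodr; apply: opair_hom => //; exact: ses_hp e.
have grw : gr_hom w.
  by apply/gr_hom_ohom/ohom_gmodl; apply: ocopair_hom => //; exact: ses_hp e'.
have grj : gr_hom j by apply/gr_hom_ohom/ohom_gmodr; apply: oinl_hom.
have grc : gr_hom c by apply/gr_hom_ohom/ohom_gmodl; apply: osnd_hom.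
have grr : gr_hom r by apply/gr_hom_ohom/ohom_gmodr; apply: oinr_hom.
have vE y : v y = (h y, p y) by exact: (@opairE _ _ (gom I) (gom Z) (gom Y) h p y).
have jE x : j x = (x, 0) by exact: (@oinlE _ _ (gom I) (gom Z) x).
have wE x : w x = q x.1 - g x.2
  by have E := @ocopairE _ _ (gom I) (gom Z) (gom S) q (- g) x; rewrite opp_lfunE in E; exact: E.
have cE x : c x = x.2 by exact: (@osndE _ _ (gom I) (gom Z) x).
have rE x : r x = (0, x) by exact: (@oinrE _ _ (gom I) (gom Z) x).
have id_gr (M : cm_module gr) : gr_hom (\1%VF : 'Hom(M, M)).
  by apply/gr_hom_ohom; apply: ohom_id.
have id_st (M : cm_module gr) : stable_isom (\1%VF : 'Hom(M, M)).
  split=> //; exists \1%VF; split=> //; apply: stable_eq_refl; exact: comp_lfun1l.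
exists (- g : 'Hom(Z, S)); split.
- exact/gr_hom_ohom/(ses_hi e).
- exact/gr_hom_ohom/(ses_hp e).
- exact/gr_hom_ohom.
exists X, Y, C, triangle_susp, i, v, w, \1%VF, \1%VF, c, \1%VF; split.
- split=> //; first exact/gr_hom_ohom/(ses_hi e).
  exists j; split; last 2 first.
  + by apply/lfunP => y; rewrite comp_lfunE wE vE /= gp comp_lfunE subrr zero_lfunE.
  + by apply/lfunP => x; rewrite comp_lfunE wE jE /= linear0 subr0.
  split=> //.
    by apply/lfunP => x; rewrite !comp_lfunE vE jE hi (ses_pi e).
  move=> T a b /gr_hom_ohom ha /gr_hom_ohom hb ab.
  (* The map out of the pushout is [b] on [I]; on [Z] it is induced by [a - b \o h], which vanishes
     on [X]. *)
  have [|d hd dp] := factor_epi (ses_hp e) (ses_surj e)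
      (ohomB ha (ohom_comp hb hh)).
    move=> y /(ses_ex e)[x ->]; rewrite add_lfunE opp_lfunE comp_lfunE hi.
    by rewrite -!comp_lfunE ab subrr.
  pose bd : 'Hom(C, T) := @ocopair _ _ (gom I) (gom Z) (gom T) b d.
  have bdE x : bd x = b x.1 + d x.2.
    by exact: (@ocopairE _ _ (gom I) (gom Z) (gom T) b d x).
  exists bd; split.
    split.
    - by apply/gr_hom_ohom/ohom_gmodl; apply: ocopair_hom.
    - apply/lfunP => y; rewrite comp_lfunE vE bdE /= dp.
      by rewrite add_lfunE opp_lfunE comp_lfunE addrC subrK.
    by apply/lfunP => x; rewrite comp_lfunE jE bdE /= linear0 addr0.
  move=> d' [_ d'v d'j]; apply/lfunP => -[x z].
  have [y yz] := ses_surj e z.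
  have -> : ((x, z) : C) = j (x - h y) + v y.
    by rewrite jE vE; apply: injective_projections; rewrite /= ?subrK ?add0r ?yz.
  have d'vE t : d' (v t) = a t by rewrite -d'v comp_lfunE.
  have d'jE t : d' (j t) = b t by rewrite -d'j comp_lfunE.
  move: (x - h y) => t; rewrite !linearD /= d'vE d'jE !bdE jE vE /= linear0 addr0 dp.
  by congr (_ + _); rewrite add_lfunE opp_lfunE comp_lfunE addrC subrK.
- split=> //; split=> //; exists r; split=> //.
    2: by apply: stable_eq_refl; apply/lfunP => z; rewrite comp_lfunE rE cE id_lfunE.
  (* [r \o c] differs from the identity of the direct sum by the projection onto [I], so it is
     stably the identity. *)
  exists I, (ofst (gom I) (gom Z) : 'Hom(C, I)), (- j); split=> //.
  + by apply/gr_hom_ohom/ohom_gmodl; apply: ofst_hom.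
  + by apply/gr_hom_ohom; apply: ohomN; apply/gr_hom_ohom.
  apply/lfunP => x; rewrite add_lfunE opp_lfunE id_lfunE !comp_lfunE cE rE.
  rewrite opp_lfunE jE [ofst _ _ _]ofstE.
  by case: x => x z; apply: injective_projections; rewrite /= ?subrr ?sub0r ?oppr0.
- split=> //; exists \1%VF; split=> //.
    by rewrite comp_lfun1l comp_lfun1r.
  by rewrite comp_lfun1l comp_lfun1r.
split.
- by apply: stable_eq_refl; rewrite comp_lfun1l comp_lfun1r.
- by apply: stable_eq_refl; apply/lfunP => y; rewrite !comp_lfunE id_lfunE cE vE.
exists I, (ofst (gom I) (gom Z) : 'Hom(C, I)), (- q : 'Hom(I, S)); split=> //.
- by apply/gr_hom_ohom/ohom_gmodl; apply: ofst_hom.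
- by apply/gr_hom_ohom; apply: ohomN; exact: ses_hp e'.
apply/lfunP => x; rewrite add_lfunE [(- ((_ \o _)%VF : 'Hom(C, S))) x]opp_lfunE.
rewrite !comp_lfunE id_lfunE wE cE !opp_lfunE [ofst _ _ _]ofstE.
by rewrite opprB addKr.
Qed.

End Triangle.

Lemma kpi_conflation (X Y Z : cm_coord gr) (I S : cm_module gr)
    (i : 'Hom(gom X, gom Y)) (p : 'Hom(gom Y, gom Z))
    (u : 'Hom(gom X, gom I)) (q : 'Hom(gom I, gom S)) :
  ses i p -> ses u q -> gr_projective I ->
  kpi (gen Y) = kpi (gen X) + kpi (gen Z).
Proof.
move=> e e' pI; have [w ex] := triangle_exact e e' pI.
have := kpi_relator (K0_triangle ex); rewrite !kpiD kpiN => /eqP.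
by rewrite addrAC subr_eq0 => /eqP ->.
Qed.

(** A projective is stably isomorphic to the zero module, whose class vanishes by the sequence 0 ->
    0 -> 0. *)
Lemma kpi_proj (c : cm_coord gr) : gr_projective c -> kpi (gen c) = 0.
Proof.
move=> pc; have v0 := var_zero gV.
have c0 : gCM (ozero k (A + int)) := CM_proj (oproj_zero gV).
have [z [f hf [fi fs]]] := cm_coord_exists v0 c0.
have z0 (x : z) : x = 0.
  by apply: fi; rewrite [LHS]ozero_eq0 [RHS]ozero_eq0.
have st : stable_isom (0 : 'Hom(z, c)).
  have h0 (X Y : cm_module gr) : gr_hom (0 : 'Hom(X, Y)).
    by apply/gr_hom_ohom; apply: ohom0.
  split=> //; exists 0; split=> //.
    by apply: stable_eq_refl; apply/lfunP => x; rewrite [LHS]z0 [RHS]z0.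
  exists c, \1%VF, (- \1%VF); split=> //.
  - by apply/gr_hom_ohom; apply: ohom_id.
  - by apply/gr_hom_ohom; apply: ohomN; apply: ohom_id.
  by rewrite comp_lfun0l sub0r comp_lfun1r.
have z00 : kpi (gen z) = 0.
  have id_z : oiso (gom z) (gom z) := oiso_refl _.
  have e : ses (\1%VF : 'Hom(gom z, gom z)) (0 : 'Hom(gom z, gom z)).
    split; try by move=> x; rewrite [LHS]z0 [RHS]z0.
    - exact: ohom_id.
    - exact: ohom0.
    - by move=> x y _; rewrite (z0 x) (z0 y).
    - by move=> x; exists 0; rewrite [LHS]z0 [RHS]z0.
    by move=> y _; exists 0; rewrite [LHS]z0 [RHS]z0.
  have pz : gr_projective z.
    apply/gr_projective_oproj/(oproj_eq0 gV); apply/eqP.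
    rewrite /odim -dimvf dimv_eq0 -subv0.
    by apply/subvP => x _; rewrite (z0 x) mem0v.
  by apply: (addrI (kpi (gen z))); rewrite addr0 -(kpi_conflation e e pz).
have := kpi_relator (K0_isom st).
by rewrite kpiD kpiN z00 sub0r => /eqP; rewrite oppr_eq0 => /eqP.
Qed.

Lemma ses_transport X Y Z X' Y' Z' (i : 'Hom(X, Y)) (p : 'Hom(Y, Z)) :
  ses i p -> oiso X' X -> oiso Y' Y -> oiso Z' Z ->
  exists (i' : 'Hom(X', Y')) (p' : 'Hom(Y', Z')), ses i' p'.
Proof.
move=> e [f hf [fi fs]] [g hg [gi gs]] [h hh [hi hs]].
have [g' [hg' gg' g'g]] := oiso_inv hg gi gs.
have [h' [hh' hh'K h'h]] := oiso_inv hh hi hs.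
exists (g' \o i \o f)%VF, (h' \o p \o g)%VF; split.
- by do 2![apply: ohom_comp => //]; exact: ses_hi e.
- by do 2![apply: ohom_comp => //]; exact: ses_hp e.
- by move=> x y; rewrite !comp_lfunE => /(can_inj g'g)/(ses_inj e)/fi.
- move=> z; case: (ses_surj e (h z)) => y yE; exists (g' y).
  by rewrite !comp_lfunE g'g yE hh'K.
- by move=> x; rewrite !comp_lfunE g'g (ses_pi e) linear0.
move=> y; rewrite !comp_lfunE => py.
have : p (g y) = 0 by rewrite -(h'h (p (g y))) py linear0.
case/(ses_ex e) => x xE; case: (fs x) => w wE; exists w.
by rewrite !comp_lfunE wE -xE gg'.
Qed.

(** A triangle relation mentions a suspension of its first vertex, so an embedding of [X] into a
    projective with Cohen-Macaulay cokernel is part of the data. *)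
Lemma cls_conflation X Y Z I S (i : 'Hom(X, Y)) (p : 'Hom(Y, Z))
    (u : 'Hom(X, I)) (q : 'Hom(I, S)) :
  grV Y -> gCM X -> gCM Z -> ses i p -> oproj grV I -> gCM S -> ses u q ->
  cls Y = cls X + cls Z.
Proof.
move=> vY cX cZ e pI cS e'.
have vI := pI.1; have cI := CM_proj pI.
have [x xX] := cm_coord_exists (ses_varl gV e vY) cX.
have [y yY] := cm_coord_exists vY (CM_ses vY e cX cZ).
have [z zZ] := cm_coord_exists (ses_varr gV e vY) cZ.
have vS := ses_varr gV e' vI.
have [i1 [p1 e1]] := ses_transport e xX yY zZ.
have iI : oiso (gom (cm_of vI cI)) I := gmod_ofK vI.
have iS : oiso (gom (cm_of vS cS)) S := gmod_ofK vS.
have [u1 [q1 e1']] := ses_transport e' xX iI iS.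
rewrite (cls_coord xX) (cls_coord yY) (cls_coord zZ).
apply: (kpi_conflation e1 e1').
by apply/gr_projective_oproj; apply: (oproj_retract gV (oiso_retract iI)).
Qed.

Lemma cls_proj P : oproj grV P -> cls P = 0.
Proof.
move=> pP; have [c iP] := cm_coord_exists pP.1 (CM_proj pP).
rewrite (cls_coord iP) kpi_proj //.
by apply/gr_projective_oproj; apply: (oproj_retract gV (oiso_retract iP)).
Qed.

(** The sequence K -> P -> X serves both as the conflation and as the suspension of [K]. *)
Lemma cls_syz K P X (i : 'Hom(K, P)) (p : 'Hom(P, X)) :
  syz grV i p -> gCM X -> cls K = - cls X.
Proof.
move=> s cX; have := cls_conflation s.1.1 (CM_syz s cX) cX s.2 s.1 cX s.2.
by rewrite cls_proj; [move/eqP; rewrite eq_sym addr_eq0 => /eqP | case: s].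
Qed.

(** No suspension of the first term is at hand, but a syzygy has one by construction. Additivity is
    therefore proved for the syzygies given by the horseshoe lemma and carried back by [cls_syz]. *)
Lemma cls_additive : stably_additive grV gCM cls.
Proof.
split.
- by move=> P pP; split; [exact: (CM_proj pP) | apply: cls_proj].
- move=> X Y Z i p vY e cX cZ; split; first exact: (CM_ses vY e cX cZ).
  have cY := CM_ses vY e cX cZ.
  have [K' [P' [i' [p' s']]]] := enough_proj gV gC (ses_varl gV e vY).
  have [K'' [P'' [i'' [p'' s'']]]] := enough_proj gV gC (ses_varr gV e vY).
  have [K [j [q [a [b [s eab]]]]]] := horseshoe gV vY e s' s''.
  have vK : grV K by case: (syz_var gV s).
  have := cls_conflation vK (CM_syz s' cX) (CM_syz s'' cZ) eab s'.1 cX s'.2.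
  by rewrite (cls_syz s cY) (cls_syz s' cX) (cls_syz s'' cZ) -opprD => /oppr_inj.
move=> X Y P i p vY e pP cY.
exact: (CM_retract vY (ses_retract_proj e vY pP) cY).
Qed.

End K0Classes.

(** * Extension of the class to all modules, and maps out of K_0 *)

Section Comparison.
Variables (k : fieldType) (A : falgType k) (l : nat) (gr : grading A l).
Notation gomod := (omod k (A + int)%type).
Notation grV := (grV gr).
Notation gCM := (@gCM k A).
Implicit Types X Y Z K M N P I S : gomod.

Let gV := grV_variety gr.
Let gC := grV_covering gr.

(** [psi] is the class of the D-th syzygy with sign (-1)^D, where [D] comes from [CM_omega] and
    works for all modules at once. On Cohen-Macaulay modules each syzygy flips the sign, so the two
    signs cancel. *)
Lemma psi_exists : finite_gr_injdim (gr_regular gr) ->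
  exists psi : gomod -> K0 gr, stably_additive grV (fun=> True) psi /\
    forall X, grV X -> gCM X -> psi X = cls gr X.
Proof.
case/CM_omega => D OmCM; have [Om OmP] := syz_functor_exists gV gC.
have sa := stably_additive_iter gV OmP D (cls_additive gr).
exists (fun M => cls gr (iter D Om M) *~ (-1) ^+ D); split.
  split=> //; first by move=> P /(sa_proj sa)[].
  move=> M' M M'' i p vM e _ _; split=> //.
  have := sa_ext sa vM e (OmCM _ OmP _ _ (leqnn D) (ses_varl gV e vM))
    (OmCM _ OmP _ _ (leqnn D) (ses_varr gV e vM)).
  by case.
move=> X vX cX.
suff [_ _ ->] : [/\ grV (iter D Om X), gCM (iter D Om X)
    & cls gr (iter D Om X) = cls gr X *~ (-1) ^+ D].
  by rewrite -mulrzA -exprMn mulrNN mulr1 expr1n.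
elim: D {OmCM sa} => [|D [v c E]] //=.
have [P [i [p s]]] := OmP _ v; split.
- by case: (syz_var gV s).
- exact: CM_syz s c.
by rewrite (cls_syz s c) E exprS mulN1r mulrNz.
Qed.

Variables (G : lmodType int) (f : gomod -> G) (H : {pred G}).
Hypothesis fD : forall X Y Z (i : 'Hom(X, Y)) (p : 'Hom(Y, Z)),
  grV Y -> ses i p -> f Y = f X + f Z.
Hypothesis cH : zmod_closed H.
Hypothesis fH : forall P, oproj grV P -> f P \in H.

Lemma additive_iso X Y : grV X -> oiso X Y -> f X = f Y.
Proof.
move=> vX [h hh [hi hs]].
have vY := var_quot gV hh hs vX.
have f0 : f (ozero k (A + int)) = 0.
  apply: (addrI (f (ozero k (A + int)))); rewrite addr0.
  rewrite -(fD (i := \1%VF) (p := 0) (var_zero gV)) //; split.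
  - exact: ohom_id.
  - exact: ohom0.
  - by move=> x y; rewrite !id_lfunE.
  - by move=> y; exists 0; rewrite [LHS]ozero_eq0 [RHS]ozero_eq0.
  - by move=> x; rewrite [LHS]ozero_eq0 [RHS]ozero_eq0.
  - by move=> y _; exists y; rewrite id_lfunE.
rewrite -[LHS]addr0 -f0; apply/esym/(fD (i := h) (p := 0)) => //; split=> //.
- exact: ohom0.
- by move=> y; exists 0; rewrite [LHS]ozero_eq0 [RHS]ozero_eq0.
- by move=> x; rewrite zero_lfunE.
by move=> y _; case: (hs y) => x <-; exists x.
Qed.

Lemma additive_sum X Y : grV X -> grV Y -> f (osum X Y) = f X + f Y.
Proof. by move=> vX vY; apply: fD (osum_ses X Y); apply: (var_sum gV). Qed.

Let HB x y : x \in H -> y \in H -> x - y \in H.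
Proof. by case: cH => _; apply. Qed.
Let HN x : x \in H -> - x \in H.
Proof. by move=> Hx; rewrite -sub0r HB //; case: cH. Qed.
Let HD x y : x \in H -> y \in H -> x + y \in H.
Proof. by move=> Hx Hy; rewrite -[y]opprK HB // HN. Qed.

(** The map (h, a) embeds [X] in [Y + P], split by (g, -b). Its complement [Q] is projective, so the
    difference of the values at [X] and [Y] is [f P - f Q]. *)
Lemma additive_stable X Y P P' (h : 'Hom(X, Y)) (g : 'Hom(Y, X)) (a : 'Hom(X, P))
    (b : 'Hom(P, X)) (a' : 'Hom(Y, P')) (b' : 'Hom(P', Y)) :
  grV Y -> oproj grV P -> oproj grV P' -> ohom h -> ohom g -> ohom a ->
  ohom b -> ohom a' -> ohom b' -> (forall x, g (h x) = x + b (a x)) ->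
  (forall y, h (g y) = y + b' (a' y)) -> f X - f Y \in H.
Proof.
move=> vY pP pP' hh hg ha hb ha' hb' ghE hgE.
have vYP : grV (osum Y P) by apply: (var_sum gV vY pP.1).
pose s := opair h a; pose t := ocopair g (- b).
have sE x : s x = (h x, a x) by apply: opairE.
have tE x : t x = g x.1 - b x.2 by rewrite /t ocopairE opp_lfunE.
have hs : ohom s by apply: opair_hom.
have ht : ohom t by apply: ocopair_hom => //; apply: ohomN.
have ts x : t (s x) = x by rewrite tE sE /= ghE addrK.
clearbody s t.
have [Q [q e]] := coker_exists hs (can_inj ts).
have [|r hr rq] := factor_epi (ses_hp e) (ses_surj e)
    (ohomB (@ohom_id _ _ (osum Y P)) (ohom_comp hs ht)).
  move=> x /(ses_ex e)[y ->].
  by rewrite add_lfunE opp_lfunE id_lfunE comp_lfunE ts subrr.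
have rqE x : r (q x) = x - s (t x).
  by rewrite rq add_lfunE opp_lfunE id_lfunE comp_lfunE.
have pQ : oproj grV Q.
  have pPP : oproj grV (osum P' (osum P P)) by do 2!apply: (oproj_sum gV) => //.
  apply: (oproj_retract gV _ pPP).
  (* [al] and [be] factor the idempotent [1 - s t], whose image is [Q], through a projective. *)
  pose al := opair (a' \o ofst Y P)%VF (opair (a \o g \o ofst Y P)%VF (osnd Y P)).
  have hal : ohom al.
    apply: opair_hom; first by apply: ohom_comp => //; apply: ofst_hom.
    apply: opair_hom; last exact: osnd_hom.
    by apply: ohom_comp (@ofst_hom _ _ Y P); apply: ohom_comp.
  pose be := ocopair (oinl Y P \o (- b'))%VF
     (ocopair (oinr Y P \o (- \1%VF))%VF (opair (h \o b)%VF (\1%VF + (a \o b)%VF))).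
  have hbe : ohom be.
    apply: ocopair_hom.
      by apply: ohom_comp; [apply: oinl_hom | apply: ohomN].
    apply: ocopair_hom.
      by apply: ohom_comp; [apply: oinr_hom | apply: ohomN; apply: ohom_id].
    apply: opair_hom; first exact: ohom_comp.
    by apply: ohomD; [apply: ohom_id | apply: ohom_comp].
  exists (al \o r)%VF, (q \o be)%VF; split.
  - exact: ohom_comp.
  - exact: ohom_comp (ses_hp e) hbe.
  have beal y : be (al y) = y - s (t y).
    have -> : al y = (a' y.1, (a (g y.1), y.2)).
      by rewrite /al opairE opairE !comp_lfunE ofstE osndE.
    rewrite /be !ocopairE /= !comp_lfunE oinlE oinrE opairE /=.
    rewrite add_lfunE !opp_lfunE id_lfunE !comp_lfunE id_lfunE tE sE.
    case: y => y x /=; apply: injective_projections => /=.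
      by rewrite add0r linearB /= hgE !opprD opprK !addrA subrr add0r.
    by rewrite add0r linearB /= opprB addrC -addrA.
  move=> z; case: (ses_surj e z) => x <-.
  rewrite !comp_lfunE beal rqE linearB /= (ses_pi e) subr0.
  by rewrite linearB /= (ses_pi e) subr0.
have := fD vYP e; rewrite additive_sum // => [E|]; last exact: pP.1.
have -> : f X - f Y = f P - f Q.
  by apply/eqP; rewrite subr_eq addrAC eq_sym subr_eq addrC E.
by apply: HB; apply: fH.
Qed.

Lemma additive_stable_isom (X Y : cm_module gr) (h : 'Hom(X, Y)) :
  stable_isom h -> f (gom X) - f (gom Y) \in H.
Proof.
case=> hh [g [hg [P [a [b [pP ha hb gh]]]] [P' [a' [b' [pP' ha' hb' hg']]]]]].
apply: (@additive_stable (gom X) (gom Y) (gom P) (gom P') h g a b a' b').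
- exact: gom_grV.
- exact/gr_projective_oproj.
- exact/gr_projective_oproj.
- exact/gr_hom_ohom.
- exact/gr_hom_ohom.
- exact/gr_hom_ohom.
- exact/gr_hom_ohom.
- exact/gr_hom_ohom.
- exact/gr_hom_ohom.
- move=> x; move/lfunP/(_ x): gh.
  by rewrite add_lfunE opp_lfunE id_lfunE !comp_lfunE => <-; rewrite addrC subrK.
move=> x; move/lfunP/(_ x): hg'.
by rewrite add_lfunE opp_lfunE id_lfunE !comp_lfunE => <-; rewrite addrC subrK.
Qed.

(** The pushout [C] is characterised only among Cohen-Macaulay modules. The quotient [C0] of [Y + I]
    by [X] is an extension of the suspension by [Y], hence Cohen-Macaulay, hence isomorphic to [C];
    the alternating sum is then the value at the projective [I]. *)
Lemma additive_standard (X Y C : cm_module gr) (s : suspension X)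
    (u : 'Hom(X, Y)) (v : 'Hom(Y, C)) (w : 'Hom(C, susp s)) :
  standard_triangle u v w -> f (gom X) - f (gom Y) + f (gom C) \in H.
Proof.
case=> /gr_hom_ohom hu _ [j [[/gr_hom_ohom hv /gr_hom_ohom hj vu univ] _ _]].
case: s w j hj vu univ => I S i q pI [/gr_hom_ohom hi /gr_hom_ohom hq i0 iq qf] /= w j hj vu univ.
have {}vu x : v (u x) = j (i x) by rewrite -!comp_lfunE vu.
have ii : injective i by apply/lker_eq0P.
have qs : forall y, exists x, q x = y by apply/limg_fullP.
have q0 x : q x = 0 <-> exists y, x = i y.
  have := memv_ker q x; rewrite -iq => E; split=> [ex | [y xE]].
    have /memv_imgP[y _ ->] : x \in limg i by rewrite E ex.
    by exists y.
  by apply/eqP; rewrite -E xE memv_img ?memvf.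
pose YI := osum (gom Y) (gom I).
have vYI : grV YI by apply: (var_sum gV); apply: gom_grV.
pose m := @opair _ _ (gom Y) (gom I) (gom X) u (- i).
have mE x : m x = (u x, - i x).
  by have E := @opairE _ _ (gom Y) (gom I) (gom X) u (- i) x; rewrite opp_lfunE in E.
have hm : ohom m by apply: opair_hom => //; apply: ohomN.
have mi : injective m by move=> x y; rewrite !mE => -[_ /oppr_inj/ii].
have [C0 [r e]] := coker_exists hm mi.
have vC0 : grV C0 by apply: (ses_varr gV e).
pose a := (r \o oinl (gom Y) (gom I))%VF; pose b := (r \o oinr (gom Y) (gom I))%VF.
have aE y : a y = r (y, 0) by rewrite comp_lfunE oinlE.
have bE x : b x = r (0, x) by rewrite comp_lfunE oinrE.
have rE x : r x = a x.1 + b x.2.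
  rewrite aE bE -linearD; congr (r _).
  by apply: injective_projections; rewrite /= ?addr0 ?add0r.
have ha : ohom a by apply: ohom_comp (ses_hp e) (@oinl_hom _ _ _ _).
have hb : ohom b by apply: ohom_comp (ses_hp e) (@oinr_hom _ _ _ _).
have aub x : a (u x) = b (i x).
  apply/eqP; rewrite -subr_eq0 -linearN; apply/eqP.
  by have := ses_pi e x; rewrite rE mE.
have hqq : ohom ((q : 'Hom(gom I, gom S)) \o osnd (gom Y) (gom I))%VF.
  by apply: ohom_comp (@osnd_hom _ _ _ _).
have [|t ht tr] := factor_epi (ses_hp e) (ses_surj e) hqq.
  move=> x /(ses_ex e)[y ->]; rewrite comp_lfunE osndE mE /= linearN.
  by apply/eqP; rewrite oppr_eq0; apply/eqP/q0; exists y.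
have trE x : t (r x) = q x.2 by rewrite tr comp_lfunE osndE.
have eC : ses a t.
  split=> //.
  - move=> y y'; rewrite !aE => /eqP; rewrite -subr_eq0 -linearB => /eqP/(ses_ex e)[x].
    rewrite mE => -[yE /eqP]; rewrite subrr eq_sym oppr_eq0 => /eqP ix.
    have x0 : x = 0 by apply: ii; rewrite ix linear0.
    by apply/eqP; rewrite -subr_eq0 yE x0 linear0.
  - by move=> z; case: (qs z) => x <-; exists (r (0, x)); rewrite trE.
  - by move=> y; rewrite aE trE linear0.
  move=> z; case: (ses_surj e z) => -[y x] <-; rewrite trE /= => /q0[x' xE].
  by exists (y + u x'); rewrite linearD /= aub -xE rE.
have cC0 : gCM C0 := CM_ses vC0 eC (gom_CM Y) (gom_CM S).
have hd : ohom (@ocopair _ _ (gom Y) (gom I) (gom C) v j) by apply: ocopair_hom.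
have dE x : @ocopair _ _ (gom Y) (gom I) (gom C) v j x = v x.1 + j x.2.
  exact: (@ocopairE _ _ (gom Y) (gom I) (gom C)).
have [|d hd' dr] := factor_epi (ses_hp e) (ses_surj e) hd.
  by move=> x /(ses_ex e)[y ->]; rewrite dE mE /= linearN /= vu subrr.
have drE x : d (r x) = v x.1 + j x.2 by rewrite dr dE.
have [|||c [[hc cv cj] _]] := univ (cm_of vC0 cC0) a b.
- exact/gr_hom_ohom/ohom_gmodr.
- exact/gr_hom_ohom/ohom_gmodr.
- by apply/lfunP => x; rewrite !comp_lfunE -!(comp_lfunE r) aub.
have {}cv y : c (v y) = a y by rewrite -cv comp_lfunE.
have {}cj x : c (j x) = b x by rewrite -cj comp_lfunE.
have hc' : ohom (c : 'Hom(gom C, C0)) by apply/(ohom_gmodr vC0)/gr_hom_ohom.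
have cd z : c (d z) = z.
  by case: (ses_surj e z) => x <-; rewrite drE linearD /= cv cj rE.
have dc z : d (c z) = z.
  (* [d \o c] and the identity both solve the universal problem of [C] for the pair [v], [j]. *)
  have [|||id [_ idU]] := univ C v j.
  - exact/gr_hom_ohom.
  - exact/gr_hom_ohom.
  - by apply/lfunP => x; rewrite !comp_lfunE vu.
  have E1 : id = \1%VF.
    apply: idU; split; first by apply/gr_hom_ohom; apply: ohom_id.
      exact: comp_lfun1l.
    exact: comp_lfun1l.
  pose dc : 'Hom(gom C, gom C) := (d \o (c : 'Hom(gom C, C0)))%VF.
  have E2 : id = dc.
    apply: idU; split; first exact/gr_hom_ohom/(ohom_comp hd' hc').
      by apply/lfunP => y; rewrite comp_lfunE [LHS]comp_lfunE cv aE drE /= linear0 addr0.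
    by apply/lfunP => x; rewrite comp_lfunE [LHS]comp_lfunE cj bE drE /= linear0 add0r.
  have : dc z = z by rewrite -E2 E1 id_lfunE.
  by rewrite comp_lfunE.
have iCC : oiso C0 (gom C).
  exists d => //; split; first exact: can_inj cd.
  by move=> y; exists (c y).
rewrite -(additive_iso vC0 iCC).
have := fD vYI e; rewrite (additive_sum (gom_grV Y) (gom_grV I)) => E.
have -> : f (gom X) - f (gom Y) + f C0 = f (gom I).
  by apply: (addrI (f (gom Y))); rewrite E addrA [f (gom Y) + _]addrC subrK.
by apply: fH; apply/gr_projective_oproj.
Qed.

Lemma additive_exact (X Y Z : cm_module gr) (s : suspension X)
    (u : 'Hom(X, Y)) (v : 'Hom(Y, Z)) (w : 'Hom(Z, susp s)) :
  exact_triangle u v w -> f (gom X) - f (gom Y) + f (gom Z) \in H.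
Proof.
case=> _ _ _ [X' [Y' [Z' [s' [u' [v' [w' [a [b [c [t]]]]]]]]]]].
case=> /additive_standard st [sa sb sc] _ _.
have HX := additive_stable_isom sa; have HY := additive_stable_isom sb.
have HZ := additive_stable_isom sc.
have -> : f (gom X) - f (gom Y) + f (gom Z) =
    (f (gom X') - f (gom Y') + f (gom Z')) - ((f (gom X') - f (gom X))
      - (f (gom Y') - f (gom Y)) + (f (gom Z') - f (gom Z))).
  move: (f (gom X)) (f (gom Y)) (f (gom Z)) (f (gom X')) (f (gom Y')) (f (gom Z')).
  move=> x y z x' y' z'.
  have -> : x' - x - (y' - y) + (z' - z) = x' - y' + z' - (x - y + z).
    rewrite [in RHS]opprD [RHS]addrACA; congr (_ + _).
    by rewrite !opprD addrACA.
  by rewrite subKr.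
by apply: HB => //; apply: HD => //; apply: HB.
Qed.

Definition K0_lift : free_K0 gr -> G := fglift (fun c : cm_coord gr => f (gom c)).

Lemma K0_lift_gen c : K0_lift (gen c) = f (gom c).
Proof. by rewrite /K0_lift /gen liftU scale1r. Qed.

Lemma K0_liftB : {morph K0_lift : x y / x - y}.
Proof. exact: lift_is_additive. Qed.

(** The preimage of [H] is a subgroup containing the relators. So [f] induces a map from K_0 to [G]
    modulo [H], expressed without forming that quotient. *)
Lemma K0_lift_relations x : kpi x = 0 -> K0_lift x \in H.
Proof.
move=> /kpi_eq0/asboolP/(_ (fun y => K0_lift y \in H)); apply.
  split; first by rewrite -[0](subrr 0) unfold_in K0_liftB subrr; case: cH.
  by move=> y z; rewrite !unfold_in K0_liftB => Hy Hz; apply: HB.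
move=> y [X Y h st | X Y Z s u v w ex]; rewrite unfold_in.
  by rewrite K0_liftB !K0_lift_gen; apply: additive_stable_isom st.
have -> : gen X - gen Y + gen Z = gen X - (gen Y - gen Z) by rewrite opprB addrA addrAC.
rewrite !K0_liftB !K0_lift_gen opprB addrA addrAC.
exact: additive_exact ex.
Qed.

End Comparison.

(** * Simple modules and multiplicities *)

Section Fitting.
Variables (k : fieldType) (B : falgType k).

Lemma annihilating_poly (a : B) : exists2 p : {poly k}, p != 0 & horner_alg a p = 0.
Proof.
pose f (c : 'rV[k]_(dim B).+1) : B := horner_alg a (rVpoly c).
have lf : linear f.
  by move=> c x y; rewrite /f linearP /= linearP /= mulr_algl.
have [/lker0P inj | ] := boolP (lker (lfun_of lf) == 0%VS).
  have := limg_dim_eq (f := lfun_of lf) (U := fullv).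
  have /eqP -> : lker (lfun_of lf) == 0%VS by apply/lker0P.
  rewrite capv0 => /(_ erefl) E; have := dimvS (subvf (limg (lfun_of lf))).
  by rewrite E !dimvf dim_matrix mul1r ltnn.
rewrite -vpick0 => nz; exists (rVpoly (vpick (lker (lfun_of lf)))).
  by apply: contra nz => /eqP E; rewrite -(rVpolyK (vpick _)) E linear0.
have := memv_pick (lker (lfun_of lf)); rewrite memv_ker lfun_ofE => /eqP.
by [].
Qed.

(* Fitting: [e] is the projection onto the part on which [a] is invertible. *)
Lemma fitting_idempotent (a : B) : exists (e c : B) (s : nat),
  [/\ e * e = e, e = a * c, e = c * a & a ^+ s * e = a ^+ s].
Proof.
have [p p0 pa] := annihilating_poly a.
(* Write p = q X^s with q(0) nonzero; Bezout for X^(s+1) and q gives u X^(s+1) + v q = 1, and e is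
   u(a) a^(s+1). The exponent s + 1 lets [a] divide [e] even when s = 0. *)
have [s [q q0 pE]] := multiplicity_XsubC p 0.
rewrite p0 /= in q0.
have cop : coprimep ('X^(s.+1)) q.
  by apply: coprimep_expl; rewrite coprimep_sym coprimepX.
have [[u v] uv] := Bezout_eq1_coprimepP _ _ cop.
pose h : {rmorphism {poly k} -> B} := horner_alg a.
exists (h (u * 'X^(s.+1))), (h (u * 'X^s)), s.
have hX : h 'X = a by apply: horner_algX.
have kill (t : {poly k}) : h (t * q * 'X^s) = 0.
  by rewrite -mulrA rmorphM /= -(subr0 'X) -polyC0 -pE [h p]pa mulr0.
have uvE : v * q = 1 - u * 'X^(s.+1) by rewrite -uv /= addrC addKr.
split.
- apply/eqP; rewrite -subr_eq0 -rmorphM -rmorphB -oppr_eq0 -rmorphN opprB; apply/eqP.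
  rewrite -{1}[u * 'X^(s.+1)]mulr1 -mulrBr -uvE.
  rewrite (_ : _ * (v * q) = u * 'X * v * q * 'X^s) ?kill //.
  by rewrite exprS; ring.
- by rewrite -[in RHS]hX -rmorphM exprS mulrCA.
- by rewrite -[in RHS]hX -rmorphM exprSr mulrA.
rewrite -hX -rmorphXn -rmorphM; apply/eqP; rewrite -subr_eq0 -rmorphB /=.
rewrite -oppr_eq0 -rmorphN opprB -{1}['X^s]mulr1 -mulrBr -uvE mulrC.
by rewrite kill.
Qed.

End Fitting.

Section Simple.
Variables (k : fieldType) (O : Type).
Notation omod := (omod k O).
Implicit Types M N S X Y : omod.

Definition osimple X := (exists x : X, x <> 0) /\
  forall U : {vspace X}, stable U -> U = 0%VS \/ U = fullv.

Lemma simple_surj M S (f : 'Hom(M, S)) x : osimple S -> ohom f -> f x <> 0 -> surj f.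
Proof.
move=> [_ sS] hf fx; apply/limg_fullP; case: (sS _ (stable_limg hf)) => // f0.
by case: fx; apply/eqP; rewrite -memv0 -f0 memv_img ?memvf.
Qed.

Lemma simple_inj S M (f : 'Hom(S, M)) x : osimple S -> ohom f -> f x <> 0 -> injective f.
Proof.
move=> [_ sS] hf fx; apply/lker_eq0P; case: (sS _ (stable_lker hf)) => // f0.
by case: fx; apply/eqP; rewrite -memv_ker f0 memvf.
Qed.

Lemma simple_quotient M : (exists x : M, x <> 0) ->
  exists S (p : 'Hom(M, S)), [/\ osimple S, ohom p & surj p].
Proof.
have [n] := ubnP (odim M); elim: n M => // n IH M Mn Mx.
have [sM | nsM] := EM (osimple M).
  exists M, \1%VF; split=> //; first exact: ohom_id.
  by move=> y; exists y; rewrite id_lfunE.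
have [U [sU U0 Uf]] : exists U : {vspace M}, [/\ stable U, U <> 0%VS & U <> fullv].
  apply: contrapT => nU; apply: nsM; split=> // U sU.
  have [->|/eqP U0] := eqVneq U 0%VS; first by left.
  have [->|/eqP Uf] := eqVneq U fullv; first by right.
  by case: nU; exists U.
have [N [i [hi ii iU]]] := sub_exists sU.
have [Q [p [hp ps pU]]] := quot_exists sU.
have e : ses i p.
  split=> // [x | y /pU/iU //].
  by apply/pU/iU; exists x.
have Nn : (0 < odim N)%N.
  rewrite lt0n; apply/negP => /eqP N0; apply: U0; apply/vspaceP => y.
  rewrite memv0; apply/idP/eqP => [/iU[x ->] | ->]; last exact: mem0v.
  by rewrite (odim0 N0 x) linear0.
have [||S [q [sS hq qs]]] := IH Q.
- by have := ses_dim e; lia.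
- apply: contrapT => nQ; apply: Uf; apply/vspaceP => y; rewrite memvf.
  by apply/pU; apply: contrapT => py; apply: nQ; exists (p y).
exists S, (q \o p)%VF; split=> //; first exact: ohom_comp.
move=> y; case: (qs y) => z <-; case: (ps z) => x <-.
by exists x; rewrite comp_lfunE.
Qed.

End Simple.

Section SimpleIdempotent.
Variables (k : fieldType) (B : falgType k).
Implicit Types X Y : omod k B.

Lemma simple_mod_osimple (M : rmodule B) : simple_mod M <-> osimple (om M).
Proof.
split=> [[M0 sM] | [[x x0] sM]]; split.
- apply: contrapT => nx; apply: M0; apply/vspaceP => x; rewrite memvf memv0.
  by apply/esym/eqP; apply: contrapT => x0; apply: nx; exists x.
- by move=> U sU; apply: sM => m b /(sU b); rewrite omE.
- by move=> M0; apply: x0; apply/eqP; rewrite -memv0 -M0 memvf.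
by move=> U sU; apply: sM => b m; rewrite omE; apply: sU.
Qed.

Lemma mod_iso_oiso (M N : rmodule B) : mod_iso M N <-> oiso (om M) (om N).
Proof.
split=> [[f [/mod_hom_ohom hf /lker_eq0P fi /limg_fullP fs]] | [f hf [fi fs]]].
  by exists f.
by exists f; split; [apply/mod_hom_ohom | apply/lker_eq0P | apply/limg_fullP].
Qed.

Lemma fitting_fix X (vX : modV X) (a e c : B) s (x : X) :
  e = a * c -> a ^+ s * e = a ^+ s -> oact X a x = x -> oact X e x = x.
Proof.
move=> _ aes ax; have [X1 XM _] := vX.
have axn : oact X (a ^+ s) x = x.
  by elim: s {aes} => [|s IH]; rewrite ?expr0 ?X1 // exprS XM ax IH.
by rewrite -{1}axn -XM aes axn.
Qed.

(* [e] is chosen with [e B] of minimal dimension among the idempotents acting *)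
(* non trivially on [X].                                                      *)
Lemma simple_idempotent X : modV X -> osimple X -> exists e : B,
  [/\ e * e = e,
      exists x, oact X e x <> 0,
      forall Y y, modV Y -> osimple Y -> ~ oiso X Y -> oact Y e y = 0
    & forall b x, e * b = b -> b * e = b -> x <> 0 -> oact X b x = x ->
        exists c, b * c = e].
Proof.
move=> vX sX; have [X1 XM XL] := vX.
pose P e := e * e = e /\ exists x, oact X e x <> 0.
pose d (e : B) := \dim (limg (amull e)).
have [e [[ee [x0 ex0]] emin]] : exists e, P e /\ forall e', P e' -> (d e <= d e')%N.
  have exn : exists n, `[< exists2 e, P e & d e = n >].
    exists (d 1); apply/asboolP; exists 1 => //; split; first exact: mulr1.
    by case: sX => -[x x0] _; exists x; rewrite X1.
  case: (ex_minnP exn) => n /asboolP[e Pe de] nmin; exists e; split=> // e' Pe'.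
  by rewrite de; apply: nmin; apply/asboolP; exists e'.
(* Here [f B] is contained in [e B], so the two coincide by minimality. *)
have minE f : P f -> e * f = f -> f * e = f -> f = e.
  move=> Pf ef fe.
  have sub : (limg (amull f) <= limg (amull e))%VS.
    apply/subvP => _ /memv_imgP[b _ ->]; rewrite lfunE /= -ef -mulrA.
    have -> : e * (f * b) = amull e (f * b) by rewrite lfunE.
    by rewrite memv_img ?memvf.
  have /eqP E : limg (amull e) == limg (amull f) by rewrite eq_sym eqEdim sub emin.
  have : e \in limg (amull f).
    have -> : e = amull e 1 by rewrite lfunE /= mulr1.
    by rewrite -E memv_img ?memvf.
  case/memv_imgP => b _; rewrite lfunE /= => eE.
  by rewrite -fe eE mulrA (Pf.1).
(* The Fitting idempotent of [b] lies in [e B e] and fixes [x], so it is [e]; as it is a multiple of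
   [b], it kills whatever [b] kills. *)
have fixE b x : e * b = b -> b * e = b -> x <> 0 -> oact X b x = x ->
    (exists c, b * c = e) /\ forall Y y, modV Y -> oact Y b y = 0 -> oact Y e y = 0.
  move=> eb be x0' bx; have [f [c [s [ff fc cf bs]]]] := fitting_idempotent b.
  have fx : oact X f x = x by apply: fitting_fix fc bs bx.
  have Pf : P f by split=> //; exists x; rewrite fx.
  have ef : e * f = f by rewrite fc mulrA eb.
  have fe : f * e = f by rewrite cf -mulrA be.
  have fE := minE f Pf ef fe; split; first by exists c; rewrite -fc.
  by move=> Y y [_ YM _] by0; rewrite -fE fc YM by0 linear0.
exists e; split=> //; last by move=> b x eb be x1 /(fixE b x eb be x1)[].
  by exists x0.
move=> Y y vY sY nXY; apply: contrapT => ey.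
have [_ YM _] := vY.
set x := oact X e x0 in ex0; set z := oact Y e y in ey.
have xe : oact X e x = x by rewrite /x -XM ee.
have ze : oact Y e z = z by rewrite /z -YM ee.
(* If all elements annihilating [z] annihilated [x], sending [z b] to [x b] would give an
   isomorphism from [Y] to [X]. *)
have [a [ax az]] : exists a, oact X a x = x /\ oact Y a z = 0.
  pose p := orbit_map vX x; pose q := orbit_map vY z.
  have hp : ohom p by apply: orbit_map_hom.
  have hq : ohom q by apply: orbit_map_hom.
  have qs : surj q by apply: (@simple_surj _ _ (oreg B) Y q e sY hq); rewrite orbit_mapE ze.
  have ps : surj p by apply: (@simple_surj _ _ (oreg B) X p e sX hp); rewrite orbit_mapE xe.
  have [K [i ei]] := ker_exists hq qs.
  have hpi : ohom (p \o i)%VF by apply: ohom_comp => //; apply: ses_hi ei.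
  have [[t pit] | /forallNP pi0] := EM (exists t, (p \o i)%VF t <> 0).
    have := simple_surj sX hpi pit => /(_ x)[t' t'x].
    exists (i t'); rewrite -!orbit_mapE -/p -/q -t'x comp_lfunE; split=> //.
    exact: ses_pi ei _.
  have [|g hg gq] := factor_epi hq qs hp.
    move=> b /(ses_ex ei)[t ->]; rewrite -comp_lfunE.
    exact: contrapT (pi0 t).
  case: nXY; apply: oiso_sym; exists g => //; split.
    by apply: (simple_inj (x := z) sY hg); rewrite -{1}ze -orbit_mapE gq orbit_mapE xe.
  by move=> w; case: (ps w) => b <-; exists (q b); rewrite gq.
have eb : e * (e * a * e) = e * a * e by rewrite !mulrA ee.
have be : e * a * e * e = e * a * e by rewrite -!mulrA ee.
have bx : oact X (e * a * e) x = x by rewrite !XM xe ax xe.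
have [_ /(_ Y z vY)] := fixE _ _ eb be ex0 bx.
rewrite ze => H; case: ey; apply: H.
by rewrite !YM ze az linear0.
Qed.

End SimpleIdempotent.

(** Images of compatible operators form an exact sequence when [E] is idempotent: an element of its
    image that comes from [M'] is fixed by [E], so it comes from the image of [E']. *)
Lemma rank_ses (k : fieldType) (O : Type) (M' M M'' : omod k O)
    (i : 'Hom(M', M)) (p : 'Hom(M, M''))
    (E' : 'End(ocar M')) (E : 'End(ocar M)) (E'' : 'End(ocar M'')) :
  ses i p -> (forall x, i (E' x) = E (i x)) -> (forall x, p (E x) = E'' (p x)) ->
  (forall x, E (E x) = E x) ->
  \dim (limg E) = (\dim (limg E') + \dim (limg E''))%N.
Proof.
move=> e iE pE EE; rewrite -(limg_ker_dim p (limg E)).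
have -> : (p @: limg E)%VS = limg E''.
  apply/vspaceP => y; apply/memv_imgP/memv_imgP => [[_ /memv_imgP[x _ ->] ->] | [z _ ->]].
    by exists (p x); rewrite ?memvf // pE.
  case: (ses_surj e z) => x <-; exists (E x); rewrite ?pE //.
  by rewrite memv_img ?memvf.
have -> : (limg E :&: lker p)%VS = (i @: limg E')%VS.
  apply/vspaceP => y; rewrite memv_cap memv_ker; apply/andP/memv_imgP.
    case=> /memv_imgP[x _ ->] /eqP/(ses_ex e)[z zE].
    exists (E' z); first by rewrite memv_img ?memvf.
    by rewrite iE -zE EE.
  case=> _ /memv_imgP[x _ ->] ->; rewrite (ses_pi e) eqxx iE.
  by rewrite memv_img ?memvf.
congr (_ + _)%N; apply: limg_dim_eq.
by have /lker0P/eqP -> := ses_inj e; rewrite capv0.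
Qed.

Lemma int_seq_max (P : int -> Prop) (s : seq int) : (exists2 i, i \in s & P i) ->
  exists2 i, P i & forall j, j \in s -> P j -> j <= i.
Proof.
elim: s => [|x s IH] [i]; first by [].
rewrite inE => isx Pi.
have [[j js Pj] | nj] := EM (exists2 j, j \in s & P j); last first.
  have ix : i = x by case/orP: isx => [/eqP //| si]; case: nj; exists i.
  exists x; first by rewrite -ix.
  by move=> j; rewrite inE => /orP[/eqP -> // | js Pj]; case: nj; exists j.
have [m Pm mM] := IH (ex_intro2 _ _ j js Pj).
have [xm | mx] := leP x m.
  by exists m => // y; rewrite inE => /orP[/eqP -> // | ys]; apply: mM.
have [Px | nPx] := EM (P x).
  exists x => // y; rewrite inE => /orP[/eqP -> // | ys Py].
  exact: le_trans (mM y ys Py) (ltW mx).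
by exists m => // y; rewrite inE => /orP[/eqP -> // | ys]; apply: mM.
Qed.

(** * The degree zero part and the graded simple modules *)

Section DegreeZero.
Variables (k : fieldType) (A : falgType k) (l : nat) (gr : grading A l).
Notation gomod := (omod k (A + int)%type).
Notation grV := (grV gr).
Notation greg := (greg gr).
Notation B := (subvs_of (degree0 gr)).
Implicit Types X Y Z M N P : gomod.

Lemma greg_out i (a : A) : (i < 0) || (l%:Z < i) -> pj greg i a = 0.
Proof.
move=> /(homog_out gr) gi; have := greg_pj_deg gr i a.
by rewrite gi memv0 => /eqP.
Qed.

Definition deg0 (a : A) : B := vsproj (degree0 gr) (pj greg 0 a).

Lemma deg0E a : vsval (deg0 a) = pj greg 0 a.
Proof. by rewrite /deg0 vsprojK //; exact: greg_pj_deg. Qed.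

Lemma deg0_val (b : B) : deg0 (vsval b) = b.
Proof.
apply: val_inj; rewrite /= deg0E; apply/greg_degP; exact: subvsP b.
Qed.

Lemma deg0_homog j a : a \in gr j -> j <> 0 -> deg0 a = 0.
Proof.
move=> /greg_degP aj /eqP j0; apply: val_inj; rewrite /= deg0E -aj.
by have [_ _ -> _] := greg_grV gr; rewrite eq_sym (negPf j0).
Qed.

Lemma deg0_1 : deg0 1 = 1.
Proof.
apply: val_inj; rewrite /= deg0E greg1 eqxx; apply/esym.
by apply/eqP; have -> : (algid (degree0 gr) == 1) by rewrite algid_eq1; apply: homog1.
Qed.

(** There are no negative degrees, so only the product of the two degree 0 components contributes in
    degree 0. *)
Lemma deg0M a b : deg0 (a * b) = deg0 a * deg0 b.
Proof.
apply: val_inj; rewrite /= !deg0E.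
have [_ [s us sE] prO prM] := greg_grV gr.
rewrite -(sE b) mulr_sumr !linear_sum mulr_sumr; apply: eq_bigr => j _ /=.
have bj := greg_pj_deg gr j b; rewrite prO.
have := prM (0 - j) j _ a bj; rewrite !greg_act subrK => ->.
case: eqP => [<- | /eqP]; first by rewrite subr0.
rewrite neq_lt => /orP[j0 | j0]; rewrite mulr0.
  by rewrite greg_out ?mul0r //; lia.
by rewrite [pj greg j b]greg_out ?mulr0 //; lia.
Qed.

Lemma deg0_linear : linear deg0.
Proof. by move=> c a b; apply: val_inj; rewrite /= !deg0E linearP. Qed.

(** Inflation along the algebra morphism [deg0], with the module placed in degree 0. *)
Definition infl (X : omod k B) : gomod :=
  @OMod k (A + int)%type X (fun o => match o with
    | inl a => oact X (deg0 a)
    | inr i => if i == 0 then \1%VF else 0 end).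

Lemma act_infl (X : omod k B) a m : act (infl X) a m = oact X (deg0 a) m. Proof. by []. Qed.
Lemma pj_infl (X : omod k B) i m : pj (infl X) i m = if i == 0 then m else 0.
Proof. by rewrite /pj /=; case: eqP => _; rewrite ?id_lfunE ?zero_lfunE. Qed.

Lemma infl_grV (X : omod k B) : modV X -> grV (infl X).
Proof.
move=> vX; have [X1 XM XL] := vX; split.
- split=> [m | a b m | c a b m]; rewrite /= !act_infl.
  + by rewrite deg0_1 X1.
  + by rewrite deg0M XM.
  by rewrite deg0_linear XL.
- by exists [:: 0] => // m; rewrite big_seq1 pj_infl eqxx.
- by move=> i j m; rewrite !pj_infl; have [->|j0] := eqVneq j 0; rewrite ?if_same.
move=> i j a m aj; rewrite !act_infl !pj_infl.
have [-> | /eqP j0] := eqVneq j 0; first by rewrite addr0; case: eqP => // _; rewrite linear0.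
by rewrite (deg0_homog aj j0) !(modV0 vX) if_same.
Qed.

Lemma infl_hom (X Y : omod k B) (f : 'Hom(X, Y)) :
  ohom f -> ohom (f : 'Hom(infl X, infl Y)).
Proof.
move=> hf; apply/ohomE; split=> [a m | i m]; first by rewrite !act_infl hf.
by rewrite !pj_infl; case: eqP; rewrite ?linear0.
Qed.

Definition dgr X i (e : A) := \dim (limg (act X e \o pj X i)%VF).

Lemma dgr_ses X Y Z (f : 'Hom(X, Y)) (g : 'Hom(Y, Z)) i (e : B) :
  grV Y -> ses f g -> e * e = e ->
  dgr Y i (vsval e) = (dgr X i (vsval e) + dgr Z i (vsval e))%N.
Proof.
move=> vY s ee; have [vV _ prO prM] := vY.
have [fa fp] := (ohomE _).1 (ses_hi s); have [ga gp] := (ohomE _).1 (ses_hp s).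
apply: (rank_ses s) => x; rewrite !comp_lfunE ?fa ?fp ?ga ?gp //.
have e0 : vsval e \in gr 0 by apply: subvsP e.
have prE n : pj Y i (act Y (vsval e) n) = act Y (vsval e) (pj Y i n).
  by rewrite -(prM _ _ _ _ e0) addr0.
rewrite prE prO eqxx.
have [_ vM _] := vV; have := vM (vsval e) (vsval e) (pj Y i x).
by move=> /= <-; rewrite -[in RHS]ee.
Qed.

Lemma dgr_shift X n i e : dgr (gshift X n) i e = dgr X (i - n) e.
Proof. by []. Qed.

Lemma dgr_infl (X : omod k B) i (e : B) :
  dgr (infl X) i (vsval e) = if i == 0 then \dim (limg (oact X e)) else 0%N.
Proof.
rewrite /dgr; case: eqP => [-> | /eqP i0].
  congr (\dim (limg _)); apply/lfunP => x.
  by rewrite comp_lfunE pj_infl eqxx act_infl deg0_val.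
rewrite (_ : (_ \o _)%VF = 0) ?lim0g ?dimv0 //; apply/lfunP => x.
by rewrite comp_lfunE pj_infl (negPf i0) linear0 zero_lfunE.
Qed.

Lemma act_sum X (I : Type) (s : seq I) (F : I -> A) m : grV X ->
  act X (\sum_(i <- s) F i) m = \sum_(i <- s) act X (F i) m.
Proof. by move=> vX; apply: (@modV_sum _ _ _ _ _ (fgt X) m (grV_modV vX)). Qed.

(** The highest nonzero component is a submodule, since homogeneous elements of positive degree kill
    it. A simple module is therefore concentrated in one degree, where [A] acts through A_0. *)
Lemma gr_simple X : grV X -> osimple X ->
  exists i (Y : omod k B), [/\ modV Y, osimple Y & oiso X (gshift (infl Y) i)].
Proof.
move=> vX [[x x0] sX]; have [vV [s us sE] prO prM] := vX.
have [i0 i0s i0x] : exists2 i, i \in s & pj X i <> 0.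
  apply: contrapT => n; apply: x0; rewrite -(sE x) big_seq big1 // => i si.
  have -> : pj X i = 0 by apply: contrapT => pi; apply: n; exists i.
  by rewrite zero_lfunE.
have [i pi iM] := @int_seq_max (fun i => pj X i <> 0) s (ex_intro2 _ _ i0 i0s i0x).
have iM' j : i < j -> pj X j = 0.
  move=> ij; have [js | js] := boolP (j \in s).
    by apply: contrapT => /(iM _ js); rewrite leNgt ij.
  by apply/lfunP => m; rewrite zero_lfunE (grV_out vX us sE).
have actE a m : act X a (pj X i m) = act X (pj greg 0 a) (pj X i m).
  have [_ [t ut tE] qrO _] := greg_grV gr.
  rewrite -[in LHS](tE a) -[in RHS](tE a) linear_sum !(act_sum _ _ _ vX).
  apply: eq_bigr => j _ /=; rewrite qrO; case: eqP => [<- // | /eqP].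
  have X0 n : act X 0 n = 0 := modV0 vV n.
  rewrite neq_lt => /orP[j0 | j0]; last by rewrite [pj greg j a]greg_out ?X0 //; lia.
  rewrite X0 -(prM _ _ _ _ (greg_pj_deg gr j a)) iM' ?zero_lfunE //; lia.
have st : stable (limg (pj X i)).
  case=> [a|j] m /memv_imgP[y _ ->]; last first.
    rewrite -/(pj X j) prO; case: eqP => _; last exact: mem0v.
    by rewrite memv_img ?memvf.
  rewrite -/(act X a) actE -(prM _ _ _ _ (greg_pj_deg gr 0 a)) addr0.
  by rewrite memv_img ?memvf.
have pf m : pj X i m = m.
  have : m \in limg (pj X i).
    case: (sX _ st) => E; rewrite E ?memvf //; case: pi; apply/lfunP => y.
    by apply/eqP; rewrite zero_lfunE -memv0 -E memv_img ?memvf.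
  by case/memv_imgP => y _ ->; rewrite prO eqxx.
have {}actE a m : act X a m = act X (vsval (deg0 a)) m.
  by rewrite deg0E -{1}(pf m) actE pf.
pose Y : omod k B := @OMod k B X (fun b => act X (vsval b)).
have vY : modV Y.
  case: vV => X1 XM XL; split.
  - move=> m; have X1m : act X 1 m = m := X1 m.
    by move: X1m; rewrite actE deg0_1.
  - by move=> a b m; apply: XM.
  by move=> c a b m; apply: XL.
exists i, Y; split=> //.
  split; first by exists x.
  move=> U sU; apply: sX => -[a|j] m mU.
    by rewrite -/(act X a) actE; apply: (sU (deg0 a)).
  rewrite -/(pj X j) -(pf m) prO; case: eqP => _; last exact: mem0v.
  by rewrite pf.
exists (\1%VF : 'Hom(X, gshift (infl Y) i)).
  apply/ohomE; split=> [a m | j m]; rewrite !id_lfunE.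
    by rewrite act_shift act_infl actE.
  by rewrite pj_shift pj_infl subr_eq0 -{1}(pf m) prO pf.
by split=> [a b | b]; [rewrite !id_lfunE | exists b; rewrite id_lfunE].
Qed.

End DegreeZero.

(** [sd_unit] is the form in which locality of e_j A_0 e_j enters: its elements fixing a nonzero
    vector of S_j are invertible on the right. *)
Record simple_data (k : fieldType) (B : falgType k) (r : nat)
    (S : 'I_r -> omod k B) (e : 'I_r -> B) : Prop := SimpleData {
  sd_mod : forall j, modV (S j);
  sd_simple : forall j, osimple (S j);
  sd_all : forall X, modV X -> osimple X -> exists j, oiso X (S j);
  sd_idem : forall j, e j * e j = e j;
  sd_out : forall i j (x : S i), i != j -> oact (S i) (e j) x = 0;
  sd_in : forall j, exists2 x : S j, x <> 0 & oact (S j) (e j) x = x;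
  sd_unit : forall j b (x : S j), e j * b = b -> b * e j = b -> x <> 0 ->
    oact (S j) b x = x -> exists c, b * c = e j
}.

Lemma simple_data_exists (k : fieldType) (B : falgType k) r :
  has_num_simples B r -> exists (S : 'I_r -> omod k B) e, simple_data S e.
Proof.
case=> S [sS iS allS].
have sS' j : osimple (om (S j)) by apply/simple_mod_osimple.
have /choice[e eP] : forall j, exists e : B, [/\ e * e = e,
      exists x, oact (om (S j)) e x <> 0,
      forall Y y, modV Y -> osimple Y -> ~ oiso (om (S j)) Y -> oact Y e y = 0
    & forall b x, e * b = b -> b * e = b -> x <> 0 -> oact (om (S j)) b x = x ->
        exists c, b * c = e].
  by move=> j; apply: simple_idempotent => //; apply: om_modV.
exists (fun j => om (S j)), e; split=> //.
- by move=> j; apply: om_modV.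
- move=> X vX sX; have [|j /mod_iso_oiso iso] := allS (rmod_of vX).
    apply/simple_mod_osimple; case: sX => x0 sU; split=> // U st.
    by apply: sU => b m /(st b); rewrite omE.
  exists j; case: iso => f hf fb; exists f => // b m.
  by rewrite -hf omE.
- by move=> j; case: (eP j).
- move=> i j x ij; case: (eP j) => _ _ H _; apply: H => //; first exact: om_modV.
  move=> iso; case/eqP: ij; apply/iS/mod_iso_oiso; exact: oiso_sym iso.
- move=> j; case: (eP j) => ee [x ex] _ _; exists (oact (om (S j)) (e j) x) => //.
  by have [_ XM _] := om_modV (S j); rewrite -XM ee.
by move=> j; case: (eP j).
Qed.

(** * Composition multiplicities of graded modules *)

Section Multiplicities.
Variables (k : fieldType) (A : falgType k) (l : nat) (gr : grading A l).
Notation gomod := (omod k (A + int)%type).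
Notation grV := (grV gr).
Notation B := (subvs_of (degree0 gr)).
Implicit Types X Y Z M N P K Q : gomod.
Variables (r : nat) (S : 'I_r -> omod k B) (e : 'I_r -> B).
Hypothesis sd : simple_data S e.

Let gV := grV_variety gr.

Definition grS j i : gomod := gshift (infl (S j)) i.

Lemma grS_grV j i : grV (grS j i).
Proof. by apply/grV_shift/infl_grV; apply: sd_mod sd j. Qed.

Lemma gr_simple_quot X : grV X -> (exists x : X, x <> 0) ->
  exists j i (p : 'Hom(X, grS j i)), ohom p /\ surj p.
Proof.
move=> vX /simple_quotient[Y [p [sY hp ps]]].
have [i [Z [vZ sZ [f hf [fi fs]]]]] := gr_simple (var_quot gV hp ps vX) sY.
have [j [g hg [gi gs]]] := sd_all sd vZ sZ.
exists j, i, (g \o f \o p)%VF; split.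
  have hg' : ohom (g : 'Hom(gshift (infl Z) i, grS j i)).
    exact: (@ohom_shift _ _ _ _ i _ (infl_hom hg)).
  exact: (ohom_comp (ohom_comp hg' hf) hp).
move=> z; case: (gs z) => y <-; case: (fs y) => x <-; case: (ps x) => w <-.
by exists w; rewrite !comp_lfunE.
Qed.

Lemma grS_neq0 j i : exists x : grS j i, x <> 0.
Proof. by case: (sd_in sd j) => x x0 _; exists x. Qed.

(** Composition series as an induction principle: a nonzero module has a simple graded quotient,
    whose kernel has smaller dimension. *)
Lemma gr_ind (Q : gomod -> Prop) :
  (forall X, grV X -> odim X = 0%N -> Q X) -> (forall j i, Q (grS j i)) ->
  (forall X Y Z (f : 'Hom(X, Y)) (g : 'Hom(Y, Z)), grV Y -> ses f g ->
    Q X -> Q Z -> Q Y) ->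
  forall X, grV X -> Q X.
Proof.
move=> Q0 QS Qe X; have [n] := ubnP (odim X); elim: n X => // n IH X Xn vX.
have [X0 | X0] := eqVneq (odim X) 0%N; first exact: Q0.
have [|j [i [p [hp ps]]]] := gr_simple_quot vX.
  apply: contrapT => nx; case/eqP: X0; apply/eqP; rewrite /odim -dimvf dimv_eq0 -subv0.
  by apply/subvP => x _; rewrite memv0; apply/eqP; apply: contrapT => x0; apply: nx; exists x.
have [K [u s]] := ker_exists hp ps.
apply: (Qe _ _ _ _ _ vX s (IH K _ (ses_varl gV s vX)) (QS j i)).
have : (0 < odim (grS j i))%N.
  rewrite lt0n; apply/negP => /eqP d0; case: (grS_neq0 j i) => x; apply.
  exact: odim0 d0 x.
by have := ses_dim s; lia.
Qed.

Definition simp_dim j := \dim (limg (oact (S j) (e j))).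

Lemma simp_dim_gt0 j : (0 < simp_dim j)%N.
Proof.
rewrite lt0n dimv_eq0; apply/negP => /eqP E; case: (sd_in sd j) => x x0 ex.
by apply: x0; apply/eqP; rewrite -memv0 -E -ex memv_img ?memvf.
Qed.

Definition dd X i j := dgr X i (vsval (e j)).

Lemma dd_ses X Y Z (f : 'Hom(X, Y)) (g : 'Hom(Y, Z)) i j :
  grV Y -> ses f g -> dd Y i j = (dd X i j + dd Z i j)%N.
Proof. by move=> vY s; apply: (dgr_ses _ vY s); apply: sd_idem sd j. Qed.

Lemma dd_grS j i i' j' :
  dd (grS j i) i' j' = if (i', j') == (i, j) then simp_dim j else 0%N.
Proof.
rewrite /dd dgr_shift dgr_infl subr_eq0 xpair_eqE; case: eqP => //= _.
case: eqVneq => [-> // | jj].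
rewrite (_ : oact _ _ = 0) ?lim0g ?dimv0 //; apply/lfunP => x.
by rewrite (sd_out sd) ?zero_lfunE // eq_sym.
Qed.

Lemma dd_0 X i j : odim X = 0%N -> dd X i j = 0%N.
Proof.
move=> X0; apply/eqP; rewrite dimv_eq0 -subv0; apply/subvP => x _.
by rewrite (odim0 X0 x) mem0v.
Qed.

Lemma dd_dvd X i j : grV X -> (simp_dim j %| dd X i j)%N.
Proof.
apply: (gr_ind (Q := fun X => (simp_dim j %| dd X i j)%N)).
- by move=> Y _ Y0; rewrite dd_0.
- by move=> j' i'; rewrite dd_grS; case: eqP => [[_ ->]|].
by move=> U Y Z f g vY s dU dZ; rewrite (dd_ses _ _ vY s) dvdn_add.
Qed.

Lemma dd_supp X : grV X -> exists2 s, uniq s & forall i j, i \notin s -> dd X i j = 0%N.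
Proof.
move=> vX; have [_ [s us sE] _ _] := vX; exists s => // i j si.
apply/eqP; rewrite dimv_eq0 -subv0; apply/subvP => _ /memv_imgP[x _ ->].
by rewrite comp_lfunE (grV_out vX us sE) // linear0 mem0v.
Qed.

(** The Jordan-Hoelder multiplicity of S_j(i). The idempotent e_j kills the other simples, so the
    dimension of X_i e_j counts the factors S_j(i), each contributing [simp_dim j], which need not
    be 1 over a general field. *)
Definition mult X i j := (dd X i j %/ simp_dim j)%N.

Lemma mult_dd X i j : grV X -> (mult X i j * simp_dim j = dd X i j)%N.
Proof. by move=> vX; rewrite /mult divnK // dd_dvd. Qed.

Notation F := {freeg (int * 'I_r)%type / int}.

Lemma cl_exists X : grV X ->
  exists D : F, forall i j, coeff (i, j) D = (mult X i j)%:Z.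
Proof.
move=> vX; have [s us s0] := dd_supp vX.
exists (\sum_(i <- s) \sum_j << (mult X i j)%:Z *g (i, j) >>) => i j.
rewrite raddf_sum; have [si | si] := boolP (i \in s); last first.
  rewrite /mult s0 // div0n big_seq big1 // => i' si' /=.
  rewrite raddf_sum big1 // => j' _ /=; rewrite coeffU xpair_eqE.
  by case: eqP => [E|_]; rewrite ?mulr0 //; rewrite E (negPf si) in si'.
rewrite (bigD1_seq i) //= [X in _ + X]big1 ?addr0 => [|i' /negPf ii].
  rewrite raddf_sum (bigD1 j) //= [X in _ + X]big1 ?addr0 => [|j' /negPf jj].
    by rewrite coeffU eqxx mulr1.
  by rewrite coeffU xpair_eqE jj andbF mulr0.
by rewrite raddf_sum big1 // => j' _; rewrite /= coeffU xpair_eqE ii mulr0.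
Qed.

Definition cl X : F :=
  if pselect (grV X) is left vX then projT1 (cid (cl_exists vX)) else 0.

Lemma clE X i j : grV X -> coeff (i, j) (cl X) = (mult X i j)%:Z.
Proof.
by move=> vX; rewrite /cl; case: pselect => // vX'; case: cid => D /= ->.
Qed.

Lemma freeg_eq (D1 D2 : F) : (forall i j, coeff (i, j) D1 = coeff (i, j) D2) -> D1 = D2.
Proof. by move=> E; apply/eqP/freeg_eqP => -[i j]. Qed.

Lemma cl_ses X Y Z (f : 'Hom(X, Y)) (g : 'Hom(Y, Z)) :
  grV Y -> ses f g -> cl Y = cl X + cl Z.
Proof.
move=> vY s; have vX := ses_varl gV s vY; have vZ := ses_varr gV s vY.
apply: freeg_eq => i j; rewrite coeffD !clE // /mult (dd_ses _ _ vY s).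
by rewrite divnDl ?dd_dvd // PoszD.
Qed.

Lemma cl_grS j i : cl (grS j i) = << (i, j) >>.
Proof.
apply: freeg_eq => i' j'; rewrite clE; last exact: grS_grV.
rewrite coeffU mul1r /mult dd_grS eq_sym; case: eqP => [[_ ->] | _].
  by rewrite divnn simp_dim_gt0.
by rewrite div0n.
Qed.

Lemma cl_additive_lift (G : lmodType int) (psi : gomod -> G) X :
  (forall X Y Z (f : 'Hom(X, Y)) (g : 'Hom(Y, Z)), grV Y -> ses f g ->
    psi Y = psi X + psi Z) -> (forall X, grV X -> odim X = 0%N -> psi X = 0) ->
  grV X -> fglift (fun z => psi (grS z.2 z.1)) (cl X) = psi X.
Proof.
move=> psiD psi0; pose L := fglift (fun z : int * 'I_r => psi (grS z.2 z.1)).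
have LB : {morph L : x y / x - y} := lift_is_additive _.
have L0 : L 0 = 0 by rewrite -[X in L X](subrr 0) LB subrr.
have LN : {morph L : x / - x} by move=> x; rewrite -[in LHS](sub0r x) LB L0 sub0r.
have LD : {morph L : x y / x + y}.
  by move=> x y; rewrite -[in LHS](opprK y) LB LN opprK.
apply: (gr_ind (Q := fun X => L (cl X) = psi X)).
- move=> Y vY Y0; rewrite psi0 // -L0; congr L; apply: freeg_eq => i j.
  by rewrite clE // /mult dd_0 // div0n coeff0.
- by move=> j i; rewrite cl_grS /L liftU scale1r.
by move=> U Y Z f g vY s UE ZE; rewrite (cl_ses vY s) LD UE ZE -(psiD _ _ _ _ _ vY s).
Qed.

End Multiplicities.

(** * Direct summands cut out by idempotents *)

Section IdempotentImage.
Variables (k : fieldType) (O : Type).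
Notation omod := (omod k O).

Definition idem_image (X I : omod) (E : 'End(ocar X)) :=
  exists (p : 'Hom(X, I)) (u : 'Hom(I, X)),
    [/\ ohom p, ohom u, forall x, u (p x) = E x & forall y, p (u y) = y].

Lemma idem_image_exists (X : omod) (E : 'End(ocar X)) :
  ohom (E : 'Hom(X, X)) -> (forall x, E (E x) = E x) -> exists I, @idem_image X I E.
Proof.
move=> hE EE; have [I [p [u [hp ps hu ui up]]]] := img_exists hE.
exists I, p, u; split=> // y; case: (ps y) => x <-.
by apply: ui; rewrite !up EE.
Qed.

Lemma idem_image_retract (X I : omod) (E : 'End(ocar X)) :
  idem_image I E -> retract I X.
Proof. by case=> p [u [hp hu _ pu]]; exists u, p. Qed.

Lemma idem_image_rank (X I : omod) (E T : 'End(ocar X)) (T' : 'End(ocar I))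
    (u : 'Hom(I, X)) (p : 'Hom(X, I)) :
  (forall x, u (p x) = E x) -> (forall y, p (u y) = y) ->
  (forall y, u (T' y) = T (u y)) -> \dim (limg T') = \dim (limg (T \o E)%VF).
Proof.
move=> up pu uT; have ui : injective u by apply: can_inj pu.
rewrite -(limg_dim_eq (f := u) (U := limg T')); last first.
  by have /lker0P/eqP -> := ui; rewrite capv0.
congr (\dim _); apply/vspaceP => y.
apply/memv_imgP/memv_imgP => [[_ /memv_imgP[x _ ->] ->] | [x _ ->]].
  by exists (u x); rewrite ?memvf // comp_lfunE -up pu uT.
by exists (T' (p x)); rewrite ?memv_img ?memvf // uT comp_lfunE up.
Qed.

End IdempotentImage.

(** * Indecomposable projectives and injectives *)

Section KrullSchmidt.
Variables (k : fieldType) (A : falgType k) (l : nat) (gr : grading A l).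
Notation gomod := (omod k (A + int)%type).
Notation grV := (grV gr).
Notation greg := (greg gr).
Notation B := (subvs_of (degree0 gr)).
Implicit Types X Y Z M N P K Q : gomod.
Variables (r : nat) (S : 'I_r -> omod k B) (e : 'I_r -> B).
Hypothesis sd : simple_data S e.

Let gV := grV_variety gr.

Lemma pj_mull n i (x a : A) : x \in gr n -> pj greg (n + i) (x * a) = x * pj greg i a.
Proof.
move=> xn; have [_ [s us sE] prO _] := greg_grV gr.
rewrite -[in LHS](sE a) -[in RHS](sE a) mulr_sumr !linear_sum mulr_sumr.
apply: eq_bigr => t _ /=; rewrite prO.
have : x * pj greg t a \in gr (n + t).
  by apply: (subvP (homogM gr n t)); rewrite memv_mul ?greg_pj_deg.
move=> /greg_degP E; rewrite -{1}E prO (inj_eq (addrI n)) E.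
by case: eqP; rewrite ?mulr0.
Qed.

(** An idempotent endomorphism of the right module [A], with image the projective P_j = e_j A. *)
Definition lmul (j : 'I_r) : 'End(ocar greg) := amull (vsval (e j)).

Lemma lmulE j a : lmul j a = vsval (e j) * a.
Proof. by rewrite /lmul lfunE. Qed.

Lemma e_deg0 j : vsval (e j) \in gr 0. Proof. exact: subvsP (e j). Qed.

Lemma e_idem j : vsval (e j) * vsval (e j) = vsval (e j).
Proof. exact: (congr1 vsval (sd_idem sd j)). Qed.

Lemma lmul_hom j : ohom (lmul j : 'Hom(greg, greg)).
Proof.
apply/ohomE; split=> [a m | i m]; rewrite !lmulE.
  by rewrite !greg_act mulrA.
by rewrite -(pj_mull i m (e_deg0 j)) add0r.
Qed.

Lemma lmul_idem j a : lmul j (lmul j a) = lmul j a.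
Proof. by rewrite !lmulE mulrA e_idem. Qed.

Lemma proj_cover_exists : exists Pj : 'I_r -> gomod,
  forall j, idem_image (Pj j) (lmul j).
Proof.
have /choice[Pj PjP] : forall j, exists I, @idem_image _ _ greg I (lmul j).
  by move=> j; apply: idem_image_exists (lmul_hom j) (lmul_idem j).
by exists Pj.
Qed.

Variable Pj : 'I_r -> gomod.
Hypothesis PjP : forall j, idem_image (Pj j) (lmul j).

Lemma Pj_oproj j i : oproj grV (gshift (Pj j) i).
Proof.
apply: oproj_shift; apply: (oproj_retract gV (idem_image_retract (PjP j))).
have := greg_oproj gr 0; apply: (oproj_retract gV); apply: oiso_retract.
exists (\1%VF : 'End(ocar greg)).
  apply/ohomE; split=> [a m | t m]; rewrite !id_lfunE //.
  by rewrite pj_shift subr0.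
by split=> [x y | y]; [rewrite !id_lfunE | exists y; rewrite id_lfunE].
Qed.

(** A nonzero projective has some simple quotient S_j(i), and then P_j(i) splits off. Stated as an
    induction principle, this spares any explicit decomposition. *)
Lemma krull_schmidt (X : gomod -> Prop) :
  (forall Q, grV Q -> odim Q = 0%N -> X Q) ->
  (forall K Q j i (u : 'Hom(K, Q)) (p : 'Hom(Q, gshift (Pj j) i)),
     grV Q -> ses u p -> X K -> X Q) ->
  forall Q, oproj grV Q -> X Q.
Proof.
move=> X0 Xs Q; have [n] := ubnP (odim Q); elim: n Q => // n IH Q Qn pQ.
have vQ := pQ.1.
have [Q0 | Q0] := eqVneq (odim Q) 0%N; first exact: X0.
have [|j [i [f [hf fs]]]] := gr_simple_quot sd vQ.
  apply: contrapT => nx; case/eqP: Q0; apply/eqP; rewrite /odim -dimvf dimv_eq0 -subv0.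
  by apply/subvP => x _; rewrite memv0; apply/eqP; apply: contrapT => x0; apply: nx; exists x.
have [p [u [hp hu up pu]]] := PjP j.
have [x x0 ex] := sd_in sd j.
have vT : grV (grS S j i) := grS_grV sd j i.
have xi : pj (grS S j i) i x = x by rewrite pj_shift subrr pj_infl eqxx.
have hh := gorbit_map_hom vT xi; set h := gorbit_map vT x in hh.
have hE a : h a = oact (S j) (deg0 gr a) x by rewrite /h gorbit_mapE.
have [_ SM _] := sd_mod sd j.
have hs : surj h.
  have sT : osimple (grS S j i).
    have [n0 sU] := sd_simple sd j; split=> // U st; apply: sU => b m mU.
    by have := st (inl (vsval b)) m mU; rewrite /= /act /= deg0_val.
  apply: (@simple_surj _ _ (gshift greg i) (grS S j i) h (1 : A) sT hh).
  by rewrite hE deg0_1; have [S1 _ _] := sd_mod sd j; rewrite S1.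
have [g hg gE] := pQ.2 (gshift greg i) (grS S j i) h f (grV_shift i (greg_grV gr)) hh hs hf.
have [ga gp] := (ohomE _).1 hg; have [fa fp] := (ohomE _).1 hf.
have [pa pp] := (ohomE _).1 hp; have [ua upj] := (ohomE _).1 hu.
pose g' : 'Hom(Q, gshift (Pj j) i) := (p \o g)%VF.
have g'E q : g' q = p (g q) by apply: comp_lfunE.
have hp' : ohom (p : 'Hom(gshift greg i, gshift (Pj j) i)).
  exact: (@ohom_shift _ _ _ _ i _ hp).
have hg' : ohom g' by apply: (ohom_comp hp' hg).
have [vV _ prO prM] := vQ.
have [q0 q0E] := fs x.
pose q1 := act Q (vsval (e j)) (pj Q i q0).
have q1i : pj Q i q1 = q1.
  by rewrite /q1 -(prM _ _ _ _ (e_deg0 j)) addr0 prO eqxx.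
have q1e : act Q (vsval (e j)) q1 = q1.
  by rewrite /q1; case: vV => _ vM _; have := vM (vsval (e j)) (vsval (e j)) (pj Q i q0);
    rewrite e_idem => <-.
have fq1 : f q1 = x.
  by rewrite /q1 fa fp q0E xi /grS act_shift act_infl deg0_val ex.
have gq1 : pj greg 0 (g q1) = g q1.
  by rewrite -{2}q1i gp pj_shift subrr.
(* [b] lies in e_j A_0 e_j and fixes [x], so [sd_unit] inverts it on the right; this makes [g']
   surjective onto P_j(i). *)
pose b := e j * deg0 gr (g q1).
have bE : vsval b = vsval (e j) * g q1 by rewrite /b /= deg0E gq1.
have [|||c bc] := @sd_unit _ _ _ _ _ sd j b x _ _ x0.
- by rewrite /b mulrA (sd_idem sd).
- apply: val_inj; rewrite /= deg0E gq1 -mulrA; congr (_ * _).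
  by have := ga (vsval (e j)) q1; rewrite q1e act_shift greg_act.
- by rewrite /b SM ex -hE gE fq1.
have bcA : vsval (e j) * g q1 * vsval c = vsval (e j) by rewrite -bE -[RHS](congr1 vsval bc).
have g's : surj g'.
  move=> y; exists (act Q (vsval c * u y) q1).
  rewrite g'E ga act_shift greg_act; apply: (can_inj pu).
  rewrite up lmulE !mulrA bcA -lmulE -up; congr (u _).
  by rewrite -[RHS]pu.
have [K [v s]] := ker_exists hg' g's.
apply: (Xs _ _ _ _ _ _ vQ s); apply: IH.
  have : (0 < odim (Pj j))%N.
    rewrite lt0n; apply/negP => /eqP d0.
    have e0 : vsval (e j) = 0.
      by rewrite -[vsval _]mulr1 -lmulE -up (odim0 d0 (p 1)) linear0.
    by apply: x0; rewrite -ex -(deg0_val (e j)) e0 /deg0 linear0 linear0 (modV0 (sd_mod sd j)).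
  have E : odim (gshift (Pj j) i) = odim (Pj j) by [].
  by have := ses_dim s; rewrite E; lia.
exact: oproj_retract (ses_retract_proj s vQ (Pj_oproj j i)) pQ.
Qed.

(** Both sides are the dimension of e_j A_s e_j'. *)
Lemma dd_Pj j s j' : dd e (Pj j) s j' =
  \dim (limg (act greg (vsval (e j')) \o pj greg s \o lmul j)%VF).
Proof.
have [p [u [hp hu up pu]]] := PjP j.
apply: (idem_image_rank (u := u) (p := p)) => // y.
by have [ua upj] := (ohomE _).1 hu; rewrite !comp_lfunE ua upj.
Qed.

Let lmul0 j : 'End(ocar (oreg B)) := amull (e j).

Let lmul0E j b : lmul0 j b = e j * b.
Proof. by rewrite /lmul0 lfunE. Qed.

Lemma proj_cover0_exists : exists P0 : 'I_r -> omod k B,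
  forall j, idem_image (P0 j) (lmul0 j).
Proof.
suff /choice[P0 H] : forall j, exists I, @idem_image _ _ (oreg B) I (lmul0 j) by exists P0.
move=> j; apply: idem_image_exists => [b m | b]; rewrite !lmul0E.
  by rewrite !oregE mulrA.
by rewrite mulrA (sd_idem sd).
Qed.

Variable P0 : 'I_r -> omod k B.
Hypothesis P0P : forall j, idem_image (P0 j) (lmul0 j).

Lemma krull_schmidt0 (X : omod k B -> Prop) :
  (forall Q : omod k B, modV Q -> odim Q = 0%N -> X Q) ->
  (forall (K Q : omod k B) j (u : 'Hom(K, Q)) (p : 'Hom(Q, P0 j)), modV Q -> ses u p -> X K -> X Q) ->
  forall Q : omod k B, oproj (@modV k B) Q -> X Q.
Proof.
move=> X0 Xs Q; have [n] := ubnP (odim Q); elim: n Q => // n IH Q Qn pQ.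
have vQ := pQ.1; have mV := modV_variety B.
have [Q0 | Q0] := eqVneq (odim Q) 0%N; first exact: X0.
have [|Y [f1 [sY hf1 f1s]]] := simple_quotient (M := Q).
  apply: contrapT => nx; case/eqP: Q0; apply/eqP; rewrite /odim -dimvf dimv_eq0 -subv0.
  by apply/subvP => x _; rewrite memv0; apply/eqP; apply: contrapT => x0; apply: nx; exists x.
have [j [f2 hf2 [_ f2s]]] := sd_all sd (var_quot mV hf1 f1s vQ) sY.
pose f := (f2 \o f1)%VF; have hf : ohom f by apply: ohom_comp.
have fs : surj f.
  by move=> z; case: (f2s z) => y <-; case: (f1s y) => x <-; exists x; rewrite comp_lfunE.
have [p [u [hp hu up pu]]] := P0P j.
have [x x0 ex] := sd_in sd j.
have [S1 SM _] := sd_mod sd j.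
pose h := orbit_map (sd_mod sd j) x.
have hh : ohom h by apply: orbit_map_hom.
have hE b : h b = oact (S j) b x by apply: orbit_mapE.
have hs : surj h.
  by apply: (@simple_surj _ _ (oreg B) (S j) h (1 : B) (sd_simple sd j) hh); rewrite hE S1.
have [g hg gE] := pQ.2 (oreg B) (S j) h f (om_modV _) hh hs hf.
have hg' : ohom (p \o g)%VF by apply: ohom_comp.
have [q0 q0E] := fs x.
pose q1 := oact Q (e j) q0.
have [_ vM _] := vQ.
have q1e : oact Q (e j) q1 = q1 by rewrite /q1 -vM (sd_idem sd).
have fq1 : f q1 = x by rewrite /q1 hf q0E ex.
have [|||c bc] := @sd_unit _ _ _ _ _ sd j (e j * g q1) x _ _ x0.
- by rewrite mulrA (sd_idem sd).
- rewrite -mulrA; congr (_ * _).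
  by have := hg (e j) q1; rewrite q1e oregE.
- by rewrite SM ex -hE gE fq1.
have g's : surj (p \o g)%VF.
  move=> y; exists (oact Q (c * u y) q1).
  rewrite comp_lfunE hg oregE; apply: (can_inj pu).
  by rewrite up lmul0E !mulrA bc -lmul0E -up pu.
have [K [v s]] := ker_exists hg' g's.
have pP0 : oproj (@modV k B) (P0 j).
  exact: (oproj_retract mV (idem_image_retract (P0P j)) (oreg_proj _)).
apply: (Xs _ _ _ _ _ vQ s); apply: IH.
  have : (0 < odim (P0 j))%N.
    rewrite lt0n; apply/negP => /eqP d0.
    have e0 : e j = 0.
      by rewrite -[e j]mulr1 -lmul0E -up (odim0 d0 (p 1)) linear0.
    by apply: x0; rewrite -ex e0 (modV0 (sd_mod sd j)).
  move=> P0j; apply: (@leq_trans (odim Q)); last by [].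
  by rewrite (ses_dim s) -addn1 leq_add2l.
exact: (oproj_retract mV (ses_retract_proj s vQ pP0) pQ).
Qed.

(** The degree 0 part of e_j A is the projective A_0-module e_j A_0. *)
Lemma dd_Pj0 j j' : dd e (Pj j) 0 j' = \dim (limg (oact (P0 j) (e j'))).
Proof.
have [p [u [hp hu up pu]]] := P0P j.
rewrite dd_Pj (idem_image_rank (T := oact (oreg B) (e j')) up pu) => [|y]; last exact: hu.
pose f : 'Hom(B, A) := linfun vsval.
have fE b : f b = vsval b by rewrite lfunE.
have fi : injective f by move=> a b; rewrite !fE => /subvs_inj.
rewrite -[RHS](limg_dim_eq (f := f)); last first.
  by have /lker0P/eqP -> := fi; rewrite capv0.
have TE (a : A) : (act greg (vsval (e j')) \o pj greg 0 \o lmul j)%VF a =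
    f ((oact (oreg B) (e j') \o lmul0 j)%VF (deg0 gr a)).
  rewrite !comp_lfunE lmul0E lmulE greg_act fE oregE /= deg0E.
  by rewrite -[X in pj greg X](addr0 0) (pj_mull 0 a (e_deg0 j)).
congr (\dim _); apply/vspaceP => y.
apply/memv_imgP/memv_imgP => [[a _ ->] | [_ /memv_imgP[b _ ->] ->]].
  by exists ((oact (oreg B) (e j') \o lmul0 j)%VF (deg0 gr a)); rewrite ?memv_img ?memvf.
by exists (vsval b); rewrite ?memvf // TE deg0_val.
Qed.

End KrullSchmidt.

(** * Cartan matrices and finite global dimension of A_0 *)

Section Cartan.
Variables (k : fieldType) (A : falgType k) (l : nat) (gr : grading A l).
Notation gomod := (omod k (A + int)%type).
Notation B := (subvs_of (degree0 gr)).
Variables (r : nat) (S : 'I_r -> omod k B) (e : 'I_r -> B).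
Hypothesis sd : simple_data S e.
Variable Pj : 'I_r -> gomod.
Hypothesis PjP : forall j, idem_image (Pj j) (lmul e j).

Definition cartan (s : int) : 'M[int]_r := \matrix_(j, j') (mult S e (Pj j) s j')%:Z.

Let rk (M : omod k B) j := \dim (limg (oact M (e j))).

Let rk_ses (K Q M : omod k B) (u : 'Hom(K, Q)) (p : 'Hom(Q, M)) j :
  modV Q -> ses u p -> rk Q j = (rk K j + rk M j)%N.
Proof.
move=> [_ QM _] s; apply: (rank_ses s) => x; first exact: ses_hi s _ _.
  exact: ses_hp s _ _.
by rewrite -QM (sd_idem sd).
Qed.

(** A finite projective resolution of S_j over A_0 writes its class as an integral combination of
    the classes of projectives; these coefficients are the rows of the inverse. *)
Lemma cartan0_left_inverse : finite_gldim B ->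
  exists D : 'M[int]_r, D *m cartan 0 = 1%:M.
Proof.
move=> [n0 gl]; have mV := @modV_variety k B.
have [P0 P0P] := proj_cover0_exists sd.
pose c0 j j' := rk (P0 j) j'.
(* Ranks are multiplicities times [simp_dim], a nonzero factor in each column that is cancelled at
   the end. *)
have c0E j j' : (c0 j j')%:Z = cartan 0 j j' * (simp_dim S e j')%:Z.
  rewrite mxE -PoszM mult_dd //; last first.
    apply: (grV_unshift (n := 0)); exact: (Pj_oproj PjP j 0).1.
  by rewrite (dd_Pj0 PjP P0P).
pose T (M : omod k B) := exists w : 'I_r -> int, forall j', (rk M j')%:Z =
  \sum_j w j * (c0 j j')%:Z.
have Tproj Q : oproj (@modV k B) Q -> T Q.
  apply: (krull_schmidt0 sd P0P) => {Q} [Q _ Q0 | K Q j u p vQ s [w wE]].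
    exists (fun=> 0) => j'; have -> : rk Q j' = 0%N.
      apply/eqP; rewrite dimv_eq0 -subv0; apply/subvP => x _.
      by rewrite (odim0 Q0 x) mem0v.
    by rewrite big1 // => j _; rewrite mul0r.
  exists (fun i => w i + (i == j)%:Z) => j'; rewrite (rk_ses _ vQ s) PoszD wE.
  rewrite (eq_bigr _ (fun i _ => mulrDl _ _ _)) big_split /=; congr (_ + _).
  rewrite (bigD1 j) //= eqxx mul1r big1 ?addr0 // => i /negPf ->.
  by rewrite mul0r.
have Tres D : forall M P d ep, modV M -> @oresolution _ _ (@modV k B) M P d ep ->
    (forall n, (D <= n)%N -> forall x : P n, x = 0) -> T M.
  elim: D => [|D IH] M P d ep vM rs z.
    exists (fun=> 0) => j'; have -> : rk M j' = 0%N.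
      apply/eqP; rewrite dimv_eq0 -subv0; apply/subvP => x _.
      by case: (ores_surj rs x) => y <-; rewrite (z 0%N _ y) // linear0 mem0v.
    by rewrite big1 // => j _; rewrite mul0r.
  have [K [i [e0 [s rK _]]]] := resolution_tail rs.
  have vP := (ores_proj rs 0).1.
  have [|w wE] := IH K _ _ _ (ses_varl mV s vP) rK.
    by move=> n Dn; apply: z.
  have [w' w'E] := Tproj _ (ores_proj rs 0).
  exists (fun j => w' j - w j) => j'.
  rewrite (eq_bigr _ (fun i _ => mulrBl _ _ _)) sumrB -wE -w'E (rk_ses _ vP s) PoszD.
  by rewrite addrAC subrr add0r.
have TS j : T (S j).
  have [P [d [ep [rs z]]]] := gl (rmod_of (sd_mod sd j)).
  have [|w wE] := Tres n0.+1 _ _ _ _ (om_modV _) (proj_resolution_ores rs).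
    by move=> n /z Pn x; apply/eqP; rewrite -memv0 -Pn memvf.
  exists w => j'; rewrite -wE; congr (\dim (limg _))%:Z.
  by apply/lfunP => x; rewrite om_rmod_of_act.
have /choice[w wE] : forall j, exists w : 'I_r -> int, forall j', (rk (S j) j')%:Z =
  \sum_i w i * (c0 i j')%:Z by exact: TS.
exists (\matrix_(j, i) w j i); apply/matrixP => j j'.
have dj' : (simp_dim S e j')%:Z != 0 by rewrite eqz_nat -lt0n simp_dim_gt0.
apply: (mulIf dj'); rewrite !mxE mulr_suml.
transitivity (rk (S j) j')%:Z.
  by rewrite wE; apply: eq_bigr => i _; rewrite c0E !mxE mulrA.
case: eqVneq => [-> | jj]; first by rewrite mul1r.
rewrite mul0r; congr Posz; apply/eqP; rewrite dimv_eq0 -subv0.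
apply/subvP => _ /memv_imgP[x _ ->]; rewrite (sd_out sd) ?mem0v //.
Qed.

Lemma cartan0_unit : finite_gldim B -> cartan 0 \in unitmx.
Proof. by case/cartan0_left_inverse => D /mulmx1_unit[]. Qed.

End Cartan.

(** * Duality of vector spaces *)

Section DualSpace.
Variable (k : fieldType).
Implicit Types V W U : vectType k.

Definition dualv V : vectType k := 'Hom(V, k^o).

Fact precomp_linear V W (T : 'Hom(V, W)) : linear (fun xi : dualv W => (xi \o T)%VF : dualv V).
Proof.
move=> c x y; apply/lfunP => v.
by rewrite add_lfunE scale_lfunE !comp_lfunE add_lfunE scale_lfunE.
Qed.

Definition precomp V W (T : 'Hom(V, W)) : 'Hom(dualv W, dualv V) :=
  lfun_of (precomp_linear T).

Lemma precompE V W (T : 'Hom(V, W)) (xi : 'Hom(W, k^o)) x : (precomp T xi : 'Hom(V, k^o)) x = xi (T x).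
Proof. by rewrite /precomp lfun_ofE comp_lfunE. Qed.

Lemma dual_separates V (a b : V) : (forall xi : 'Hom(V, k^o), xi a = xi b) -> a = b.
Proof.
move=> E; have bV := vbasisP (fullv : {vspace V}).
have lc i : linear (coord (vbasis (fullv : {vspace V})) i : V -> k^o).
  by move=> c x y; rewrite linearP.
rewrite (coord_vbasis (memvf a)) (coord_vbasis (memvf b)).
by apply: eq_bigr => i _; have := E (lfun_of (lc i)); rewrite !lfun_ofE => ->.
Qed.

Lemma dim_dualv V : dim (dualv V) = dim V.
Proof. by rewrite /dim /= muln1. Qed.

Fact eval_linear V (x : V) : linear (fun xi : dualv V => (xi : 'Hom(V, k^o)) x : k^o).
Proof. by move=> c a b; rewrite add_lfunE scale_lfunE. Qed.

Fact bidual_linear V : linear (fun x : V => lfun_of (eval_linear x) : dualv (dualv V)).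
Proof.
move=> c x y; apply/lfunP => xi.
by rewrite add_lfunE scale_lfunE !lfun_ofE linearP.
Qed.

Definition bidual V : 'Hom(V, dualv (dualv V)) := lfun_of (@bidual_linear V).

Lemma bidualE V (x : V) (xi : 'Hom(V, k^o)) :
  (bidual V x : 'Hom(dualv V, k^o)) xi = xi x.
Proof. by rewrite /bidual !lfun_ofE. Qed.

Lemma bidual_inj V : injective (bidual V).
Proof.
move=> x y xy; apply: dual_separates => xi.
by rewrite -(bidualE x) -(bidualE y) xy.
Qed.

Lemma bidual_surj V y : exists x, bidual V x = y.
Proof.
have : y \in limg (bidual V).
  have /eqP -> : limg (bidual V) == fullv; last exact: memvf.
  have lk : lker (bidual V) = 0%VS by apply/lker_eq0P/bidual_inj.
  by rewrite eqEdim subvf dimvf !dim_dualv limg_dim_eq ?lk ?capv0 ?dimvf ?leqnn.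
by case/memv_imgP => x _ ->; exists x.
Qed.

Lemma precomp_surj V W (T : 'Hom(V, W)) : injective T -> forall y, exists x, precomp T x = y.
Proof.
move=> /lker0P Ti y; exists ((y : 'Hom(V, k^o)) \o T^-1)%VF.
by apply/lfunP => x; rewrite precompE comp_lfunE lker0_lfunK.
Qed.

Lemma precomp_inj V W (T : 'Hom(V, W)) : (forall y, exists x, T x = y) -> injective (precomp T).
Proof.
move=> Ts x y xy; apply/lfunP => w; case: (Ts w) => v <-.
by rewrite -(precompE T x) -(precompE T y) xy.
Qed.

Lemma rank_precomp V (T : 'End(V)) : \dim (limg (precomp T)) = \dim (limg T).
Proof.
pose u : 'Hom(subvs_of (limg T), V) := linfun vsval.
pose q : 'Hom(V, subvs_of (limg T)) := (linfun (vsproj (limg T)) \o T)%VF.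
have uE x : u x = vsval x by rewrite lfunE.
have ui : injective u by move=> x y; rewrite !uE => /subvs_inj.
have uq x : u (q x) = T x by rewrite uE comp_lfunE lfunE /= vsprojK ?memv_img ?memvf.
have qs y : exists x, q x = y.
  by case/memv_imgP: (subvsP y) => x _ yE; exists x; apply: ui; rewrite uq uE.
have -> : limg (precomp T) = (precomp q @: fullv)%VS.
  apply/vspaceP => y; apply/memv_imgP/memv_imgP => [[x _ ->] | [x _ ->]].
    exists (precomp u x); rewrite ?memvf //; apply/lfunP => v.
    by rewrite !precompE uq.
  case: (precomp_surj ui x) => z <-; exists z; rewrite ?memvf //; apply/lfunP => v.
  by rewrite !precompE uq.
have lk : lker (precomp q) = 0%VS by apply/lker_eq0P/precomp_inj.
rewrite limg_dim_eq ?lk ?capv0 // dimvf dim_dualv -dimvf.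
rewrite -(limg_dim_eq (f := u)); last first.
  by have /lker_eq0P -> := ui; rewrite capv0.
congr (\dim _); apply/vspaceP => x; apply/memv_imgP/idP => [[y _ ->] | xT].
  by rewrite uE subvsP.
by exists (vsproj (limg T) x); rewrite ?memvf // uE vsprojK.
Qed.

End DualSpace.

(** * Graded duality between left and right modules *)

Section GradedDual.
Variables (k : fieldType) (A : falgType k) (l : nat) (gr : grading A l).
Notation gomod := (omod k (A + int)%type).
Notation gop := (opposite_grading gr).
Notation grVop := (@grV k (A^c) l gop).
Notation gregop := (@greg k (A^c) l gop).
Notation grV := (grV gr).
Notation greg := (greg gr).
Implicit Types M N X I : gomod.

(** Transposition by itself exchanges left and right actions, so [inl a] is kept; degree [i] of the
    dual is dual to degree [- i]. *)
Definition dualg M : gomod := @OMod k (A + int)%type (dualv M)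
  (fun o => precomp (match o with inl a => act M a | inr i => pj M (- i) end)).

Lemma act_dualE M a (xi : 'Hom(M, k^o)) x :
  (act (dualg M) a xi : 'Hom(M, k^o)) x = xi (act M a x).
Proof. exact: precompE. Qed.

Lemma pj_dualE M i (xi : 'Hom(M, k^o)) x :
  (pj (dualg M) i xi : 'Hom(M, k^o)) x = xi (pj M (- i) x).
Proof. exact: precompE. Qed.

Lemma dual_hom M N (f : 'Hom(M, N)) :
  ohom f -> ohom (precomp f : 'Hom(dualg N, dualg M)).
Proof.
move=> hf o xi; apply/lfunP => x; rewrite /= !precompE.
by case: o => [a|i]; rewrite hf.
Qed.

Lemma dual_ses M N X (i : 'Hom(M, N)) (p : 'Hom(N, X)) : ses i p ->
  ses (precomp p : 'Hom(dualg X, dualg N)) (precomp i : 'Hom(dualg N, dualg M)).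
Proof.
move=> s; split.
- exact: dual_hom (ses_hp s).
- exact: dual_hom (ses_hi s).
- exact: precomp_inj (ses_surj s).
- exact: precomp_surj (ses_inj s).
- by move=> x; apply/lfunP => v; rewrite !precompE (ses_pi s) linear0 zero_lfunE.
move=> xi xi0; exists ((xi : 'Hom(N, k^o)) \o p^-1)%VF; apply/lfunP => x.
rewrite precompE comp_lfunE; apply/eqP; rewrite -subr_eq0 -linearB; apply/eqP.
have : p (x - (p^-1)%VF (p x)) = 0.
  by rewrite linearB /= limg_lfunVK ?memv_img ?memvf ?subrr.
case/(ses_ex s) => y ->; have := precompE i xi y; rewrite xi0 zero_lfunE => E.
exact: esym E.
Qed.

Lemma bidual_hom M : ohom (bidual M : 'Hom(M, dualg (dualg M))).
Proof.
move=> o x; apply/lfunP => xi; rewrite bidualE /= precompE bidualE.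
by case: o => [a|i]; rewrite ?act_dualE ?pj_dualE ?opprK.
Qed.

Fact dual_gradingE M : (exists2 s, uniq s & forall m, \sum_(i <- s) pj M i m = m) ->
  (forall i j m, pj M i (pj M j m) = if i == j then pj M j m else 0) ->
  (exists2 s, uniq s & forall xi, \sum_(i <- s) pj (dualg M) i xi = xi) /\
  forall i j xi, pj (dualg M) i (pj (dualg M) j xi) =
    if i == j then pj (dualg M) j xi else 0.
Proof.
move=> [s us sE] prO; split.
  exists [seq - i | i <- s]; first by rewrite map_inj_uniq //; apply: oppr_inj.
  move=> xi; apply/lfunP => x; rewrite big_map sum_lfunE -[in RHS](sE x) linear_sum.
  by apply: eq_bigr => i _; rewrite pj_dualE opprK.
move=> i j xi; apply/lfunP => x; rewrite !pj_dualE prO eqr_opp eq_sym.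
by case: eqP => [->|_]; rewrite ?pj_dualE ?linear0 ?zero_lfunE.
Qed.

Lemma grV_dual_op M : grVop M -> grV (dualg M).
Proof.
case=> -[M1 MM ML] sE prO prM; have [sE' prO'] := dual_gradingE sE prO; split=> //.
- split=> [xi | a b xi | c a b xi]; apply/lfunP => x.
  + by rewrite act_dualE; congr (fun_of_lfun xi _); apply: M1.
  + rewrite [LHS]act_dualE [RHS]act_dualE act_dualE; congr (fun_of_lfun xi _).
    exact: (MM (b : A^c) (a : A^c)).
  rewrite [LHS]act_dualE add_lfunE scale_lfunE [in RHS]act_dualE [in RHS]act_dualE.
  by rewrite -linearP; congr (fun_of_lfun xi _); apply: ML.
move=> i j a xi aj; apply/lfunP => x.
rewrite pj_dualE !act_dualE pj_dualE; congr (fun_of_lfun xi _).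
have := prM (- (i + j)) j a x aj; rewrite opprD addrNK => <-.
by [].
Qed.

Lemma grV_dual M : grV M -> grVop (dualg M).
Proof.
case=> -[M1 MM ML] sE prO prM; have [sE' prO'] := dual_gradingE sE prO; split=> //.
- split=> [xi | a b xi | c a b xi]; apply/lfunP => x.
  + by rewrite [LHS]act_dualE; congr (fun_of_lfun xi _); apply: M1.
  + rewrite [LHS]act_dualE [RHS]act_dualE act_dualE; congr (fun_of_lfun xi _).
    exact: (MM (b : A) (a : A)).
  rewrite [LHS]act_dualE add_lfunE scale_lfunE [in RHS]act_dualE [in RHS]act_dualE.
  by rewrite -linearP; congr (fun_of_lfun xi _); apply: ML.
move=> i j a xi aj; apply/lfunP => x.
rewrite [LHS]pj_dualE [LHS]act_dualE [RHS]act_dualE pj_dualE; congr (fun_of_lfun xi _).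
have := prM (- (i + j)) j a x aj; rewrite opprD addrNK => <-.
by [].
Qed.

(** A lift along the epimorphism [p] is dual to an extension into [I] along the monomorphism dual to
    [p]; the bidual isomorphisms translate between the two. *)
Lemma oproj_dual I : grVop I -> oinj grVop I -> oproj grV (dualg I).
Proof.
move=> vI Ii; split=> [|X N p f vX hp ps hf]; first exact: grV_dual_op.
have [w [hw wb bw]] := oiso_inv (@bidual_hom I) (@bidual_inj _ I) (@bidual_surj _ I).
pose q : 'Hom(dualg N, I) := (w \o (precomp f : 'Hom(dualg N, dualg (dualg I))))%VF.
have hq : ohom q by apply: ohom_comp => //; apply: dual_hom.
have [g1 hg1 g1E] := Ii (dualg N) (dualg X) (precomp p) (grV_dual vX) (dual_hom hp)
  (precomp_inj ps) q hq.
have [v [hv vb bv]] := oiso_inv (@bidual_hom X) (@bidual_inj _ X) (@bidual_surj _ X).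
exists (v \o (precomp g1 : 'Hom(dualg I, dualg (dualg X))))%VF.
  by apply: ohom_comp => //; apply: dual_hom.
move=> xi; apply: dual_separates => nu; rewrite comp_lfunE -precompE -bidualE bv.
rewrite precompE g1E comp_lfunE -(bidualE _ xi) bw precompE.
by [].
Qed.

(** Dualising an injective resolution of left modules gives a projective resolution of right
    modules. *)
Lemma pdim_dual (R : nat -> gomod) (d : forall n, 'Hom(R n, R n.+1)) M
    (u : 'Hom(M, R 0%N)) D :
  (forall n, grVop (R n) /\ oinj grVop (R n)) -> (forall n, ohom (d n)) -> ohom u ->
  injective u -> (forall x, d 0%N x = 0 <-> exists y, x = u y) ->
  (forall n x, d n.+1 x = 0 <-> exists y, x = d n y) ->
  (forall n, (D <= n)%N -> forall x : R n, x = 0) ->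
  pdim_le grV D (dualg M).
Proof.
elim: D R d M u => [|D IH] R d M u VR hd hu iu u0 dd R0.
  apply: (oproj_eq0 (grV_variety gr)).
  have M0 (x : M) : x = 0 by apply: iu; rewrite (R0 0%N _ (u x)) // linear0.
  rewrite /odim dim_dualv; apply/eqP; rewrite -dimvf dimv_eq0 -subv0.
  by apply/subvP => x _; rewrite (M0 x) mem0v.
have [C [p ep]] := coker_exists hu iu.
have [|u' hu' u'p] := factor_epi (ses_hp ep) (ses_surj ep) (hd 0%N).
  by move=> x /(ses_ex ep) ex; apply/u0.
exists (dualg C), (dualg (R 0%N)), (precomp p), (precomp u); split.
  by split; [apply: oproj_dual; case: (VR 0%N) | apply: dual_ses].
apply: (IH (fun n => R n.+1) (fun n => d n.+1) C u') => //.
- move=> x y /eqP; rewrite -subr_eq0 -linearB => /eqP exy.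
  apply/eqP; rewrite -subr_eq0; apply/eqP; move: exy.
  case: (ses_surj ep (x - y)) => z <-; rewrite /= u'p => /u0[w ->].
  exact: ses_pi ep _.
- move=> x; split=> [/dd[y ->] | [c ->]]; first by exists (p y); rewrite u'p.
  by case: (ses_surj ep c) => y <-; rewrite u'p; apply/dd; exists y.
by move=> m Dm; apply: R0.
Qed.

Definition coreg : gomod := dualg gregop.

(** This is where finite injective dimension of [A] as a left module enters: its dual, the injective
    cogenerator D(A), gets finite projective dimension. *)
Lemma pdim_coreg : finite_gr_injdim (gr_regular gop) -> exists n, pdim_le grV n coreg.
Proof.
case=> D [R [d [u [Ri [hd hu] [u0 ud] dd R0]]]]; exists D.+1.
apply: (@pdim_dual (fun n => gom (R n)) d gregop u).
- by move=> n; split; [exact: gom_grV | exact: (proj1 (@gr_injective_oinj _ _ _ gop _) (Ri n))].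
- by move=> n; exact: (proj1 (@gr_hom_ohom _ _ _ gop _ _ (d n)) (hd n)).
- exact: (proj1 (@gr_hom_ohom _ _ _ gop _ _ u) hu).
- exact/lker_eq0P.
- move=> x; have := memv_ker (d 0%N) x; rewrite -ud => E; split=> [ex | [y xE]].
    have /memv_imgP[y _ ->] : x \in limg u by rewrite E ex.
    by exists y.
  by apply/eqP; rewrite -E xE memv_img ?memvf.
- move=> a x; have := memv_ker (d a.+1) x; rewrite -dd => E; split=> [ex | [y xE]].
    have /memv_imgP[y _ ->] : x \in limg (d a) by rewrite E ex.
    by exists y.
  by apply/eqP; rewrite -E xE memv_img ?memvf.
by move=> n /R0 Rn x; apply/eqP; rewrite -memv0 -Rn memvf.
Qed.

End GradedDual.

(** * The injectives I_j and their multiplicities *)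

Section InjectiveHulls.
Variables (k : fieldType) (A : falgType k) (l : nat) (gr : grading A l).
Notation gomod := (omod k (A + int)%type).
Notation gop := (opposite_grading gr).
Notation gregop := (@greg k (A^c) l gop).
Notation grV := (grV gr).
Notation greg := (greg gr).
Notation B := (subvs_of (degree0 gr)).
Variables (r : nat) (S : 'I_r -> omod k B) (e : 'I_r -> B).
Hypothesis sd : simple_data S e.

Let gV := grV_variety gr.
Let gC := grV_covering gr.

Lemma pj_gregop_deg t (x : A) : x \in gr t -> pj gregop t x = x.
Proof. by move=> xt; have [H _] := @greg_degP _ _ _ gop t x; apply: H. Qed.

Lemma pj_gregop i (x : A) : pj gregop i x = pj greg i x.
Proof.
have [_ [s us sE] prO _] := greg_grV gr.
have [_ _ qrO _] := greg_grV gop.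
have L (f : 'End(A)) : f x = \sum_(t <- s) f (pj greg t x).
  by rewrite -[in LHS](sE x) linear_sum.
apply: (etrans (L (pj gregop i))); apply: (etrans _ (esym (L (pj greg i)))).
apply: eq_bigr => t _.
have E := pj_gregop_deg (greg_pj_deg gr t x).
by rewrite prO -E qrO.
Qed.

Lemma act_gregop (a x : A) : act gregop a x = a * x.
Proof. exact: (@greg_act _ _ _ gop a x). Qed.

Let amulr_e (j : 'I_r) : 'End(A) := amulr (vsval (e j)).

Definition rmul (j : 'I_r) : 'End(ocar gregop) := amulr_e j.

Lemma rmulE j (x : A) : rmul j x = x * vsval (e j).
Proof.
have E : amulr_e j x = x * vsval (e j) by rewrite /amulr_e lfunE.
exact: E.
Qed.

Lemma rmul_hom j : ohom (rmul j : 'Hom(gregop, gregop)).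
Proof.
apply/ohomE; split=> [a m | i m].
  by rewrite !rmulE !act_gregop mulrA.
rewrite !rmulE !pj_gregop.
have [_ _ _ prM] := greg_grV gr.
have := prM i 0 _ m (e_deg0 e j).
by rewrite addr0 !greg_act.
Qed.

(** The transpose of right multiplication by e_j on the left module [A]; its image is I_j = D(A
    e_j). *)
Definition coreg_idem j : 'End(ocar (coreg gr)) := precomp (rmul j).

Lemma inj_hull_exists : exists Ij : 'I_r -> gomod,
  forall j, idem_image (Ij j) (coreg_idem j).
Proof.
suff /choice[I H] : forall j, exists I, @idem_image _ _ (coreg gr) I (coreg_idem j) by exists I.
move=> j; apply: idem_image_exists => [|xi]; first exact: dual_hom (rmul_hom j).
apply/lfunP => x; rewrite !precompE !rmulE -mulrA.
by rewrite (e_idem sd).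
Qed.

Variable Pj : 'I_r -> gomod.
Hypothesis PjP : forall j, idem_image (Pj j) (lmul e j).
Variable Ij : 'I_r -> gomod.
Hypothesis IjP : forall j, idem_image (Ij j) (coreg_idem j).

Lemma coreg_grV : grV (coreg gr).
Proof. by apply: grV_dual_op; exact: (greg_grV gop). Qed.

Lemma Ij_grV j : grV (Ij j).
Proof.
have [p [u [hp hu up pu]]] := IjP j.
exact: (var_sub gV hu (can_inj pu) coreg_grV).
Qed.

(** Both sides are the dimension of e_j' A_(-s) e_j, since a transpose has the same rank. *)
Lemma dd_Ij j s j' : dd e (Ij j) s j' = dd e (Pj j') (- s) j.
Proof.
have [p [u [hp hu up pu]]] := IjP j.
rewrite (dd_Pj PjP).
pose T := (act (coreg gr) (vsval (e j')) \o pj (coreg gr) s)%VF.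
transitivity (\dim (limg (T \o coreg_idem j)%VF)).
  apply: (idem_image_rank (u := u) (p := p)) => // y.
  by have [ua upj] := (ohomE _).1 hu; rewrite !comp_lfunE ua upj.
pose U : 'End(ocar gregop) := (rmul j \o pj gregop (- s) \o act gregop (vsval (e j')))%VF.
have -> : (T \o coreg_idem j)%VF = precomp U.
  apply/lfunP => xi; apply/lfunP => x.
  by rewrite !comp_lfunE act_dualE pj_dualE precompE precompE /U !comp_lfunE.
rewrite rank_precomp; congr (\dim (limg _)).
Qed.

Lemma pdim_shift n M i : pdim_le grV n M -> pdim_le grV n (gshift M i).
Proof.
elim: n M => [|n IH] M /=; first exact: oproj_shift.
case=> K [P [u [p [[pP s] dK]]]].
exists (gshift K i), (gshift P i), u, p; split; last exact: IH.
by split; [apply: oproj_shift | apply: ses_shift].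
Qed.

Lemma Ij_pdim : finite_gr_injdim (gr_regular gop) ->
  exists n, forall j i, pdim_le grV n (gshift (Ij j) i).
Proof.
case/pdim_coreg => n cn; exists n => j i; apply: pdim_shift.
exact: (pdim_le_retract gV gC coreg_grV (idem_image_retract (IjP j))).
Qed.

Lemma dd_Pj_out j s j' : (s < 0) || (l%:Z < s) -> dd e (Pj j) s j' = 0%N.
Proof.
move=> so; rewrite (dd_Pj PjP); apply/eqP; rewrite dimv_eq0 -subv0.
apply/subvP => _ /memv_imgP[x _ ->].
by rewrite !comp_lfunE greg_out // linear0 mem0v.
Qed.

Definition inj_cartan (s : int) : 'M[int]_r := \matrix_(j, j') (mult S e (Ij j) (- s) j')%:Z.

(** By [dd_Ij] this matrix is the transpose of the Cartan matrix, conjugated by the diagonal matrix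
    of the [simp_dim]. Cancelling the nonzero determinant of the latter, the two determinants
    agree. *)
Lemma inj_cartan0_unit : finite_gldim B -> inj_cartan 0 \in unitmx.
Proof.
move=> /(cartan0_unit sd PjP) uC.
have vP j : grV (Pj j) by apply: (grV_unshift (n := 0)); exact: (Pj_oproj PjP j 0).1.
pose d : 'rV[int]_r := \row_j (simp_dim S e j)%:Z.
have E : inj_cartan 0 *m diag_mx d = diag_mx d *m (cartan S e Pj 0)^T.
  apply/matrixP => j j'; rewrite mul_mx_diag mul_diag_mx !mxE -!PoszM; congr Posz.
  rewrite oppr0 mult_dd //; last exact: Ij_grV.
  by rewrite mulnC mult_dd // dd_Ij oppr0.
have d0 : \det (diag_mx d) != 0.
  rewrite det_diag; apply/prodf_neq0 => j _; rewrite mxE eqz_nat -lt0n.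
  exact: simp_dim_gt0.
have := congr1 determinant E; rewrite !det_mulmx det_tr mulrC => /(mulfI d0) D.
by rewrite unitmxE D -unitmxE.
Qed.

End InjectiveHulls.

(** * Generators and torsion of the Grothendieck group *)

Section AbelianGroups.
Variable G : zmodType.

Definition comb n (g : 'I_n -> G) (v : 'rV[int]_n) := \sum_i g i *~ v 0 i.

Lemma combB n (g : 'I_n -> G) : {morph comb g : u v / u - v}.
Proof.
move=> u v; rewrite /comb -sumrB; apply: eq_bigr => i _.
by rewrite !mxE mulrzBr.
Qed.

Lemma comb_delta n (g : 'I_n -> G) i : comb g (delta_mx 0 i) = g i.
Proof.
rewrite /comb (bigD1 i) //= mxE !eqxx mulr1z big1 ?addr0 // => j /negPf ji.
by rewrite mxE eqxx ji mulr0z.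
Qed.

Lemma comb_mul n m (g : 'I_n -> G) (v : 'rV_m) (R : 'M_(m, n)) :
  comb g (v *m R) = comb (fun i => comb g (row i R)) v.
Proof.
rewrite /comb.
under eq_bigr do rewrite mxE mulrz_sumr.
rewrite exchange_big; apply: eq_bigr => i _.
rewrite mulrz_suml; apply: eq_bigr => j _.
by rewrite mxE mulrC mulrzA.
Qed.

(* By the Smith normal form of the relation [v], a change of generators turns  *)
(* it into [c g_0 = 0], and [g_0] is redundant as there is no torsion.         *)
Lemma generators_drop n (g : 'I_n.+1 -> G) (v : 'rV_n.+1) :
  (forall (x : G) c, c != 0 -> x *~ c = 0 -> x = 0) ->
  (forall x, exists u, x = comb g u) -> v != 0 -> comb g v = 0 ->
  exists g' : 'I_n -> G, forall x, exists u, x = comb g' u.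
Proof.
move=> tf gen v0 gv.
have [L uL [R uR [d _ vE]]] := int_Smith_normal_form v.
pose D : 'rV[int]_n.+1 := \matrix_(i, j) (d`_i *+ (i == j :> nat)).
pose g1 i := comb g (row i R).
(* [L] is a 1 by 1 matrix, and only the first entry of [D] can be nonzero. *)
pose c := L 0 0 * d`_0.
have LD : L *m D = c *: delta_mx 0 0.
  apply/rowP => j; rewrite !mxE big_ord1 !mxE eqxx /= /c mulrnAr.
  by rewrite eq_sym -val_eqE /= mulr1 mulrnAr.
have c0 : c != 0.
  by apply: contraNneq v0 => c0; rewrite vE -/D LD c0 scale0r mul0mx.
have g10 : g1 0 = 0.
  apply: (tf _ _ c0); rewrite -[RHS]gv vE -/D LD comb_mul -/g1.
  rewrite /comb (bigD1 0) //= !mxE mulr1 big1 ?addr0 // => j /negPf j0.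
  by rewrite !mxE j0 mulr0 mulr0z.
exists (fun i : 'I_n => g1 (fintype.lift ord0 i)) => x.
have [u ->] := gen x; exists (\row_i (u *m invmx R) 0 (fintype.lift ord0 i)).
rewrite -{1}[u](mulmxKV uR) comb_mul -/g1 {1}/comb big_ord_recl g10 mul0rz add0r.
by rewrite /comb; apply: eq_bigr => i _; rewrite [in RHS]mxE.
Qed.

(** Generators satisfying no nontrivial relation form a basis; otherwise one of them is dropped, by
    [generators_drop]. *)
Lemma torsion_free_basis n (g : 'I_n -> G) :
  (forall (x : G) c, c != 0 -> x *~ c = 0 -> x = 0) ->
  (forall x, exists u, x = comb g u) ->
  exists m (b : 'I_m -> G), is_basis b /\ (m <= n)%N.
Proof.
move=> tf; elim: n g => [|n IH] g gen.
  exists 0%N, g; split=> // x; have [u ->] := gen x.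
  exists [ffun i => u 0 i]; split; first by rewrite /comb; apply: eq_bigr => i _; rewrite ffunE.
  by move=> c _; apply/ffunP => -[].
have [[v v0 gv]|free] := pselect (exists2 v, v != 0 & comb g v = 0).
  have [g' gen'] := generators_drop tf gen v0 gv.
  by have [m [b [bB mn]]] := IH g' gen'; exists m, b; split=> //; apply: leqW.
exists n.+1, g; split=> // x; have [u xE] := gen x.
exists [ffun i => u 0 i]; split.
  by rewrite xE /comb; apply: eq_bigr => i _; rewrite ffunE.
move=> c xc; apply/ffunP => i; rewrite ffunE.
have [w0|w0] := eqVneq (u - \row_j c j) 0.
  by move/rowP/(_ i)/eqP: w0; rewrite !mxE subr_eq0 => /eqP.
case: free; exists (u - \row_j c j) => //; rewrite combB -xE {1}xc.
apply/eqP; rewrite subr_eq0 /comb; apply/eqP.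
by apply: eq_bigr => j _; rewrite mxE.
Qed.

End AbelianGroups.

Lemma freeg_zmod_ind (K : choiceType) (P : {freeg K / int} -> Prop) :
  P 0 -> (forall x y, P x -> P y -> P (x - y)) -> (forall z, P << z >>) ->
  forall D, P D.
Proof.
move=> P0 PB PU D.
have PN x : P x -> P (- x) by rewrite -[- x]add0r; apply: PB.
have PD x y : P x -> P y -> P (x + y).
  by move=> Px Py; rewrite -[y]opprK; apply/PB/PN.
have Pn x n : P x -> P (x *+ n).
  by move=> Px; elim: n => [|n IH]; rewrite ?mulr0n // mulrS; apply: PD.
have Pz x m : P x -> P (x *~ m).
  by case: m => n Px; [apply: Pn | apply: PN; apply: Pn].
rewrite -[D]freeg_sumE; elim/big_rec: _ => // z x _ Px; apply: PD => //.
by rewrite -[coeff z D]intz -freegU_mulz; apply: Pz.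
Qed.

Lemma coeff_mulrz (K : choiceType) z (x : {freeg K / int}) n :
  coeff z (x *~ n) = coeff z x * n.
Proof. by rewrite raddfMz /= mulrzz. Qed.

HB.instance Definition _ (R : nzRingType) (M : lmodType R) (K : choiceType) (f : K -> M) :=
  GRing.isZmodMorphism.Build {freeg K / R} M (fglift f) (lift_is_additive f).

(** * Purity of the projective classes, and generators of K_0 *)

Section Assembly.
Variables (k : fieldType) (A : falgType k) (l : nat) (gr : grading A l).
Notation gomod := (omod k (A + int)%type).
Notation grV := (grV gr).
Notation B := (subvs_of (degree0 gr)).
Variables (r : nat) (S : 'I_r -> omod k B) (e : 'I_r -> B).
Hypothesis sd : simple_data S e.
Hypothesis gldimB : finite_gldim B.
Notation F := {freeg (int * 'I_r) / int}.
Notation cl := (cl (gr := gr) S e).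
Notation mult := (mult (gr := gr) S e).

Let gV := grV_variety gr.

Variable Pj : 'I_r -> gomod.
Hypothesis PjP : forall j, idem_image (X := greg gr) (Pj j) (lmul e j).

Let Pj_grV j : grV (Pj j).
Proof. by apply: (grV_unshift (n := 0)); exact: (Pj_oproj PjP j 0).1. Qed.

Lemma mult_shift X n i j : mult (gshift X n) i j = mult X (i - n) j.
Proof. by rewrite /mult /dd dgr_shift. Qed.

(** Its image is the subgroup spanned by the classes of projectives, by [cl_projective]. *)
Definition cartan_map : F -> F := fglift (fun z => cl (gshift (Pj z.2) z.1) : F).

Lemma cartan_mapU z : cartan_map << z >> = cl (gshift (Pj z.2) z.1).
Proof. by rewrite /cartan_map liftU scale1r. Qed.

Lemma cartan_mapB : {morph cartan_map : x y / x - y}.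
Proof. exact: raddfB. Qed.

Lemma cartan_mapD : {morph cartan_map : x y / x + y}.
Proof. exact: raddfD. Qed.

Lemma cartan_map0 : cartan_map 0 = 0.
Proof. exact: raddf0. Qed.

Lemma cartan_mapMz n : {morph cartan_map : x / x *~ n}.
Proof. exact: raddfMz. Qed.

Lemma cl_projective P : oproj grV P -> exists w, cl P = cartan_map w.
Proof.
move: P; apply: (krull_schmidt sd PjP) => [Q vQ Q0 | K Q j i u p vQ s [w Kw]].
  exists 0; rewrite cartan_map0; apply: freeg_eq => i j.
  by rewrite clE // coeff0 /mult dd_0 // div0n.
exists (w + << (i, j) >>); rewrite (cl_ses sd vQ s) Kw cartan_mapD.
by rewrite cartan_mapU.
Qed.

Lemma mult_Pj_out j s j' : (s < 0) || (l%:Z < s) -> mult (Pj j) s j' = 0%N.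
Proof. by move=> so; rewrite /mult (dd_Pj_out PjP) // div0n. Qed.

(** In generating series notation, [cartan_map] is multiplication by the matrix polynomial with
    coefficients [cartan 0] to [cartan l]. *)
Lemma cartan_mapE w i j' : coeff (i, j') (cartan_map w) =
  \sum_(s < l.+1) \sum_j cartan S e Pj s%:Z j j' * coeff (i - s%:Z, j) w.
Proof.
move: w; apply: freeg_zmod_ind => [|x y Hx Hy|[t j0]].
- rewrite cartan_map0 coeff0 big1 // => s _.
  by rewrite big1 // => j _; rewrite coeff0 mulr0.
- rewrite cartan_mapB coeffB Hx Hy -sumrB; apply: eq_bigr => s _.
  by rewrite -sumrB; apply: eq_bigr => j _; rewrite coeffB mulrBr.
rewrite cartan_mapU clE; last exact: (Pj_oproj PjP j0 t).1.
rewrite mult_shift /=.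
have E (s : 'I_l.+1) : \sum_j cartan S e Pj s%:Z j j' * coeff (i - s%:Z, j) << (t, j0) >> =
    (mult (Pj j0) s%:Z j')%:Z * (t == i - s%:Z)%:R.
  rewrite (bigD1 j0) //= big1 ?addr0 => [|j /negPf jj].
    by rewrite coeffU mul1r xpair_eqE eqxx andbT mxE.
  by rewrite coeffU mul1r xpair_eqE [j0 == j]eq_sym jj andbF mulr0.
rewrite (eq_bigr _ (fun s _ => E s)).
have [io|ii] := boolP ((i - t < 0) || (l%:Z < i - t)).
  rewrite mult_Pj_out // big1 // => s _.
  have /negPf-> : t != i - s%:Z by apply/eqP => ts; have := ltn_ord s; lia.
  by rewrite mulr0.
have sl : (`|i - t| < l.+1)%N by lia.
have sE : (`|i - t|)%:Z = i - t by lia.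
rewrite (bigD1 (Ordinal sl)) //= big1 ?addr0 => [|s /negPf ss].
  rewrite sE; have -> : i - (i - t) = t by lia.
  by rewrite eqxx mulr1.
rewrite (_ : (t == _) = false) ?mulr0 //; apply/eqP => ts.
by move/eqP: ss; apply; apply: val_inj => /=; lia.
Qed.

Lemma dvdz_freeg (n : int) (w : F) : n != 0 -> (forall z, (n %| coeff z w)%Z) ->
  exists w', w = w' *~ n.
Proof.
move=> n0 nw; exists (\sum_(z <- dom w) << (coeff z w %/ n)%Z *g z >>).
rewrite -[LHS]freeg_sumE mulrz_suml; apply: eq_bigr => z _.
by rewrite freeg_mulz mulrzz divzK.
Qed.

Lemma dvdz_unitmx m (n : int) (v : 'rV_m) (M : 'M_m) : M \in unitmx ->
  (forall j, (n %| (v *m M) ord0 j)%Z) -> forall j, (n %| v ord0 j)%Z.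
Proof.
move=> uM nv j; rewrite -[v](mulmxK uM) mxE.
by apply: rpred_sum => i _; rewrite mulrC; apply: dvdz_mull; apply: nv.
Qed.

(* Induction on the degree: the component of [cartan_map w] in degree i is the *)
(* product of that of [w] with [cartan 0] plus terms in lower degrees of [w].  *)
Lemma cartan_map_pure (D w : F) (n : int) : n != 0 -> D *~ n = cartan_map w ->
  exists w', D = cartan_map w'.
Proof.
move=> n0 Dw.
have nC i j' : (n %| \sum_(s < l.+1) \sum_j cartan S e Pj s%:Z j j' * coeff (i - s%:Z, j) w)%Z.
  by rewrite -cartan_mapE -Dw coeff_mulrz dvdz_mull.
(* [w] has no terms in degrees below [- N], where the induction on the degree starts. *)
pose N := (\sum_(z <- dom w) `|z.1|)%N.
have nw m i j : i < m%:Z - N%:Z -> (n %| coeff (i, j) w)%Z.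
  elim: m i j => [|m IH] i j im.
    rewrite coeff_outdom ?dvdz0 //; apply/negP => iw.
    have : (`|i| <= N)%N by rewrite /N (bigD1_seq _ iw) ?uniq_dom //= leq_addr.
    lia.
  move: j; pose v : 'rV[int]_r := \row_j coeff (i, j) w.
  have nv : forall j, (n %| v ord0 j)%Z.
    apply: (dvdz_unitmx (cartan0_unit sd PjP gldimB)) => j'.
    have := nC i j'; rewrite big_ord_recl rpredDr.
      rewrite subr0 mxE; congr (_ %| _)%Z.
      by apply: eq_bigr => j _; rewrite [v _ _]mxE mulrC.
    apply: rpred_sum => s _; apply: rpred_sum => j _; apply: dvdz_mull.
    by apply: IH; rewrite /= /bump /=; lia.
  by move=> j; have := nv j; rewrite mxE.
have [[i j]|w' wE] := @dvdz_freeg n w n0.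
  by apply: (nw (`|i| + N).+1); lia.
exists w'; apply: freeg_eq => i j; apply: (mulIf n0).
have := congr1 (coeff (i, j)) Dw.
by rewrite wE cartan_mapMz !coeff_mulrz.
Qed.


Variable psi : gomod -> K0 gr.
Hypothesis sa : stably_additive grV (fun=> True) psi.

(** [zmodule] views K_0 as a module over the integers, as [fglift] requires. *)
Let psiZ : gomod -> zmodule (K0 gr) := psi.

Definition simple_lift : F -> zmodule (K0 gr) := fglift (fun z => psiZ (grS S z.2 z.1)).

Lemma simple_liftB : {morph simple_lift : x y / x - y}.
Proof. exact: raddfB. Qed.

Lemma simple_lift_sum I (s : seq I) (f : I -> F) :
  simple_lift (\sum_(i <- s) f i) = \sum_(i <- s) simple_lift (f i).
Proof. exact: raddf_sum. Qed.

Lemma simple_lift0 : simple_lift 0 = 0.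
Proof. exact: raddf0. Qed.

Lemma simple_liftU c j i : simple_lift << c *g (i, j) >> = psi (grS S j i) *~ c.
Proof. by rewrite /simple_lift liftU. Qed.

Lemma simple_lift_cl X : grV X -> simple_lift (cl X) = psi X.
Proof.
apply: (cl_additive_lift sd) => [Y Y' Z f g vY s | Y _ Y0].
  by have [] := sa_ext sa vY s I I.
by have [] := sa_proj sa (oproj_eq0 gV Y0).
Qed.

Lemma simple_lift_cartan_map w : simple_lift (cartan_map w) = 0.
Proof.
move: w; apply: freeg_zmod_ind => [|x y Hx Hy|[i j]].
- by rewrite cartan_map0 simple_lift0.
- by rewrite cartan_mapB simple_liftB Hx Hy subrr.
have pP := Pj_oproj PjP j i.
rewrite cartan_mapU simple_lift_cl; last exact: pP.1.
by have [] := sa_proj sa pP.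
Qed.

Hypothesis psi_cls : forall X, grV X -> gCM X -> psi X = cls gr X.

Let phi : free_K0 gr -> F := K0_lift (G := F : lmodType int) cl.

(** On Cohen-Macaulay modules [psi] is the tautological class, and by additivity it depends only on
    multiplicities; hence multiplicities determine the class in K_0. *)
Lemma kpi_simple_lift x : kpi x = simple_lift (phi x).
Proof.
move: x; apply: freeg_zmod_ind => [|x y Hx Hy|c].
- by rewrite kpi0 -[X in phi X](subrr 0) /phi K0_liftB subrr simple_lift0.
- by rewrite kpiD kpiN Hx Hy /phi K0_liftB simple_liftB.
rewrite -[<< c >>]/(gen c) /phi K0_lift_gen simple_lift_cl; last exact: gom_grV.
rewrite psi_cls; [|exact: gom_grV|exact: gom_CM].
exact/esym/cls_coord/oiso_refl.
Qed.

(** Some lift of [x] has multiplicities that fall in the image of [cartan_map] after multiplication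
    by [n]. By purity they already lie there, and [simple_lift] vanishes on that image. *)
Lemma K0_torsion_free (x : K0 gr) n : n != 0 -> x *~ n = 0 -> x = 0.
Proof.
move=> n0; have [y <-] := kpi_surj x => yn.
pose H : {pred F} := fun D => `[< exists w, D = cartan_map w >].
have cH : zmod_closed H.
  split=> [|u v /asboolP[u' ->] /asboolP[v' ->]]; apply/asboolP.
    by exists 0; rewrite cartan_map0.
  by exists (u' - v'); rewrite cartan_mapB.
have kpiMz m : kpi (y *~ m) = kpi y *~ m.
  have kpiMn p : kpi (y *+ p) = kpi y *+ p.
    by elim: p => [|p IH]; rewrite ?kpi0 // !mulrS kpiD IH.
  by case: m => p; rewrite /intmul ?kpiN kpiMn.
have phiMz m : phi (y *~ m) = phi y *~ m by exact: raddfMz.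
have /asboolP[w] : phi (y *~ n) \in H.
  apply: (K0_lift_relations _ cH) => [X Y Z i p vY s | P /cl_projective Pw | ].
  - exact: (cl_ses sd vY s).
  - exact/asboolP.
  - by rewrite kpiMz.
rewrite phiMz => /(cartan_map_pure n0)[w' phiE].
by rewrite kpi_simple_lift phiE simple_lift_cartan_map.
Qed.

Lemma psi_window (tau : 'I_l.+1 -> int) X : injective tau -> grV X ->
  (forall t j, (forall s, t != tau s) -> mult X t j = 0%N) ->
  psi X = \sum_s \sum_j psi (grS S j (tau s)) *~ (mult X (tau s) j)%:Z.
Proof.
move=> ti vX Xo; rewrite -(simple_lift_cl vX).
have -> : cl X = \sum_s \sum_j << (mult X (tau s) j)%:Z *g (tau s, j) >>.
  apply: freeg_eq => t j; rewrite clE // raddf_sum /=.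
  have E s : coeff (t, j) (\sum_j' << (mult X (tau s) j')%:Z *g (tau s, j') >>) =
      (mult X (tau s) j)%:Z * (tau s == t)%:R.
    rewrite raddf_sum (bigD1 j) //= big1 ?addr0 => [|j' /negPf jj].
      by rewrite coeffU xpair_eqE eqxx andbT.
    by rewrite coeffU xpair_eqE jj andbF mulr0.
  rewrite (eq_bigr _ (fun s _ => E s)).
  have [[s <-]|no] := pselect (exists s, tau s = t).
    rewrite (bigD1 s) //= eqxx mulr1 big1 ?addr0 // => s' /negPf ss.
    by rewrite (inj_eq ti) ss mulr0.
  have nt s : tau s != t by apply/eqP => st; case: no; exists s.
  rewrite Xo => [|s]; last by rewrite eq_sym.
  by rewrite big1 // => s _; rewrite (negPf (nt s)) mulr0.
rewrite simple_lift_sum; apply: eq_bigr => s _.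
by rewrite simple_lift_sum; apply: eq_bigr => j _; rewrite simple_liftU.
Qed.

(** [tau] lists the degrees the modules [X j] may occupy, with [tau ord0] the one to eliminate. The
    relations [psi (X j) = 0] form a linear system for the classes in that degree, whose matrix is
    invertible over the integers. *)
Lemma window_step (H : zmodClosed (K0 gr)) (tau : 'I_l.+1 -> int)
    (X : 'I_r -> gomod) (M : 'M[int]_r) : injective tau -> M \in unitmx ->
  (forall j, grV (X j)) -> (forall j, psi (X j) = 0) ->
  (forall j t j', (forall s, t != tau s) -> mult (X j) t j' = 0%N) ->
  (forall j j', M j j' = (mult (X j) (tau ord0) j')%:Z) ->
  (forall s j, s != ord0 -> psi (grS S j (tau s)) \in H) ->
  forall j, psi (grS S j (tau ord0)) \in H.
Proof.
move=> ti uM vX X0 Xo ME Hs j.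
have HM i : \sum_j' psi (grS S j' (tau ord0)) *~ M i j' \in H.
  have := psi_window ti (vX i) (Xo i); rewrite X0 big_ord_recl /= => /esym/eqP.
  rewrite addr_eq0 => /eqP E.
  under eq_bigr do rewrite ME.
  rewrite E rpredN; apply: rpred_sum => s _; apply: rpred_sum => j' _.
  by apply: rpredMz; apply: Hs.
have -> : psi (grS S j (tau ord0)) =
    \sum_i (\sum_j' psi (grS S j' (tau ord0)) *~ M i j') *~ invmx M j i.
  under eq_bigr do rewrite mulrz_suml.
  rewrite exchange_big (bigD1 j) //= [X in _ + X]big1 ?addr0 => [|j' /negPf jj].
    rewrite -[LHS]mulr1z; under eq_bigr do rewrite -mulrzA mulrC.
    by rewrite -mulrz_sumr; have /matrixP/(_ j j) := mulVmx uM; rewrite !mxE eqxx => ->.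
  under eq_bigr do rewrite -mulrzA mulrC.
  rewrite -mulrz_sumr; have /matrixP/(_ j j') := mulVmx uM.
  by rewrite !mxE eq_sym jj => ->.
by apply: rpred_sum => i _; apply: rpredMz.
Qed.

Variable Ij : 'I_r -> gomod.
Hypothesis IjP : forall j, idem_image (X := coreg gr) (Ij j) (coreg_idem e j).
Hypothesis opid : finite_gr_injdim (gr_regular (opposite_grading gr)).

(** The injectives I_j(i) express degree i through the [l] degrees below it, which gives all i >= 0
    from the window; the projectives P_j(i) use the [l] degrees above, which then gives the negative
    degrees. *)
Lemma psi_simples_closed (H : zmodClosed (K0 gr)) :
  (forall (i : int) j, 0 <= i < l%:Z -> psi (grS S j i) \in H) ->
  forall i j, psi (grS S j i) \in H.
Proof.
move=> Hw.
have Hup n (i : int) j : 0 <= i < l%:Z + n%:Z -> psi (grS S j i) \in H.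
  elim: n i j => [|n IH] i j ib; first by apply: Hw; lia.
  have [/IH//|ni] := boolP (0 <= i < l%:Z + n%:Z).
  pose tau (s : 'I_l.+1) : int := i - s%:Z.
  have tau0 : tau ord0 = i by rewrite /tau subr0.
  have ti : injective tau by move=> s s' /addrI/oppr_inj[]; apply: val_inj.
  rewrite -tau0; move: j.
  apply: (window_step (X := fun j => gshift (Ij j) i) ti
    (inj_cartan0_unit sd PjP IjP gldimB)) => [j|j|j t j' tn|j j'|s j s0].
  - exact/grV_shift/Ij_grV.
  - have [n0 Ipd] := Ij_pdim IjP opid.
    by apply: (pdim_additive_eq0 gV sa _ (Ipd j i)); apply/grV_shift/Ij_grV.
  - rewrite mult_shift /mult (dd_Ij PjP IjP) (dd_Pj_out PjP) ?div0n //.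
    apply: contraT => tb; have sl : (`|i - t| < l.+1)%N by lia.
    by have /eqP[] := tn (Ordinal sl); rewrite /tau /=; lia.
  - by rewrite mxE mult_shift tau0 subrr oppr0.
  - have : (0 < s)%N by rewrite lt0n.
    by move=> sp; have := ltn_ord s; rewrite /tau => sl; apply: IH; lia.
have Hdown n (i : int) j : - n%:Z <= i -> psi (grS S j i) \in H.
  elim: n i j => [|n IH] i j ib; first by apply: (Hup (`|i|).+1); lia.
  have [/IH//|ni] := boolP (- n%:Z <= i).
  pose tau (s : 'I_l.+1) : int := i + s%:Z.
  have tau0 : tau ord0 = i by rewrite /tau addr0.
  have ti : injective tau by move=> s s' /addrI[]; apply: val_inj.
  rewrite -tau0; move: j.
  apply: (window_step (X := fun j => gshift (Pj j) i) ti
    (cartan0_unit sd PjP gldimB)) => [j|j|j t j' tn|j j'|s j s0].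
  - exact/grV_shift/Pj_grV.
  - by have [] := sa_proj sa (Pj_oproj PjP j i).
  - rewrite mult_shift mult_Pj_out //.
    apply: contraT => tb; have sl : (`|t - i| < l.+1)%N by lia.
    by have /eqP[] := tn (Ordinal sl); rewrite /tau /=; lia.
  - by rewrite mxE mult_shift tau0 subrr.
  - have : (0 < s)%N by rewrite lt0n.
    by move=> sp; apply: IH; rewrite /tau; lia.
by move=> i j; apply: (Hdown `|i|%N); lia.
Qed.

Lemma K0_generators : exists g : 'I_(l * r) -> K0 gr, forall x, exists u, x = comb g u.
Proof.
pose T := ('I_l * 'I_r)%type.
have cT : #|{: T}| = (l * r)%N by rewrite card_prod !card_ord.
pose g (i : 'I_(l * r)) := let z : T := enum_val (cast_ord (esym cT) i) in psi (grS S z.2 z.1%:Z).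
exists g.
pose H0 : {pred K0 gr} := fun x => `[< exists u, x = comb g u >].
have cH0 : zmod_closed H0.
  split=> [|x y /asboolP[u ->] /asboolP[v ->]]; apply/asboolP.
    by exists 0; rewrite -[X in comb g X](subrr 0) combB subrr.
  by exists (u - v); rewrite combB.
pose mH := GRing.isZmodClosed.Build _ _ cH0.
pose H : zmodClosed (K0 gr) := HB.pack H0 mH.
have Hs : forall i j, psi (grS S j i) \in H.
  apply: psi_simples_closed => i j /andP[i0 il].
  have il' : (`|i| < l)%N by lia.
  apply/asboolP; exists (delta_mx 0 (cast_ord cT (enum_rank (Ordinal il', j)))).
  by rewrite comb_delta /g cast_ordK enum_rankK /= gez0_abs.
move=> x; have [y <-] := kpi_surj x; rewrite kpi_simple_lift; apply/asboolP.
rewrite -[X in is_true X]/(simple_lift (phi y) \in H).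
move: (phi y); apply: freeg_zmod_ind => [|u v Hu Hv|[i j]].
- by rewrite simple_lift0; exact: (rpred0 H).
- by rewrite simple_liftB; exact: (rpredB Hu Hv).
by rewrite simple_liftU mulr1z.
Qed.

End Assembly.

Theorem theorem1p1 (k : fieldType) (A : falgType k) (l : nat)
  (gr : grading A l) (r : nat) :
  iwanaga_gorenstein gr ->
  finite_gldim (subvs_of (degree0 gr)) ->
  has_num_simples (subvs_of (degree0 gr)) r ->
  exists (n : nat) (b : 'I_n -> K0 gr), is_basis b /\ (n <= l * r)%N.
Proof.
case=> _ _ gid opid gldim /simple_data_exists[S [e sd]].
have [psi [sa psi_cls]] := psi_exists gid.
have [Pj PjP] := proj_cover_exists sd; have [Ij IjP] := inj_hull_exists sd.
have [g gen] := K0_generators sd gldim PjP sa psi_cls IjP opid.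
apply: torsion_free_basis gen => x n n0.
exact: (K0_torsion_free sd gldim PjP sa psi_cls n0).
Qed.
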